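(* Let $A$ and $B$ be local augmented convenient $C^\infty$-algebras, with associated functors $T_A,T_B:\mathcal{M}f_{\mathrm{fin}}\to\mathcal{M}f$ from the category of finite dimensional separable Hausdorff smooth manifolds to the category of smooth manifolds modelled on convenient vector spaces. Then: (1) One gets the convenient $C^\infty$-algebra $A$ back from the functor $T_A$ by restricting $T_A$ to the subcategory of the $\mathbb R^n$'s (and all smooth mappings between them). (2) The natural transformations $T_A\to T_B$ correspond exactly to the bounded $C^\infty$-algebra homomorphisms $A\to B$: assigning to a natural transformation $\varphi:T_A\to T_B$ its value $\varphi_{\mathbb R}:T_A(\mathbb R)=A\to T_B(\mathbb R)=B$ is a bijection onto the set of bounded $C^\infty$-algebra homomorphisms, with inverse $\psi\mapsto T(\psi,\;\cdot\;)$.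
   Context: Convenient calculus. A (Hausdorff, real) locally convex vector space $E$ is convenient if for each smooth curve $\mathbb R\to E$ the Riemann integrals over compact intervals exist in $E$. The $c^\infty$-topology on $E$ is the final topology with respect to all smooth curves. A mapping between $c^\infty$-open subsets of convenient vector spaces is smooth if it maps smooth curves to smooth curves; multilinear maps are smooth iff bounded. A smooth manifold is a set with a maximal atlas of charts (bijections onto $c^\infty$-open subsets of convenient vector spaces) with smooth chart changings defined on $c^\infty$-open subsets. A mapping between manifolds is smooth iff it maps smooth curves to smooth curves. A curve in $C^\infty(M,M')$ is smooth if the associated map $\mathbb R\times M\to M'$ is smooth, and a mapping between such function spaces is smooth if it maps smooth curves to smooth curves. $C^\infty$-algebras. A $C^\infty$-algebra is a product preserving functor $A$ from the category of the spaces $\mathbb R^n$ ($n\ge0$) and all smooth mappings between them to sets; one writes $A$ also for $A(\mathbb R)$, so a smooth $f:\mathbb R^n\to\mathbb R^m$ is interpreted as $A(f):A^n\to A^m$, compatibly with projections, compositions and identities. $A(\mathbb R)$ is a commutative real unital algebra with operations obtained by applying $A$ to those of $\mathbb R$ (we assume $A(\mathbb R)\neq$ point). Homomorphisms of $C^\infty$-algebras are natural transformations, i.e. algebra homomorphisms compatible with the interpretation of all smooth mappings. A local augmented convenient $C^\infty$-algebra is a $C^\infty$-algebra $A=\mathbb R\cdot1\oplus N$ which is a local ring with maximal ideal $N$, with augmentation $\pi=\pi_A:A\to A/N=\mathbb R$ (a surjective homomorphism of $C^\infty$-algebras), and which carries a compatible convenient structure: $A$ is a convenient vector space and each mapping $A:C^\infty(\mathbb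 R^n,\mathbb R^m)\to C^\infty(A^n,A^m)$ is well defined and smooth. The functor $T_A$. Put $T_A(\mathbb R^n)=A^n$, and $T_A(U)=(\pi^n)^{-1}(U)$ for $U\subseteq\mathbb R^n$ open. For a smooth $f:U\to W$ between open sets $U\subseteq\mathbb R^n$, $W\subseteq\mathbb R^m$, $T_A(f):T_A(U)\to T_A(W)$ is the unique map which over a neighborhood $V$ of each $x\in U$ coincides on $T_A(V)$ with $A(f_x)$, for any smooth $f_x:\mathbb R^n\to\mathbb R^m$ which equals $f$ on $V$ (this is well defined and smooth). For a manifold $M$ in $\mathcal{M}f_{\mathrm{fin}}$ with atlas $(U_\alpha,u_\alpha)$ and chart changings $u_{\alpha\beta}$, $T_AM$ is the manifold obtained by gluing the sets $T_A(u_\alpha(U_\alpha))$ via the maps $T_A(u_{\alpha\beta})$; $T_Af$ for smooth $f:M\to M'$ is obtained by applying $T_A$ to local representatives. For a bounded homomorphism $\psi:A\to B$, $T(\psi,\mathbb R^n)=\psi^n:A^n\to B^n$, and $T(\psi,M):T_AM\to T_BM$ is the (natural) map given in charts by restrictions of $\psi^m$, $m=\dim M$. *)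

(* Defs.v *)
From HB Require Import structures.
From mathcomp Require Import all_boot all_order all_algebra.
From mathcomp Require Import all_classical all_reals all_analysis.

Set Implicit Arguments.
Unset Strict Implicit.
Unset Printing Implicit Defensive.

Import Order.TTheory GRing.Theory Num.Theory numFieldNormedType.Exports.

Local Open Scope classical_set_scope.
Local Open Scope ring_scope.

Section TvsLimits.
Context {R : realType} {E : tvsType R}.
Context {T : Type} {F : set_system T} {FF : Filter F}.

Lemma tvs_cvgD (f g : T -> E) (a b : E) :
  f @ F --> a -> g @ F --> b -> (fun t => f t + g t) @ F --> a + b.
Proof.
move=> fa gb; apply: (@cvg_comp _ _ _ (fun t => (f t, g t))
  (fun z : E * E => z.1 + z.2) F (nbhs (a, b))); first exact: (cvg_pair fa gb).
exact: (@add_continuous E (a, b)).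
Qed.

Lemma tvs_cvgZ (p : T -> R) (f : T -> E) (r : R) (a : E) :
  p @ F --> r -> f @ F --> a -> (fun t => p t *: f t) @ F --> r *: a.
Proof.
move=> pr fa; apply: (@cvg_comp _ _ _ (fun t => (p t : R^o, f t))
  (fun z : R^o * E => z.1 *: z.2) F (nbhs (r : R^o, a))); first exact: (cvg_pair pr fa).
exact: (@scale_continuous R E (r : R^o, a)).
Qed.

End TvsLimits.

Definition tpower (R : realType) (E : tvsType R) (n : nat) := 'I_n -> E.

Section TPower.
Context {R : realType} (E : tvsType R) (n : nat).

HB.instance Definition _ := GRing.Lmodule.copy (tpower E n) ('I_n -> E).
HB.instance Definition _ :=
  Uniform.copy (tpower E n) (prod_topology (fun _ : 'I_n => E)).

Lemma tpower_proj_continuous i : continuous (fun a : tpower E n => a i).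
Proof. exact: (@proj_continuous _ (fun _ : 'I_n => E) i). Qed.

Lemma tpower_nbhsP (a : tpower E n) (W : set (tpower E n)) :
  nbhs a W <-> exists2 V : 'I_n -> set E, (forall i, nbhs (a i) (V i)) &
    [set b | forall i, V i (b i)] `<=` W.
Proof.
split; last first.
  move=> [V Va VW]; apply: filterS VW _.
  apply: (@filter_forall _ _ (fun i b => V i (b i)) (nbhs a)) => i.
  exact: (@tpower_proj_continuous i a _ (Va i)).
pose G : set_system (tpower E n) := [set W | exists2 V : 'I_n -> set E,
  (forall i, nbhs (a i) (V i)) & [set b | forall i, V i (b i)] `<=` W].
have FG : Filter G.
  split.
  - by exists (fun=> setT) => // i; exact: filterT.
  - move=> P Q [V Va VP] [V' Va' VQ]; exists (fun i => V i `&` V' i).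
      by move=> i; exact: filterI.
    by move=> b bV; split; [apply: VP|apply: VQ] => i; have [] := bV i.
  - by move=> P Q PQ [V Va VP]; exists V => // b /VP /PQ.
suff : G --> a by apply.
apply/cvg_sup => i U; rewrite nbhsE => -[U' [[B oB <-] Ba] BU].
exists (fun j => if j == i then B else setT).
  by move=> j; case: eqP => [->|_]; [exact: open_nbhs_nbhs|exact: filterT].
by move=> b /(_ i); rewrite eqxx => ?; exact: BU.
Qed.

Lemma tpower_cvg (T : Type) (F : set_system T) (FF : Filter F)
    (f : T -> tpower E n) (a : tpower E n) :
  (forall i, (fun t => f t i) @ F --> a i) -> f @ F --> a.
Proof.
move=> fa W /tpower_nbhsP[V Va VW]; apply: filterS VW _.
by apply: (@filter_forall _ _ (fun i t => V i (f t i)) F) => i; exact: (fa i _ (Va i)).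
Qed.

Let add_cont : continuous (fun x : tpower E n * tpower E n => x.1 + x.2).
Proof.
move=> [x y] /=; apply: tpower_cvg => i; apply: tvs_cvgD.
  apply: (@cvg_comp _ _ _ fst (fun a : tpower E n => a i) _ (nbhs x)).
    exact: cvg_fst.
  exact: tpower_proj_continuous.
apply: (@cvg_comp _ _ _ snd (fun a : tpower E n => a i) _ (nbhs y)).
  exact: cvg_snd.
exact: tpower_proj_continuous.
Qed.

Let scale_cont : continuous (fun z : R^o * tpower E n => z.1 *: z.2).
Proof.
move=> [r y] /=; apply: tpower_cvg => i; apply: tvs_cvgZ; first exact: cvg_fst.
apply: (@cvg_comp _ _ _ snd (fun a : tpower E n => a i) _ (nbhs y)).
  exact: cvg_snd.
exact: tpower_proj_continuous.
Qed.

Let locally_conv : exists2 B : set_system (tpower E n),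
  (forall b, b \in B -> convex_set b) & basis B.
Proof.
have [Be Bc [Bo Bb]] := @locally_convex R E.
exists [set W | open W /\ convex_set W]; first by move=> b /[!inE] -[].
split; first by move=> b [].
move=> a W /tpower_nbhsP[V Va VW].
have /choice[C CP] i : exists C, (Be C /\ C (a i)) /\ C `<=` V i.
  by have [C ? ?] := Bb (a i) (V i) (Va i); exists C.
exists [set b | forall i, C i (b i)].
  split; last by move=> i; have [[]] := CP i.
  split.
    rewrite openE => b Cb; apply/tpower_nbhsP; exists C => // i.
    apply: open_nbhs_nbhs; split; last exact: Cb.
    by apply: Bo; have [[]] := CP i.
  move=> x y l; rewrite !inE => Cx Cy i.
  have [[BC _] _] := CP i.
  have := Bc (C i) (mem_set BC) (x i) (y i) l.
  by rewrite !inE; apply.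
by move=> b Cb; apply: VW => i; have [_] := CP i; apply.
Qed.

HB.instance Definition _ := PreTopologicalNmodule_isTopologicalNmodule.Build
  (tpower E n) add_cont.
HB.instance Definition _ := TopologicalNmodule_isTopologicalLmodule.Build
  R (tpower E n) scale_cont.
HB.instance Definition _ :=
  Uniform_isTvs.Build R (tpower E n) locally_conv.

End TPower.
Section Curves.
Context {R : realType}.
Implicit Types E F : tvsType R.

Definition curve_deriv E (c : R -> E) (t : R) (v : E) : Prop :=
  (fun h : R => h^-1 *: (c (t + h) - c t)) @ 0^' --> v.

(* [d] is the sequence of iterated derivatives on [J], which is meant to be
   open *)
Definition smooth_curve_on E (J : set R) (c : R -> E) : Prop :=
  exists d : nat -> R -> E, (forall t, J t -> d 0%N t = c t) /\
    (forall k t, J t -> curve_deriv (d k) t (d k.+1 t)).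

Definition smooth_curve E (c : R -> E) : Prop := smooth_curve_on setT c.

Definition cinf_open E (U : set E) : Prop :=
  forall c : R -> E, smooth_curve c -> open (c @^-1` U).

Definition smooth_on E F (U : set E) (f : E -> F) : Prop :=
  forall c : R -> E, smooth_curve c -> (forall t, U (c t)) ->
    smooth_curve (f \o c).

Definition smooth E F (f : E -> F) : Prop := smooth_on setT f.

(* limit of Riemann sums over tagged partitions of mesh less than [del] *)
Definition riemann_integral E (c : R -> E) (a b : R) (I : E) : Prop :=
  forall W : set E, nbhs I W -> exists2 del : R, 0 < del &
    forall (n : nat) (x xi : nat -> R), x 0%N = a -> x n = b ->
      (forall i, (i < n)%N ->
         x i <= xi i <= x i.+1 /\ x i.+1 - x i < del) ->
      W (\sum_(i < n) (x i.+1 - x i) *: c (xi i)).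

Definition convenient E : Prop := hausdorff_space E /\
  forall c : R -> E, smooth_curve c -> forall a b : R, a <= b ->
    exists I, riemann_integral c a b I.

Definition tvs_bounded E (B : set E) : Prop :=
  forall U : set E, nbhs 0 U -> \forall r \near +oo%R, B `<=` *:%R r @` U.

Definition bounded_map E F (f : E -> F) : Prop :=
  forall B : set E, tvs_bounded B -> tvs_bounded (f @` B).

End Curves.

Section Manifolds.
Context {R : realType}.

(* The values of [ch_map] outside [ch_dom] are irrelevant *)
Record chart (X : Type) := Chart {
  ch_model : tvsType R ;
  ch_dom : set X ;
  ch_map : X -> ch_model }.

Definition is_chart (X : Type) (c : chart X) : Prop :=
  [/\ convenient (ch_model c),
      {in ch_dom c &, injective (ch_map c)} &
      cinf_open (ch_map c @` ch_dom c)].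

(* ch_map d \o f \o (ch_map c)^-1, defined as 0 where this makes no sense *)
Definition local_rep (X Y : Type) (c : chart X) (d : chart Y) (f : X -> Y)
    (e : ch_model c) : ch_model d :=
  if pselect (exists2 x, ch_dom c x & ch_map c x = e) is left h
  then ch_map d (f (s2val (cid2 h))) else 0.
Arguments local_rep {X Y} c d f e.

Definition compatible (X : Type) (c d : chart X) : Prop :=
  let W := ch_map c @` (ch_dom c `&` ch_dom d) in
  cinf_open W /\ smooth_on W (local_rep c d id).

(* The bare data of an atlas; the axioms are in [is_manifold] *)
Record premanifold := Premanifold {
  pt :> Type ;
  atlas : chart pt -> Prop }.
Arguments atlas : clear implicits.

Definition is_manifold (M : premanifold) : Prop :=
  [/\ forall c, atlas M c -> is_chart c,
      forall x : M, exists2 c, atlas M c & ch_dom c x,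
      forall c d, atlas M c -> atlas M d -> compatible c d &
      forall c, is_chart c ->
        (forall d, atlas M d -> compatible c d /\ compatible d c) ->
        atlas M c].

Definition max_atlas (X : Type) (S : chart X -> Prop) (c : chart X) : Prop :=
  is_chart c /\ forall d, S d -> compatible c d /\ compatible d c.

Definition smooth_mcurve (M : premanifold) (g : R -> M) : Prop :=
  forall t0 : R, exists (c : chart M) (J : set R),
    [/\ atlas M c, open J, J t0,
        forall t, J t -> ch_dom c (g t) & smooth_curve_on J (ch_map c \o g)].

Definition msmooth (M N : premanifold) (f : M -> N) : Prop :=
  forall g : R -> M, smooth_mcurve g -> smooth_mcurve (f \o g).

Definition mopen (M : premanifold) (W : set M) : Prop :=
  forall c, atlas M c -> cinf_open (ch_map c @` (W `&` ch_dom c)).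

Definition mhausdorff (M : premanifold) : Prop :=
  forall x y : M, x <> y -> exists U V : set M,
    [/\ mopen U, mopen V, U x, V y & U `&` V = set0].

Definition mseparable (M : premanifold) : Prop :=
  exists2 D : set M, countable D &
    forall W : set M, mopen W -> W !=set0 -> (D `&` W) !=set0.

Record fmanifold := FManifold {
  fm_pre :> premanifold ;
  fm_dim : nat ;
  fm_manifold : is_manifold fm_pre ;
  fm_chart : forall x : fm_pre, exists U (u : fm_pre -> 'rV[R]_fm_dim),
    atlas fm_pre (Chart U u) /\ U x ;
  fm_hausdorff : mhausdorff fm_pre ;
  fm_separable : mseparable fm_pre }.

Definition vchart (E : tvsType R) : chart E := Chart setT (@id E).

Definition vmanifold (E : tvsType R) : premanifold :=
  Premanifold (max_atlas (eq (vchart E))).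

End Manifolds.
Arguments local_rep {R X Y} c d f e.
Arguments atlas {R} M c : rename.
Arguments chart R X : clear implicits.
Arguments premanifold R : clear implicits.
Arguments fmanifold R : clear implicits.
Section CurveCalculus.
Context {R : realType}.
Implicit Types E F : tvsType R.

Lemma dnbhs0_nbhs E (f : R -> E) (a : E) :
  f @ 0^' --> a -> f 0 = a -> f @ (0 : R) --> a.
Proof.
move=> fa f0 W Wa; have H : \forall h \near (0 : R), h != 0 -> W (f h) by exact: (fa W Wa).
change (\forall h \near (0 : R), W (f h)); near=> h; have [->|h0] := eqVneq h 0.
  by rewrite f0; exact: nbhs_singleton.
by move: h0; near: h.
Unshelve. all: by end_near. Qed.

Lemma curve_deriv_cvg0 E (c : R -> E) t v : curve_deriv c t v ->
  (fun h => c (t + h)) @ (0 : R) --> c t.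
Proof.
move=> cv; apply: dnbhs0_nbhs; last by rewrite addr0.
have : (fun h : R => c t + h *: (h^-1 *: (c (t + h) - c t))) @ 0^' -->
    c t + 0 *: v.
  apply: tvs_cvgD; first exact: cvg_cst.
  apply: tvs_cvgZ => //.
  exact: (@cvg_within_filter _ _ id (nbhs (0 : R))).
rewrite scale0r addr0; apply: cvg_trans; apply: near_eq_cvg.
near=> h; rewrite scalerA divff ?scale1r ?subrKC//.
by near: h; exact: nbhs_dnbhs_neq.
Unshelve. all: by end_near. Qed.

Lemma curve_deriv_continuous E (c : R -> E) t v : curve_deriv c t v ->
  {for t, continuous c}.
Proof.
move=> /curve_deriv_cvg0 cv; rewrite /prop_for /continuous_at.
have -> : c = (fun h => c (t + h)) \o (fun s => s - t).
  by apply/funext => s /=; rewrite subrKC.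
apply: (@cvg_comp _ _ _ (fun s : R => s - t) (fun h => c (t + h))
  (nbhs t) (nbhs (0 : R))).
  by rewrite -(subrr t); apply: cvgB; [exact: cvg_id|exact: cvg_cst].
by move=> W /=; rewrite subrr addr0 => /cv.
Qed.

Lemma smooth_curve_deriv E (c : R -> E) : smooth_curve c ->
  exists2 c', smooth_curve c' & forall t, curve_deriv c t (c' t).
Proof.
move=> [d [d0 dS]]; exists (d 1%N).
  by exists (fun k => d k.+1); split => // k t _; exact: dS.
by move=> t; have <- : d 0%N = c by [apply/funext => s; exact: d0]; exact: dS.
Qed.

Lemma smooth_curve_continuous E (c : R -> E) : smooth_curve c -> continuous c.
Proof.
by move=> /smooth_curve_deriv[c' _ cc'] t; exact: curve_deriv_continuous (cc' t).
Qed.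

(* a class of curves closed under derivation consists of smooth curves *)
Lemma smooth_curve_coind E (P : (R -> E) -> Prop) :
  (forall c, P c -> exists2 c', P c' & forall t, curve_deriv c t (c' t)) ->
  forall c, P c -> smooth_curve c.
Proof.
move=> PP c Pc.
pose T := {c : R -> E | P c}.
have /choice[D DP] (x : T) : exists y : T, forall t,
    curve_deriv (sval x) t (sval y t).
  by case: x => x Px /=; have [c' Pc' cc'] := PP x Px; exists (exist _ c' Pc').
exists (fun k => sval (iter k D (exist _ c Pc))); split => //.
Qed.

Lemma curve_deriv_cst E (a : E) t : curve_deriv (fun=> a) t 0.
Proof.
rewrite /curve_deriv; under eq_fun do rewrite subrr scaler0; exact: cvg_cst.
Qed.

Lemma curve_derivD E (c d : R -> E) t v w : curve_deriv c t v ->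
  curve_deriv d t w -> curve_deriv (fun s => c s + d s) t (v + w).
Proof.
move=> cv dw; rewrite /curve_deriv.
under eq_fun do rewrite opprD addrACA scalerDr.
exact: tvs_cvgD.
Qed.

Lemma curve_derivZ E (p : R -> R) (c : R -> E) t r v : curve_deriv p t r ->
  curve_deriv c t v ->
  curve_deriv (fun s => p s *: c s) t (p t *: v + r *: c t).
Proof.
move=> pr cv; rewrite /curve_deriv.
have -> : (fun h => h^-1 *: (p (t + h) *: c (t + h) - p t *: c t)) =
    fun h => p (t + h) *: (h^-1 *: (c (t + h) - c t)) +
             (h^-1 *: (p (t + h) - p t)) *: c t.
  apply/funext => h; rewrite [h^-1 *: (p _ - _)]/(h^-1 * (p (t + h) - p t)).
  rewrite -[(h^-1 * _) *: _]scalerA [p (t + h) *: (h^-1 *: _)]scalerA [p (t + h) * _]mulrC -scalerA.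
  by rewrite -scalerDr; congr (_ *: _); rewrite scalerBr scalerBl addrA subrK.
apply: tvs_cvgD; last by apply: tvs_cvgZ => //; exact: cvg_cst.
apply: tvs_cvgZ => //.
have /curve_deriv_cvg0 := pr; exact: cvg_within_filter.
Qed.

Lemma curve_deriv_comp E (c : R -> E) (s : R -> R) t v r :
  curve_deriv c (s t) v -> curve_deriv s t r ->
  curve_deriv (c \o s) t (r *: v).
Proof.
move=> cv sr.
pose Q (k : R) := if k == 0 then v else k^-1 *: (c (s t + k) - c (s t)).
have Qv : Q @ (0 : R) --> v.
  apply: dnbhs0_nbhs; last by rewrite /Q eqxx.
  apply: cvg_trans cv; apply: near_eq_cvg; near=> k; rewrite /Q ifF//.
  by apply/negbTE; near: k; exact: nbhs_dnbhs_neq.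
have : (fun h => (h^-1 *: (s (t + h) - s t)) *: Q (s (t + h) - s t)) @ 0^' -->
    r *: v.
  apply: tvs_cvgZ => //.
  apply: (@cvg_comp _ _ _ (fun h => s (t + h) - s t) Q _ (nbhs (0 : R))) => //.
  suff : (fun h => s (t + h) - s t) @ 0^' --> s t - s t by rewrite subrr.
  apply: cvgB; last exact: cvg_cst.
  have /curve_deriv_cvg0 := sr; exact: cvg_within_filter.
rewrite /curve_deriv; apply: cvg_trans; apply: near_eq_cvg.
near=> h; rewrite /Q /=; case: eqP => [|/eqP] k0.
  by rewrite k0 -[s (t + h)](subrK (s t)) k0 add0r subrr !scaler0 scale0r.
rewrite subrKC scalerA [h^-1 *: _]/(h^-1 * _) /= mulfK.
Unshelve. all: by end_near. Qed.

Lemma is_derive_curve (f : R -> R) (t r : R) : is_derive t 1 f r -> curve_deriv f t r.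
Proof.
move=> [fl <-]; rewrite /curve_deriv.
have -> : (fun h : R => h^-1 *: (f (t + h) - f t)) =
    (fun h => h^-1 *: ((f \o shift t) (h *: 1) - f t)).
  by apply/funext => h; rewrite /= [h *: 1]mulr1 [h + t]addrC.
exact: fl.
Qed.

End CurveCalculus.
Section Localization.
Context {R : realType}.
Implicit Types E F : tvsType R.

Inductive trig_curve E (d : nat -> R -> E) (s : R -> R) : (R -> E) -> Prop :=
| trig_base k : trig_curve d s (d k \o s)
| trig_add f g : trig_curve d s f -> trig_curve d s g ->
    trig_curve d s (fun t => f t + g t)
| trig_scale r f : trig_curve d s f -> trig_curve d s (fun t => r *: f t)
| trig_sin f : trig_curve d s f -> trig_curve d s (fun t => sin t *: f t)
| trig_cos f : trig_curve d s f -> trig_curve d s (fun t => cos t *: f t).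

Lemma smooth_curve_sin E (c : R -> E) (t0 r : R) : smooth_curve c ->
  smooth_curve (fun t => c (t0 + r * sin t)).
Proof.
move=> [d [d0 dS]]; pose s t := t0 + r * sin t.
have -> : (fun t => c (t0 + r * sin t)) = d 0%N \o s.
  by apply/funext => t; rewrite /= d0.
apply: (@smooth_curve_coind _ _ (trig_curve d s)); last exact: trig_base.
have sder t : curve_deriv s t (r * cos t).
  have -> : r * cos t = 0 + (r * cos t + 0 * sin t) by rewrite mul0r addr0 add0r.
  apply: (@curve_derivD _ R (fun=> t0)); first exact: curve_deriv_cst.
  apply: (@curve_derivZ _ R (fun=> r)); first exact: curve_deriv_cst.
  exact: is_derive_curve.
move=> f; elim=> {f} [k|f g _ [f' ? ff'] _ [g' ? gg']|a f _ [f' ? ff']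
  |f Pf [f' ? ff']|f Pf [f' ? ff']].
- exists (fun t => r *: (cos t *: (d k.+1 \o s) t)).
    exact/trig_scale/trig_cos/trig_base.
  by move=> t; rewrite scalerA; apply: curve_deriv_comp => //; exact: dS.
- by exists (fun t => f' t + g' t); [exact: trig_add|move=> t; exact: curve_derivD].
- exists (fun t => a *: f' t); first exact: trig_scale.
  move=> t; rewrite -[a *: f' t]addr0 -(scale0r (f t)).
  by apply: (@curve_derivZ _ _ (fun=> a)) => //; exact: curve_deriv_cst.
- exists (fun t => sin t *: f' t + cos t *: f t).
    by apply: trig_add; [exact: trig_sin|exact: trig_cos].
  by move=> t; apply: curve_derivZ => //; exact: is_derive_curve.
- exists (fun t => cos t *: f' t + -1 *: (sin t *: f t)).
    by apply: trig_add; [exact: trig_cos|exact/trig_scale/trig_sin].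
  move=> t; rewrite scalerA mulN1r.
  by apply: curve_derivZ => //; exact: is_derive_curve.
Qed.

Lemma cinf_open_preimage E F (U : set E) (f : E -> F) (W : set F) :
  cinf_open U -> smooth_on U f -> cinf_open W ->
  cinf_open [set e | U e /\ W (f e)].
Proof.
move=> Uo fS Wo c cS; rewrite openE => t0 [Ut0 Wt0].
have := Uo c cS; rewrite openE => /(_ _ Ut0); rewrite /interior /= => Jt0.
have [e /= e0 eJ] := (nbhs_ballP _ _).1 Jt0.
pose s t := t0 + (e / 2) * sin t.
have sU t : U (c (s t)).
  apply: eJ; rewrite /ball /= /s opprD addNKr normrN normrM gtr0_norm ?divr_gt0//.
  apply: (@le_lt_trans _ _ (e / 2)); last by rewrite ltr_pdivrMr// ltr_pMr// ltr1n.
  by rewrite ler_piMr ?divr_ge0 ?(ltW e0)// sin_max.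
have fcs := fS _ (smooth_curve_sin t0 (e / 2) cS) sU.
have := Wo _ fcs; rewrite openE => /(_ 0).
have s0 : s 0 = t0 by rewrite /s sin0 mulr0 addr0.
rewrite /= -/(s 0) s0 => /(_ Wt0); rewrite /interior /= => V0.
pose q t := (t - t0) * (2 / e).
have q0 : q t @[t --> t0] --> (0 : R).
  rewrite -[0](mul0r (2 / e)) -(subrr t0).
  by apply: cvgMl; apply: cvgB; [exact: cvg_id|exact: cvg_cst].
have aq0 : asin (q t) @[t --> t0] --> (0 : R).
  apply: (@cvg_comp _ _ _ q asin _ (nbhs (0 : R))) => //.
  have : {for 0, continuous (@asin R)} by apply: continuous_asin; rewrite ltrN10 ltr01.
  have asin0 : asin (0 : R) = 0.
    rewrite -{1}sin0 sinK// in_itv /= oppr_le0 andbb.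
    by rewrite divr_ge0// pi_ge0.
  by rewrite /prop_for /continuous_at asin0.
near=> t.
have qt : q t \in `[-1, 1].
  rewrite in_itv /= -ler_norml ltW//; near: t.
  by have /cvgr0Pnorm_lt/(_ _ ltr01) := q0.
have st : s (asin (q t)) = t.
  rewrite /s asinK// /q mulrCA -[e / 2 * _]mulrA [2^-1 * _]mulrA mulVf// mul1r.
  by rewrite divff ?gt_eqF// mulr1 subrKC.
split; first by near: t.
have : W (f (c (s (asin (q t))))) by near: t; exact: (aq0 _ V0).
by rewrite st.
Unshelve. all: by end_near. Qed.

End Localization.
Section VectorSpaceManifold.
Context {R : realType} (E : tvsType R) (E_conv : convenient E).

Lemma open_cinf_open (U : set E) : open U -> cinf_open U.
Proof. by move=> oU c /smooth_curve_continuous /continuousP; exact. Qed.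

Lemma local_repE (X Y : Type) (c : chart R X) (d : chart R Y) (f : X -> Y) x :
  {in ch_dom c &, injective (ch_map c)} -> ch_dom c x ->
  local_rep c d f (ch_map c x) = ch_map d (f x).
Proof.
move=> cI cx; rewrite /local_rep; case: pselect => [h|[]]; last by exists x.
by congr (ch_map d (f _)); apply: cI; rewrite ?inE//; case: (cid2 h).
Qed.

Lemma vchart_inj : {in ch_dom (vchart E) &, injective (ch_map (vchart E))}.
Proof. by []. Qed.

Lemma is_chart_vchart : is_chart (vchart E).
Proof.
split => //; rewrite (_ : _ @` _ = setT); last first.
  by rewrite eqEsubset; split => // x _; exists x.
exact/open_cinf_open/openT.
Qed.

Lemma compatible_vchart : compatible (vchart E) (vchart E).
Proof.
split.
  rewrite setIid; have [] := is_chart_vchart; by [].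
by move=> c cS _; rewrite (_ : _ \o c = c)//; apply/funext => t; exact: local_repE.
Qed.

Lemma vmanifold_vchart : atlas (vmanifold E) (vchart E).
Proof.
by split; [exact: is_chart_vchart|move=> _ <-; split; exact: compatible_vchart].
Qed.

Lemma vmanifold_chart_inv (c : chart R E) : atlas (vmanifold E) c ->
  [/\ {in ch_dom c &, injective (ch_map c)}, cinf_open (ch_map c @` ch_dom c),
      smooth_on (ch_map c @` ch_dom c) (local_rep c (vchart E) id) &
      smooth_on (ch_dom c) (ch_map c)].
Proof.
move=> [[_ cI co] /(_ _ erefl)[[_ c1] [_ c2]]]; split => //.
  by move: c1; rewrite setIT.
move=> g gS gc; have := c2 g gS.
rewrite (_ : _ \o g = ch_map c \o g); last by apply/funext => t; exact: local_repE.
by apply => t; exists (g t).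
Qed.

Lemma vmanifold_image_open (c : chart R E) (W : set E) :
  atlas (vmanifold E) c -> cinf_open W ->
  cinf_open (ch_map c @` (W `&` ch_dom c)).
Proof.
move=> /vmanifold_chart_inv[cI co cS _] oW.
rewrite (_ : _ @` _ = [set e | (ch_map c @` ch_dom c) e /\
    W (local_rep c (vchart E) id e)]); first exact: cinf_open_preimage.
rewrite eqEsubset; split => [_ [x [Wx cx] <-]|_ [[x cx <-]]] /=.
  by split; [exists x|rewrite local_repE].
by rewrite local_repE// => Wx; exists x.
Qed.

Lemma vmanifold_dom_open (c : chart R E) :
  atlas (vmanifold E) c -> cinf_open (ch_dom c).
Proof.
move=> [_ /(_ _ erefl)[_ []]] /=; rewrite setTI (_ : id @` _ = ch_dom c)//.
by rewrite eqEsubset; split => [_ [x ? <-]|x]//; exists x.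
Qed.

Lemma vmanifold_is_manifold : is_manifold (vmanifold E).
Proof.
split.
- by move=> c [].
- by move=> x; exists (vchart E) => //; exact: vmanifold_vchart.
- move=> c d cA dA.
  have [cI co cS _] := vmanifold_chart_inv cA.
  have [_ _ _ dS] := vmanifold_chart_inv dA.
  split.
    rewrite setIC; apply: vmanifold_image_open => //.
    exact: vmanifold_dom_open.
  move=> g gS gW.
  have gc t : (ch_map c @` ch_dom c) (g t).
    by have [x [cx _] xg] := gW t; exists x.
  rewrite (_ : _ \o g = ch_map d \o (local_rep c (vchart E) id \o g)).
    apply: dS; first exact: cS.
    by move=> t; have [x [cx dx] xg] := gW t; rewrite /= -xg local_repE.
  apply/funext => t; have [x [cx dx] xg] := gW t.
  by rewrite /= -xg !local_repE.
- move=> c cC cA; split => // _ <-; apply: cA; exact: vmanifold_vchart.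
Qed.

Lemma vmanifold_mopen (W : set (vmanifold E)) :
  mopen W <-> cinf_open (W : set E).
Proof.
split=> [/(_ _ vmanifold_vchart)|oW c cA]; last exact: vmanifold_image_open.
by rewrite setIT (_ : _ @` W = W)//; rewrite eqEsubset; split => [_ [x ? <-]|x]//; exists x.
Qed.

Lemma vmanifold_hausdorff : mhausdorff (vmanifold E).
Proof.
move=> x y xy; have [+ _] := E_conv; rewrite open_hausdorff.
move=> /(_ x y)[|[U V] /= [xU yV] [oU oV UV]]; first exact/eqP.
exists U, V; split; [exact/vmanifold_mopen/open_cinf_open|
  exact/vmanifold_mopen/open_cinf_open|exact/set_mem|exact/set_mem|exact/eqP].
Qed.

End VectorSpaceManifold.
Section EuclideanSpace.
Context {R : realType}.

Lemma curve_is_derive (f : R -> R) (t r : R) : curve_deriv f t r -> is_derive t 1 f r.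
Proof.
rewrite /curve_deriv.
have -> : (fun h : R => h^-1 *: (f (t + h) - f t)) =
    (fun h => h^-1 *: ((f \o shift t) (h *: 1) - f t)).
  by apply/funext => h; rewrite /= [h *: 1]mulr1 [h + t]addrC.
by move=> fr; apply: DeriveDef; [apply/cvg_ex; exists r|exact: cvg_lim fr].
Qed.

Lemma antiderivative (f : R -> R) (a b : R) : continuous f ->
  exists F : R -> R, forall x, a <= x <= b -> is_derive x 1 F (f x).
Proof.
move=> fc; pose F (x : R) := (\int[lebesgue_measure]_(t in `[(a - 1)%R, x]) (f t))%R.
exists F => x /andP[ax xb].
have xb1 : x < b + 1 by rewrite (le_lt_trans xb)// ltrDl.
have ax1 : a - 1 < x by rewrite (lt_le_trans _ ax)// ltrBlDr ltrDl.
have fi : lebesgue_measure.-integrable `[a - 1, b + 1] (EFin \o f).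
  apply: continuous_compact_integrable; first exact: segment_compact.
  exact: continuous_subspaceT.
have [dF eF] := continuous_FTC1_closed xb1 fi ax1 (fc x).
by rewrite -eF derive1E; exact: derivableP.
Qed.

Lemma smooth_curve_lipschitz (c : R -> R) (a b : R) : smooth_curve c -> a <= b ->
  exists2 K, 0 <= K & forall s t, a <= s <= b -> a <= t <= b ->
    `|c s - c t| <= K * `|s - t|.
Proof.
move=> /smooth_curve_deriv[c' /smooth_curve_continuous c'c cc'] ab.
have [|m _ mP] := @EVT_max R (fun t => `|c' t|) a b ab.
  by apply: continuous_subspaceT => t; apply: continuous_comp; [exact: c'c|exact: norm_continuous].
exists `|c' m| => // s t; wlog st : s t / s <= t => [H sI tI|].
  have [st|/ltW ts] := leP s t; first exact: H.
  by rewrite distrC [`|s - t|]distrC; exact: H.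
move=> /andP[a_s sb] /andP[a_t tb].
have c'P x : x \in `]s, t[ -> is_derive x 1 c (c' x).
  by move=> _; exact: curve_is_derive.
have ct : {within `[s, t], continuous c}.
  apply: continuous_subspaceT => x; exact: curve_deriv_continuous (cc' x).
have [e eI ce] := MVT_segment st c'P ct.
rewrite distrC ce normrM [`|s - t|]distrC ler_wpM2r//; apply: mP.
move: eI; rewrite !in_itv /= => /andP[se et].
by rewrite (le_trans a_s se) (le_trans et tb).
Qed.

Lemma riemann_integral_real (c : R -> R) (a b : R) : smooth_curve c -> a <= b ->
  exists I, riemann_integral c a b I.
Proof.
move=> cS ab.
have [K K0 cK] := smooth_curve_lipschitz cS ab.
have [F Fc] := antiderivative a b (smooth_curve_continuous cS).
exists (F b - F a) => W /nbhs_ballP[e /= e0 eW].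
pose M := K * (b - a) + 1.
have M0 : 0 < M by rewrite ltr_wpDl// mulr_ge0// subr_ge0.
exists (e / M); first by rewrite divr_gt0.
move=> n x xi x0 xn xP; apply: eW.
have xS i : (i < n)%N -> x i <= x i.+1.
  by move=> /xP[/andP[xxi xix] _]; exact: le_trans xxi xix.
have ax i : (i <= n)%N -> a <= x i.
  elim: i => [|i IHi] lin; first by rewrite x0.
  by apply: le_trans (xS _ lin); apply: IHi; exact: ltnW.
have xb i : (i <= n)%N -> x i <= b.
  move=> /subnKC; move: (n - i)%N => k; elim: k i => [|k IHk] i ikn.
    by rewrite -xn -ikn addn0.
  have lin : (i < n)%N by rewrite -ikn addnS ltnS leq_addr.
  by apply: (le_trans (xS _ lin)); apply: IHk; rewrite -ikn addnS addSn.
rewrite /ball /= -x0 -xn -(telescope_sumr (F \o x) (leq0n n)) big_mkord -sumrB.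
apply: (@le_lt_trans _ _ (\sum_(i < n) (x i.+1 - x i) * (K * (e / M)))).
  apply: le_trans (ler_norm_sum _ _ _) _; apply: ler_sum => i _ /=.
  have [/andP[xxi xix] xd] := xP i (ltn_ord i).
  have aI t : x i <= t <= x i.+1 -> a <= t <= b.
    move=> /andP[it ti]; rewrite (le_trans (ax _ (ltnW (ltn_ord i))) it) /=.
    by rewrite (le_trans ti)// xb.
  have FP t : t \in `]x i, x i.+1[ -> is_derive t 1 F (c t).
    by rewrite in_itv /= => /andP[/ltW it /ltW ti]; apply/Fc/aI/andP.
  have Fct : {within `[x i, x i.+1], continuous F}.
    apply: derivable_within_continuous => t; rewrite in_itv /= => /aI /Fc.
    by case.
  have [y yI ->] := MVT_segment (xS _ (ltn_ord i)) FP Fct.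
  have -> : c y * (x i.+1 - x i) - (x i.+1 - x i) *: c (xi i) =
      (x i.+1 - x i) * (c y - c (xi i)).
    by rewrite [c y * _]mulrC [RHS]mulrBr.
  have D0 : 0 <= x i.+1 - x i by rewrite subr_ge0 xS.
  rewrite normrM ger0_norm// ler_wpM2l//.
  move: yI; rewrite in_itv /= => yI.
  apply: le_trans (cK _ _ (aI _ yI) (aI _ _)) _; first by rewrite xxi xix.
  rewrite ler_wpM2l// (le_trans _ (ltW xd))//.
  case/andP: yI => yi iy.
  by rewrite ler_norml lerNl opprB !lerB.
have -> : \sum_(i < n) (x i.+1 - x i) * (K * (e / M)) = (b - a) * (K * (e / M)).
  rewrite -mulr_suml; congr (_ * _).
  by rewrite -x0 -xn -(telescope_sumr x (leq0n n)) big_mkord.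
rewrite mulrA [(b - a) * K]mulrC mulrCA -[ltRHS]mulr1 ltr_pM2l//.
by rewrite ltr_pdivrMr// mul1r /M ltrDl.
Qed.

Lemma curve_deriv_coord n (c : R -> 'rV[R]_n) t v i : curve_deriv c t v ->
  curve_deriv (fun s => c s ord0 i) t (v ord0 i).
Proof.
move=> cv; rewrite /curve_deriv.
have -> : (fun h : R => h^-1 *: (c (t + h) ord0 i - c t ord0 i)) =
    (fun M : 'rV[R]_n => M ord0 i) \o (fun h => h^-1 *: (c (t + h) - c t)).
  by apply/funext => h; rewrite /= !mxE.
apply: (@cvg_comp _ _ _ _ _ _ (nbhs v)); first exact: cv.
exact: coord_continuous.
Qed.

Lemma smooth_curve_coord n (c : R -> 'rV[R]_n) i : smooth_curve c ->
  smooth_curve (fun s => c s ord0 i).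
Proof.
move=> [d [d0 dS]]; exists (fun k t => d k t ord0 i); split.
  by move=> t _; rewrite d0.
by move=> k t _; apply: curve_deriv_coord; exact: dS.
Qed.

Lemma convenient_rV n : convenient 'rV[R]_n.
Proof.
split; first exact: norm_hausdorff.
move=> c cS a b ab.
have /choice[I IP] i := riemann_integral_real (smooth_curve_coord i cS) ab.
exists (\row_i I i) => W [P PI PW].
pose Q i del := forall (k : nat) (x xi : nat -> R), x 0%N = a -> x k = b ->
  (forall j, (j < k)%N -> x j <= xi j <= x j.+1 /\ x j.+1 - x j < del) ->
  P ord0 i (\sum_(j < k) (x j.+1 - x j) *: c (xi j) ord0 i).
have QP i : \forall del \near 0^'+, Q i del.
  have [del del0 dP] : exists2 del, 0 < del & Q i del.
    by have := PI ord0 i; rewrite mxE => /(IP i).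
  near=> e => k x xi x0 xk xP; apply: dP => // j jk.
  have [xx xd] := xP j jk; split => //; apply: lt_le_trans xd _.
  by near: e; exact: nbhs_right_le.
have : \forall del \near (0 : R)^'+, (forall i, Q i del) /\ 0 < del.
  near=> del; split.
    by near: del; exact: (@filter_forall _ _ Q).
  by near: del; exact: nbhs_right_gt.
move=> /filter_ex[del [dQ del0]]; exists del => // k x xi x0 xk xP.
apply: PW => i j; rewrite (ord1 i) summxE.
under eq_bigr do rewrite mxE.
exact: dQ.
Unshelve. all: by end_near. Qed.

Lemma smooth_curve_line (E : tvsType R) (a v : E) :
  smooth_curve (fun t : R => a + t *: v).
Proof.
apply: (@smooth_curve_coind _ _ (fun c => exists a v, c = fun t : R => a + t *: v));
  last by exists a, v.
move=> _ [b [w ->]]; exists (fun t => w + t *: 0); first by exists w, 0.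
move=> t.
have -> : w + t *: 0 = 0 + (t *: 0 + 1 *: w).
  by rewrite scale1r scaler0 addr0 !add0r.
apply: (@curve_derivD _ _ (fun=> b)); first exact: curve_deriv_cst.
apply: (@curve_derivZ _ _ id); last exact: curve_deriv_cst.
exact: is_derive_curve.
Qed.

Section Rn.
Variable n : nat.

Lemma Rn_chart (x : vmanifold 'rV[R]_n) :
  exists U (u : vmanifold 'rV[R]_n -> 'rV[R]_n),
    atlas (vmanifold 'rV[R]_n) (Chart U u) /\ U x.
Proof.
by exists setT, id; split => //; exact/vmanifold_vchart/convenient_rV.
Qed.

Lemma Rn_separable : mseparable (vmanifold 'rV[R]_n).
Proof.
exists (range (map_mx (@ratr R) : 'rV[rat]_n -> 'rV[R]_n)).
  exact: sub_countable (card_image_le _ _) (countableP _).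
move=> W /(vmanifold_mopen (convenient_rV n)) oW [v0 Wv0].
have [v Wv vQ] : exists2 v, W v &
    forall i : 'I_n, (i < n)%N -> exists q, v ord0 i = ratr q.
  suff H k : (k <= n)%N -> exists2 v, W v &
      forall i : 'I_n, (i < k)%N -> exists q, v ord0 i = ratr q by exact: H.
  elim: k => [_|k IHk kn]; first by exists v0.
  have [v Wv vQ] := IHk (ltnW kn).
  pose i0 := Ordinal kn; pose w : 'rV[R]_n := delta_mx ord0 i0.
  have := oW _ (smooth_curve_line v w); rewrite openE => /(_ 0).
  rewrite /= scale0r addr0 => /(_ Wv) /nbhs_ballP[e /= e0 eW].
  have [q] : exists q, ratr q \in `]v ord0 i0, (v ord0 i0 + e)[.
    by apply: rat_in_itvoo; rewrite ltrDl.
  rewrite in_itv /= => /andP[vq qv].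
  exists (v + (ratr q - v ord0 i0) *: w).
    apply: eW; rewrite /ball /= sub0r normrN gtr0_norm ?subr_gt0//.
    by rewrite ltrBlDl.
  move=> i; rewrite ltnS leq_eqVlt => /orP[/eqP ik|ik].
    exists q; have -> : i = i0 by exact: val_inj.
    by rewrite !mxE !eqxx mulr1 subrKC.
  have [p vp] := vQ i ik; exists p.
  rewrite !mxE eqxx /= (_ : (i == i0) = false) ?mulr0 ?addr0//.
  by apply/negbTE; rewrite -val_eqE /= ltn_eqF.
have /choice[q qP] (i : 'I_n) : exists q, v ord0 i = ratr q by exact: vQ.
exists v; split => //; exists (\row_i q i) => //.
by apply/rowP => i; rewrite !mxE qP.
Qed.

Definition Rn : fmanifold R :=
  FManifold (vmanifold_is_manifold (convenient_rV n)) Rn_chart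
    (vmanifold_hausdorff (convenient_rV n)) Rn_separable.

End Rn.

End EuclideanSpace.
Arguments Rn : clear implicits.
Section CinfAlgebras.
Context {R : realType}.

(* A product preserving functor on the spaces R^n, normalized so that
   A(R^n) = A^n: [F n m f] is A(f) when [f] is smooth, and an irrelevant value
   otherwise *)
Definition interpretation (A : Type) : Type :=
  forall n m : nat, ('rV[R]_n -> 'rV[R]_m) -> ('I_n -> A) -> ('I_m -> A).

Record is_cinf_algebra (A : Type) (F : interpretation A) : Prop := {
  cinf_id : forall n (a : 'I_n -> A), F n n id a = a ;
  cinf_comp : forall n m p (f : 'rV[R]_n -> 'rV[R]_m) (g : 'rV[R]_m -> 'rV[R]_p),
    smooth f -> smooth g ->
    forall a : 'I_n -> A, F n p (g \o f) a = F m p g (F n m f a) ;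
  cinf_proj : forall n (i : 'I_n) (a : 'I_n -> A),
    F n 1%N (fun v => \row_(_ < 1) v ord0 i) a = (fun=> a i) ;
  cinf_nontrivial : exists a b : A, a <> b }.

Definition cinf_hom (A B : Type) (F : interpretation A) (G : interpretation B)
    (psi : A -> B) : Prop :=
  forall n m (f : 'rV[R]_n -> 'rV[R]_m), smooth f ->
    forall a : 'I_n -> A, psi \o F n m f a = G n m f (psi \o a).

Definition real_interpretation : interpretation R :=
  fun n m f a j => f (\row_i a i) ord0 j.

Section Operations.
Variables (A : zmodType) (F : interpretation A).

Definition cinf_one : A := F (fun=> const_mx 1 : 'rV_1) (fun _ : 'I_0 => 0) ord0.

Definition cinf_scale (r : R) (a : A) : A :=
  F (fun v : 'rV_1 => r *: v) (fun=> a) ord0.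

Definition cinf_add (a b : A) : A :=
  F (fun v : 'rV_2 => \row_(_ < 1) (v ord0 0 + v ord0 1))
    (fun i => if i == 0 then a else b) ord0.

Definition cinf_mul (a b : A) : A :=
  F (fun v : 'rV_2 => \row_(_ < 1) (v ord0 0 * v ord0 1))
    (fun i => if i == 0 then a else b) ord0.

Definition is_ideal (I : set A) : Prop :=
  [/\ I 0, forall a b, I a -> I b -> I (a + b) &
      forall a b, I b -> I (cinf_mul a b)].

Definition maximal_ideal (I : set A) : Prop :=
  [/\ is_ideal I, I != setT &
      forall J, is_ideal J -> I `<=` J -> J = I \/ J = setT].

End Operations.

(* [lca_add] and [lca_scale] identify the linear structure of [lca_space] with
   the one coming from the interpretation of the operations of R; [lca_local]
   says that N is the unique maximal ideal *)
Record local_convenient_algebra := {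
  lca_space :> tvsType R ;
  lca_interp : interpretation lca_space ;
  lca_aug : lca_space -> R ;
  lca_cinf : is_cinf_algebra lca_interp ;
  lca_add : forall a b, cinf_add lca_interp a b = a + b ;
  lca_scale : forall r a, cinf_scale lca_interp r a = r *: a ;
  lca_aug_hom : cinf_hom lca_interp real_interpretation lca_aug ;
  lca_aug_surj : forall r, exists a, lca_aug a = r ;
  lca_split : let N := [set a | lca_aug a = 0] in
    forall a, exists! rx : R * lca_space,
      N rx.2 /\ a = rx.1 *: cinf_one lca_interp + rx.2 ;
  lca_local : let N := [set a | lca_aug a = 0] in
    forall I, maximal_ideal lca_interp I <-> I = N ;
  lca_convenient : convenient lca_space ;
  lca_wd : forall n m (f : 'rV[R]_n -> 'rV[R]_m), smooth f ->
    smooth (lca_interp f : tpower lca_space n -> tpower lca_space m) ;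
  (* A : C^infty(R^n, R^m) -> C^infty(A^n, A^m) maps smooth curves
     to smooth curves *)
  lca_smooth : forall n m (f : R -> 'rV[R]_n -> 'rV[R]_m),
    smooth (fun p : R * 'rV[R]_n => f p.1 p.2) ->
    smooth (fun p : R * tpower lca_space n =>
      lca_interp (f p.1) p.2 : tpower lca_space m) }.

Definition bounded_hom (A B : local_convenient_algebra) (psi : A -> B) : Prop :=
  cinf_hom (@lca_interp A) (@lca_interp B) psi /\ bounded_map psi.

Lemma smooth_cst (E F : tvsType R) (a : F) : smooth (fun _ : E => a).
Proof.
move=> c _ _; rewrite /comp /=; have := smooth_curve_line a 0.
by under eq_fun do rewrite scaler0 addr0.
Qed.

Lemma smooth_scale (E : tvsType R) (r : R) : smooth (fun a : E => r *: a).
Proof.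
move=> c [d [d0 dS]] _; exists (fun k t => r *: d k t); split.
  by move=> t _; rewrite /= d0.
move=> k t _; rewrite -[r *: d k.+1 t]addr0 -(scale0r (d k t)).
apply: (@curve_derivZ _ _ (fun=> r)); first exact: curve_deriv_cst.
exact: dS.
Qed.

Lemma lca_aug_scale_one (A : local_convenient_algebra) (r : R) :
  lca_aug (r *: cinf_one (@lca_interp A)) = r.
Proof.
have hom n (f : 'rV[R]_n -> 'rV[R]_1) a : smooth f ->
    lca_aug (lca_interp f a ord0) = f (\row_i (@lca_aug A (a i))) ord0 ord0.
  by move=> fS; have /(congr1 (@^~ ord0)) := @lca_aug_hom A _ _ _ fS a.
rewrite -(lca_scale r) hom; last exact: smooth_scale.
by rewrite mxE mxE hom ?mxE ?mulr1//; exact: smooth_cst.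
Qed.

End CinfAlgebras.
Arguments local_convenient_algebra : clear implicits.

Section WeilFunctor.
Context {R : realType} (A : local_convenient_algebra R).

Definition aug_pow n (a : tpower A n) : 'rV[R]_n := \row_i lca_aug (a i).

(* The value of T_A(f) at [a], for [f] smooth near [aug_pow a]: any global smooth
   map with the germ of [f] there can serve as [g] *)
Definition TA_loc n m (f : 'rV[R]_n -> 'rV[R]_m) (a : tpower A n) : tpower A m :=
  xget 0 [set b | exists g : 'rV[R]_n -> 'rV[R]_m,
    [/\ smooth g, \forall y \near aug_pow a, g y = f y & b = lca_interp g a]].

Section Objects.
Variable M : fmanifold R.

(* Points of the disjoint union of the sets T_A(u(U)), (U, u) a chart of [M] *)
Record TA_rep := TARep {
  tr_dom : set M ;
  tr_map : M -> 'rV[R]_(fm_dim M) ;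
  tr_val : tpower A (fm_dim M) }.

Definition tr_chart (p : TA_rep) : chart R M := Chart (tr_dom p) (tr_map p).

Definition TA_valid (p : TA_rep) : Prop :=
  atlas M (tr_chart p) /\ (tr_map p @` tr_dom p) (aug_pow (tr_val p)).

Definition TA_glue (p q : TA_rep) : Prop :=
  [/\ TA_valid p, TA_valid q,
      (tr_map p @` (tr_dom p `&` tr_dom q)) (aug_pow (tr_val p)) &
      TA_loc (local_rep (tr_chart p) (tr_chart q) id) (tr_val p) = tr_val q].

Definition TA_point : Type :=
  {C : set TA_rep | exists2 p, TA_valid p & C = TA_glue p}.

Definition TA_class (p : TA_rep) (pv : TA_valid p) : TA_point :=
  exist _ (TA_glue p : set TA_rep) (ex_intro2 _ _ p pv erefl).

Definition TA_chart (U : set M) (u : M -> 'rV[R]_(fm_dim M)) :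
    chart R TA_point :=
  Chart [set t : TA_point | exists a, sval t (TARep U u a)]
    (fun t : TA_point => xget 0 [set a | sval t (TARep U u a)]).

Definition TA : premanifold R :=
  Premanifold (max_atlas (fun c =>
    exists U u, atlas M (Chart U u) /\ c = TA_chart U u)).

Lemma TA_base_ex (t : TA) : exists x : M, exists p,
  [/\ TA_valid p, sval t = TA_glue p, tr_dom p x &
      tr_map p x = aug_pow (tr_val p)].
Proof.
case: t => C /= [p pv CE]; have [pA [x px xp]] := pv.
by exists x, p.
Qed.

Definition TA_base (t : TA) : M := sval (cid (TA_base_ex t)).

Lemma TA_zero_ex (x : M) : exists t : TA, exists p,
  [/\ TA_valid p, sval t = TA_glue p, tr_dom p x &
      tr_val p = fun i => tr_map p x ord0 i *: cinf_one (@lca_interp _ A)].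
Proof.
have [U [u [uA Ux]]] := fm_chart x.
pose p := TARep U u (fun i => u x ord0 i *: cinf_one (@lca_interp _ A)).
have pv : TA_valid p.
  split => //; exists x => //; apply/rowP => i.
  by rewrite mxE lca_aug_scale_one.
by exists (TA_class pv), p.
Qed.

Definition TA_zero (x : M) : TA := sval (cid (TA_zero_ex x)).

End Objects.

Definition pick_or (T : Type) (x0 : T) (P : set T) : T :=
  if pselect (exists x, P x) is left h then sval (cid h) else x0.

(* The default value only serves to make the definition total *)
Definition TA_map (M N : fmanifold R) (f : M -> N) (t : TA M) : TA N :=
  pick_or (TA_zero (f (TA_base t)))
    [set s : TA_point N | exists (p : TA_rep M) (q : TA_rep N),
      [/\ sval t p, sval s q,
          exists x, [/\ tr_dom p x, tr_map p x = aug_pow (tr_val p) &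
                        tr_dom q (f x)] &
          tr_val q = TA_loc (local_rep (tr_chart p) (tr_chart q) f) (tr_val p)]].

Lemma TA_Rn_valid n (a : tpower A n) :
  @TA_valid (Rn R n) (@TARep (Rn R n) setT id a).
Proof.
split; first exact/vmanifold_vchart/convenient_rV.
by exists (aug_pow a).
Qed.

(* The identification of T_A(R^n) with A^n given by the chart [id] of R^n *)
Definition TA_Rn n (t : TA (Rn R n)) : tpower A n :=
  ch_map (@TA_chart (Rn R n) setT id) t.

Definition Rn_TA n (a : tpower A n) : TA (Rn R n) := TA_class (TA_Rn_valid a).

End WeilFunctor.
Arguments TA {R} A M.
Arguments TA_map {R} A {M N} f t.
Arguments TA_Rn {R} A n t.
Arguments Rn_TA {R} A n a.

Section NaturalTransformations.
Context {R : realType}.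

Definition is_functor (T : fmanifold R -> premanifold R)
    (Tm : forall M N : fmanifold R, (M -> N) -> T M -> T N) : Prop :=
  [/\ forall M, is_manifold (T M),
      forall (M N : fmanifold R) (f : M -> N), msmooth f -> msmooth (Tm M N f),
      forall M, Tm M M id = id &
      forall (M N P : fmanifold R) (f : M -> N) (g : N -> P),
        msmooth f -> msmooth g -> Tm M P (g \o f) = Tm N P g \o Tm M N f].

Variables A B : local_convenient_algebra R.

Definition natural (phi : forall M : fmanifold R, TA A M -> TA B M) : Prop :=
  (forall M, msmooth (phi M)) /\
  forall (M N : fmanifold R) (f : M -> N), msmooth f ->
    phi N \o TA_map A f = TA_map B f \o phi M.

Definition at_R (phi : forall M : fmanifold R, TA A M -> TA B M) (a : A) : B :=
  TA_Rn B 1 (phi (Rn R 1) (Rn_TA A 1 (fun=> a))) ord0.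

(* T(psi, M); the default value plays the same role as in [TA_map] *)
Definition T_hom (psi : A -> B) (M : fmanifold R) (t : TA A M) : TA B M :=
  pick_or (TA_zero B (TA_base t))
    [set s : TA_point B M | exists U u a,
      sval t (TARep U u a) /\ sval s (TARep U u (psi \o a))].

End NaturalTransformations.

(* Main.v *)
(* The statement rests on two facts about a local algebra A with augmentation pi. First, A(f)(a)
   depends only on the germ of f at pi(a): elements outside ker pi are invertible, so a bump
   function X around pi(a) gives an invertible A(X)(a). Second, although pi is not assumed to
   be continuous, pi o c is continuous along every smooth curve c: A(X) o c is continuous, equal
   to 1 where X is 1 near pi(c(t)), and equal to 0 where pi(c(t)) leaves the support of X; hence
   the sets T_A(U) are c^infty-open. The functor T_A then comes from composing germs of chart
   representatives.

   A natural transformation phi is determined on the R^n's by psi = phi_R because projections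
   are smooth. On a manifold M, extend a chart u near x to a smooth map M -> R^n and use
   naturality; this requires phi to preserve base points, which follows from the fact that psi
   preserves augmentations and smooth functions separate the points of M. Bounded linear maps
   are the same as smooth ones, by the special curve lemma in one direction and by the
   boundedness of second order Taylor remainders in the other. *)

Require Import Defs.
From mathcomp Require Import all_boot all_order all_algebra.
From mathcomp Require Import all_classical all_reals all_analysis.
From mathcomp Require Import ring lra.

Set Implicit Arguments.
Unset Strict Implicit.
Unset Printing Implicit Defensive.

Import Order.TTheory GRing.Theory Num.Theory numFieldNormedType.Exports.

Local Open Scope classical_set_scope.
Local Open Scope ring_scope.

(** * Smooth curves *)

(** Smoothness is tested only on curves defined on the whole line, whereas charts and germs give
    local data. The device that bridges this is [reparam]: a smooth self-map of the line with values
    in a prescribed open set around t0 and equal to the identity near t0. It makes [smooth_at],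
    agreement near t0 with a globally smooth curve, the working notion, and Hausdorff targets allow
    local derivatives to be glued. For products, compositions, reciprocals and flat curves no
    formula for higher derivatives is used: it suffices to exhibit a class of curves whose
    derivatives are sums of members of the class. All cutoffs descend from e^(-1/t). A point of T_A
    M is a class of representatives, and maps between such classes are defined by choice. All
    reasoning is therefore done on representatives, each with its base point, through [push];
    well-definedness, transitivity of the gluing and functoriality are then one computation with
    germs, [push_push]. *)

Section SmoothCurves.
Context {R : realType}.
Implicit Types E F : tvsType R.

Lemma curve_deriv_unique E (c : R -> E) t v w : hausdorff_space E ->
  curve_deriv c t v -> curve_deriv c t w -> v = w.
Proof. by move=> hE cv cw; exact: (cvg_unique hE cv cw). Qed.

Lemma near_shift0 (t : R) (P : R -> Prop) :
  (\forall s \near t, P s) -> \forall h \near (0 : R), P (t + h).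
Proof.
have tc : (fun h : R => t + h) @ (0 : R) --> t.
  by rewrite -[X in _ --> X]addr0; apply: cvgD; [exact: cvg_cst|exact: cvg_id].
by move=> /tc.
Qed.

Lemma curve_deriv_near E (c d : R -> E) t v :
  (\forall s \near t, c s = d s) -> curve_deriv c t v -> curve_deriv d t v.
Proof.
move=> cd; have ctdt := nbhs_singleton cd.
apply: cvg_trans; apply: near_eq_cvg.
have H := near_shift0 cd.
have : \forall h \near 0^', c (t + h) = d (t + h) by exact: cvg_within H.
by apply: filterS => h ->; rewrite ctdt.
Qed.

Lemma smooth_curve_onS E (J J' : set R) (c : R -> E) : J' `<=` J ->
  smooth_curve_on J c -> smooth_curve_on J' c.
Proof.
move=> J'J [d [d0 dS]]; exists d; split=> [t /J'J|k t /J'J]; [exact: d0|exact: dS].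
Qed.

Lemma smooth_curve_on_ext E (J : set R) (c d : R -> E) :
  (forall t, J t -> c t = d t) -> smooth_curve_on J c -> smooth_curve_on J d.
Proof.
by move=> cd [D [D0 DS]]; exists D; split=> // t Jt; rewrite D0// cd.
Qed.

(** Limits in a Hausdorff space are unique, so two towers of derivatives with the same bottom agree
    on the overlap at every level. This serves both to glue towers and to see that all derivatives
    of a bump vanish off its support. *)
Lemma smooth_curve_on_deriv_unique E (J J' : set R) (d d' : nat -> R -> E) :
  hausdorff_space E -> open J -> open J' ->
  (forall t, J t -> J' t -> d 0%N t = d' 0%N t) ->
  (forall k t, J t -> curve_deriv (d k) t (d k.+1 t)) ->
  (forall k t, J' t -> curve_deriv (d' k) t (d' k.+1 t)) ->
  forall k t, J t -> J' t -> d k t = d' k t.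
Proof.
move=> hE oJ oJ' d0 dS dS'; elim=> [//|k IHk] t Jt J't.
apply: (curve_deriv_unique hE (dS k t Jt)).
apply: curve_deriv_near (dS' k t J't).
have : \forall s \near t, (J `&` J') s.
  by apply: open_nbhs_nbhs; split=> //; exact: openI.
by apply: filterS => s [Js J's]; rewrite IHk.
Qed.

Lemma smooth_curve_local E (c : R -> E) : hausdorff_space E ->
  (forall t0, exists J : set R, [/\ open J, J t0 & smooth_curve_on J c]) ->
  smooth_curve c.
Proof.
move=> hE /choice[J JP].
have /choice[d dP] t0 : exists d : nat -> R -> E,
    (forall t, J t0 t -> d 0%N t = c t) /\
    (forall k t, J t0 t -> curve_deriv (d k) t (d k.+1 t)).
  by have [_ _] := JP t0.
(* Each derivative at t is read off the tower chosen at t itself; near t it agrees with the towers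
   chosen at the neighbouring points. *)
exists (fun k t => d t k t); split=> [t _|k t _].
  by have [_ Jt _] := JP t; have [d0 _] := dP t; rewrite d0.
have [oJ Jt _] := JP t; have [d0 dS] := dP t.
apply: curve_deriv_near (dS k t Jt).
have : \forall s \near t, J t s by apply: open_nbhs_nbhs.
apply: filterS => s Js; have [oJs Jss _] := JP s; have [ds0 dsS] := dP s.
apply: (smooth_curve_on_deriv_unique hE oJ oJs _ dS dsS) => // u Ju Jsu.
by rewrite d0// ds0.
Qed.

(** The product rule turns one generator into a sum of generators, so the coinduction runs on the
    closure of a class under sums. *)
Inductive curve_sums E (P : (R -> E) -> Prop) : (R -> E) -> Prop :=
| curve_sums_base f : P f -> curve_sums P f
| curve_sums_add f g : curve_sums P f -> curve_sums P g ->
    curve_sums P (fun t => f t + g t).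

Lemma smooth_curve_coind_sum E (P : (R -> E) -> Prop) :
  (forall c, P c -> exists2 c', curve_sums P c' &
    forall t, curve_deriv c t (c' t)) ->
  forall c, P c -> smooth_curve c.
Proof.
move=> PP c Pc; apply: (@smooth_curve_coind _ _ (curve_sums P)); last first.
  exact: curve_sums_base.
move=> f; elim=> {f} [f /PP//|f g _ [f' Pf' ff'] _ [g' Pg' gg']].
exists (fun t => f' t + g' t); first exact: curve_sums_add.
by move=> t; exact: curve_derivD.
Qed.

Lemma smooth_curve_cst E (a : E) : smooth_curve (fun=> a : E).
Proof.
have := smooth_curve_line a 0; by under eq_fun do rewrite scaler0 addr0.
Qed.

Lemma smooth_curve_id : smooth_curve (@id R).
Proof.
have := @smooth_curve_line R R 0 1.
by under eq_fun do rewrite add0r [_ *: _]mulr1.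
Qed.

Lemma smooth_curveD E (c d : R -> E) :
  smooth_curve c -> smooth_curve d -> smooth_curve (fun t => c t + d t).
Proof.
move=> [c' [c0 cS]] [d' [d0 dS]]; exists (fun k t => c' k t + d' k t); split.
  by move=> t _; rewrite c0// d0.
by move=> k t _; apply: curve_derivD; [exact: cS|exact: dS].
Qed.


Lemma smooth_curveZ E (p : R -> R) (c : R -> E) :
  smooth_curve p -> smooth_curve c -> smooth_curve (fun t => p t *: c t).
Proof.
move=> pS cS; apply: (@smooth_curve_coind_sum E (fun f => exists (p : R -> R) (c : R -> E),
  [/\ smooth_curve p, smooth_curve c & f = fun t => p t *: c t])); last first.
  by exists p, c.
move=> _ [q [d [qS dS ->]]].
have [q' q'S qq'] := smooth_curve_deriv qS.
have [d' d'S dd'] := smooth_curve_deriv dS.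
exists (fun t => q t *: d' t + q' t *: d t); last first.
  by move=> t; exact: curve_derivZ.
by apply: curve_sums_add; apply: curve_sums_base; [exists q, d'|exists q', d].
Qed.

(** The curves p(t) d_k(s(t)), with p smooth and d_k a derivative of c, are closed under derivation
    up to sums; this replaces the formula of Faa di Bruno. *)
Lemma smooth_curve_comp_on E (J : set R) (c : R -> E) (s : R -> R) :
  smooth_curve_on J c -> smooth_curve s -> (forall t, J (s t)) ->
  smooth_curve (c \o s).
Proof.
move=> [d [d0 dS]] sS sJ.
have [s' s'S ss'] := smooth_curve_deriv sS.
have -> : c \o s = fun t => 1 *: d 0%N (s t).
  by apply/funext => t; rewrite scale1r d0.
apply: (@smooth_curve_coind_sum E (fun f => exists (p : R -> R) (k : nat),
  smooth_curve p /\ f = fun t => p t *: d k (s t))); last first.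
  by exists (fun=> 1), 0%N; split=> //; exact: smooth_curve_cst.
move=> _ [p [k [pS ->]]].
have [p' p'S pp'] := smooth_curve_deriv pS.
exists (fun t => (p t * s' t) *: d k.+1 (s t) + p' t *: d k (s t)).
  apply: curve_sums_add; apply: curve_sums_base; last by exists p', k.
  by exists (fun t => p t * s' t), k.+1; split=> //; exact: smooth_curveZ.
move=> t; rewrite -scalerA; apply: curve_derivZ => //.
by apply: curve_deriv_comp => //; exact: dS.
Qed.

Lemma smooth_curve_comp E (c : R -> E) (s : R -> R) :
  smooth_curve c -> smooth_curve s -> smooth_curve (c \o s).
Proof. by move=> cS sS; exact: smooth_curve_comp_on cS sS _. Qed.

Lemma curve_derivX (c : R -> R) (n : nat) (t r : R) : curve_deriv c t r ->
  curve_deriv (fun s => c s ^+ n) t (n%:R * (r * c t ^+ n.-1)).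
Proof.
move=> cr; elim: n => [|n IHn]; first by rewrite mul0r; exact: curve_deriv_cst.
have -> : (fun s => c s ^+ n.+1) = fun s => c s *: c s ^+ n.
  by apply/funext => s; rewrite exprS.
have := curve_derivZ cr IHn; congr (curve_deriv _ _ _).
rewrite /GRing.scale /= -[n.+1%:R]natr1.
by case: (n) => [|m]; rewrite /= ?expr0 ?exprS; ring.
Qed.

Lemma smooth_curve_inv (c : R -> R) : smooth_curve c -> (forall t, 0 < c t) ->
  smooth_curve (fun t => (c t)^-1).
Proof.
move=> cS c_gt0; have [c' c'S cc'] := smooth_curve_deriv cS.
have cV t : curve_deriv (fun s => (c s)^-1) t (- (c t) ^- 2 *: c' t).
  apply: is_derive_curve; apply: is_deriveV => //; first by rewrite gt_eqF.
  exact: curve_is_derive.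
apply: (@smooth_curve_coind_sum R (fun f => exists (p : R -> R) (k : nat),
  smooth_curve p /\ f = fun t => p t *: (c t)^-1 ^+ k)); last first.
  exists (fun=> 1), 1%N; split; first exact: smooth_curve_cst.
  by apply/funext => t; rewrite scale1r expr1.
have cVX k t : curve_deriv (fun s => (c s)^-1 ^+ k) t
    (- k%:R * (c' t * (c t)^-1 ^+ k.+1)).
  have := @curve_derivX _ k _ _ (cV t); congr (curve_deriv _ _ _).
  rewrite /GRing.scale /= -exprVn.
  by case: k => [|k]; rewrite /= ?exprS ?expr0; ring.
move=> _ [p [k [pS ->]]].
have [p' p'S pp'] := smooth_curve_deriv pS.
exists (fun t => (p t * (- k%:R * c' t)) *: (c t)^-1 ^+ k.+1 + p' t *: (c t)^-1 ^+ k).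
  apply: curve_sums_add; apply: curve_sums_base; last by exists p', k.
  exists (fun t => p t * (- k%:R * c' t)), k.+1; split=> //.
  by do 2! apply: smooth_curveZ => //; exact: smooth_curve_cst.
move=> t; rewrite -scalerA; apply: curve_derivZ => //.
by rewrite /GRing.scale /= -mulrA; exact: cVX.
Qed.

End SmoothCurves.

(** * Bounded sets and flat curves *)

Section BoundedSets.
Context {R : realType}.
Implicit Types E F : tvsType R.

Lemma nbhs0_balanced E (U : set E) : nbhs 0 U ->
  exists2 V : set E, nbhs 0 V &
    forall (l : R) v, `|l| <= 1 -> V v -> U (l *: v).
Proof.
move=> U0.
have /= : nbhs ((0 : R^o) *: (0 : E)) U by rewrite scaler0.
move=> /(@scale_continuous R E (0 : R^o, 0 : E)) [[A B] /= [A0 B0] AB].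
have [e /= e0 eA] := (nbhs_ballP _ _).1 A0.
(* The factor 2/e trades the scalars of the ball of radius e for those of absolute value at most 1,
   with a margin since the ball is open. *)
exists [set v | B ((2 / e) *: v)].
  have : (fun v : E => (2 / e) *: v) @ (0 : E) --> (2 / e) *: (0 : E).
    by apply: tvs_cvgZ; [exact: cvg_cst|exact: cvg_id].
  by rewrite scaler0 => /(_ _ B0).
move=> l v l1 Bv.
have -> : l *: v = (l * (e / 2)) *: ((2 / e) *: v).
  by rewrite scalerA; congr (_ *: _); field; rewrite gt_eqF.
apply: (AB (_, _)); split=> //=; apply: eA.
rewrite /ball /= sub0r normrN normrM (gtr0_norm (divr_gt0 e0 _))//.
rewrite (le_lt_trans (ler_piMl _ l1)) ?divr_ge0 ?(ltW e0)//.
by rewrite ltr_pdivrMr// ltr_pMr// ltr1n.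
Qed.

(** Small scalars of either sign replace large dilations: by a balanced neighbourhood inside U,
    absorption by a single r extends to all scalars of absolute value at most 1/r. *)
Lemma tvs_boundedP E (B : set E) : tvs_bounded B <->
  forall U, nbhs 0 U -> exists2 d : R, 0 < d &
    forall l b, `|l| <= d -> B b -> U (l *: b).
Proof.
split=> [Bb U /nbhs0_balanced[V V0 VU]|H U /H[d d0 dU]].
  have : \forall r \near +oo, 0 < r /\ B `<=` *:%R r @` V.
    by apply: filterI; [exact: nbhs_pinfty_gt (num_real _)|exact: Bb].
  move=> /filter_ex[r [r0 rB]]; exists r^-1; first by rewrite invr_gt0.
  move=> l b lr /rB[v Vv <-]; rewrite scalerA; apply: VU => //.
  by rewrite normrM (gtr0_norm r0) -ler_pdivlMr// mul1r.
have : \forall r \near +oo, d^-1 < r by exact: nbhs_pinfty_gt (num_real _).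
apply: filterS => r dr b Bb.
have r0 : 0 < r by rewrite (lt_trans _ dr)// invr_gt0.
exists (r^-1 *: b); last by rewrite scalerA divff ?scale1r// gt_eqF.
apply: dU => //; rewrite gtr0_norm ?invr_gt0//.
by rewrite -[leRHS]invrK lef_pV2 ?posrE ?invr_gt0// ltW.
Qed.

Lemma tvs_bounded_normed (V : normedModType R) (B : set V) (C : R) :
  (forall b, B b -> `|b| <= C) -> tvs_bounded B.
Proof.
move=> BC; apply/tvs_boundedP => U /nbhs_ballP[e /= e0 eU].
have C0 : 0 < `|C| + 1 by rewrite ltr_wpDl.
exists (e / 2 / (`|C| + 1)); first by rewrite !divr_gt0.
move=> l b ld Bb; apply: eU; rewrite -ball_normE /ball_ /= sub0r normrN normrZ.
apply: (@le_lt_trans _ _ (e / 2 / (`|C| + 1) * (`|C| + 1))).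
  apply: ler_pM => //; apply: (le_trans (BC b Bb)).
  by rewrite (le_trans (ler_norm C))// lerDl.
by rewrite divfK ?gt_eqF// ltr_pdivrMr// ltr_pMr// ltr1n.
Qed.

Section Flat.
Variable E : tvsType R.

(* With y = 1 / t these are the curves y^n e^(-y) g(y), which are flat at 0 and, for
   bounded g, closed under derivation; see [flat_deriv]. *)
Definition flat (n : nat) (g : R -> E) (t : R) : E :=
  if 0 < t then (t^-1 ^+ n * expR (- t^-1)) *: g t^-1 else 0.

(** With y = 1/t, the estimate e^y >= (y/(n+1))^(n+1) leaves one spare power of y, that is, a factor
    t, which makes the weight tend to 0 at 0. *)
Lemma flat_weight_le (n : nat) (t : R) : 0 < t ->
  t^-1 ^+ n * expR (- t^-1) <= n.+1%:R ^+ n.+1 * t.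
Proof.
move=> t0; set y := t^-1; have y0 : 0 < y by rewrite invr_gt0.
have n0 : 0 < n.+1%:R :> R by rewrite ltr0n.
have ye : (y / n.+1%:R) ^+ n.+1 <= expR y.
  have -> : expR y = expR (y / n.+1%:R) ^+ n.+1.
    by rewrite -expRM_natl mulrCA mulfV ?mulr1 ?gt_eqF.
  rewrite lerXn2r ?nnegrE ?expR_ge0 ?divr_ge0 ?(ltW y0) ?(ltW n0)//.
  by rewrite (le_trans _ (expR_ge1Dx _))// lerDr.
rewrite expRN ler_pdivrMr ?expR_gt0//.
have -> : y ^+ n = n.+1%:R ^+ n.+1 * t * (y / n.+1%:R) ^+ n.+1.
  rewrite expr_div_n [y ^+ n.+1]exprS -[t]invrK -/y.
  have := expf_neq0 n.+1 (lt0r_neq0 n0); move: (_ ^+ n.+1) => N N0; field.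
  by rewrite N0 gt_eqF.
by rewrite ler_wpM2l// mulr_ge0 ?exprn_ge0 ?(ltW t0) ?(ltW n0).
Qed.

Lemma flat_cvg0 n g : tvs_bounded (range g) -> flat n g @ (0 : R) --> (0 : E).
Proof.
move=> /tvs_boundedP gb W W0; have [d d0 dW] := gb W W0.
pose C : R := n.+1%:R ^+ n.+1.
have C0 : 0 < C by rewrite exprn_gt0// ltr0n.
change (\forall t \near (0 : R), W (flat n g t)).
near=> t; rewrite /flat; case: ifPn => [t0|_]; last exact: nbhs_singleton.
apply: dW; last by exists t^-1.
rewrite ger0_norm ?mulr_ge0 ?exprn_ge0 ?expR_ge0 ?invr_ge0 ?(ltW t0)//.
apply: (le_trans (flat_weight_le n t0)); rewrite -/C mulrC -ler_pdivlMr//.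
by apply: ltW; near: t; apply: lt_nbhsl; rewrite divr_gt0.
Unshelve. all: by end_near. Qed.

(** Since dy/dt = -y^2 for y = 1/t, differentiating y^n e^(-y) g(y) gives three terms of weights
    y^(n+1), y^(n+2) and y^(n+2). *)
Lemma flat_deriv n g g' : tvs_bounded (range g) ->
  (forall s, curve_deriv g s (g' s)) -> forall t, curve_deriv (flat n g) t
    (- n%:R *: flat n.+1 g t + 1 *: flat n.+2 g t + - 1 *: flat n.+2 g' t).
Proof.
move=> gb gg' t; have [t0|t0|->] := ltgtP t 0.
- rewrite /flat !ifF ?(le_gtF (ltW t0))// !scaler0 !addr0.
  apply: (@curve_deriv_near _ _ (fun=> 0)); last exact: curve_deriv_cst.
  have : \forall s \near t, s < 0 by exact: lt_nbhsl.
  by apply: filterS => s s0; rewrite (le_gtF (ltW s0)).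
- apply: (@curve_deriv_near _ _
      ((fun y => (y ^+ n * expR (- y)) *: g y) \o (fun s => s^-1))).
    have : \forall s \near t, 0 < s by exact: lt_nbhsr.
    by apply: filterS => s s0; rewrite /flat s0.
  have dV : curve_deriv (fun s : R => s^-1) t (- t ^- 2).
    have := @is_deriveV R id t 1 1; rewrite gt_eqF// => /(_ isT (is_derive_id _ _)).
    by move=> /is_derive_curve; rewrite [_ *: _]mulr1.
  have dX := @curve_derivX _ _ n _ _ (@is_derive_curve _ id t^-1 1 (is_derive_id _ _)).
  have dN : curve_deriv (fun y : R => - y) t^-1 (- 1).
    by apply: is_derive_curve; exact: is_deriveN.
  have dE := curve_deriv_comp (is_derive_curve (is_derive_expR _)) dN.
  have dG := curve_deriv_comp (curve_derivZ (curve_derivZ dX dE) (gg' t^-1)) dV.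
  congr (curve_deriv _ t _): dG.
  rewrite /flat t0 scalerDr !scalerA [in LHS]addrC -scalerDl.
  rewrite -exprVn; set y := t^-1; set e := expR (- y).
  rewrite -scalerDl; congr (_ *: _ + _ *: _); rewrite /GRing.scale /=; last by rewrite -/e !exprS expr0; ring.
  by case: (n) => [|m]; rewrite /= ?expr0 !exprS ?expr0 -?[m.+1%:R]natr1; ring.
- rewrite /flat ltxx !scaler0 !addr0 /curve_deriv.
  (* The difference quotient at 0 is again a flat curve, with exponent raised by one, so [flat_cvg0]
     applies to it. *)
  have -> : (fun h => h^-1 *: (flat n g (0 + h) - flat n g 0)) = flat n.+1 g.
    apply/funext => h; rewrite add0r /flat ltxx subr0.
    by case: ifP => _; rewrite ?scaler0// scalerA mulrA exprS.
  have := @flat_cvg0 n.+1 g gb; exact: cvg_within_filter.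
Qed.

End Flat.
End BoundedSets.

(** * The special curve lemma *)

Section SpecialCurve.
Context {R : realType}.
Implicit Types E F : tvsType R.

Lemma smooth_flat E (d : nat -> R -> E) :
  (forall k t, curve_deriv (d k) t (d k.+1 t)) ->
  (forall k, tvs_bounded (range (d k))) -> smooth_curve (flat 0 (d 0%N)).
Proof.
move=> dS db; have -> : flat 0 (d 0%N) = fun t => 1 *: flat 0 (d 0%N) t.
  by apply/funext => t; rewrite scale1r.
apply: (@smooth_curve_coind_sum _ E (fun f => exists (r : R) (n k : nat),
  f = fun t => r *: flat n (d k) t)); last by exists 1, 0%N, 0%N.
move=> _ [r [n [k ->]]].
exists (fun t => (r * - n%:R) *: flat n.+1 (d k) t + r *: flat n.+2 (d k) t +
    (- r) *: flat n.+2 (d k.+1) t).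
  apply: curve_sums_add; [apply: curve_sums_add|]; apply: curve_sums_base.
  - by exists (r * - n%:R), n.+1, k.
  - by exists r, n.+2, k.
  - by exists (- r), n.+2, k.+1.
move=> t; have := @flat_deriv _ _ n _ _ (db k) (dS k) t.
move=> /(curve_derivZ (curve_deriv_cst r t)).
by rewrite scale0r addr0 !scalerDr !scalerA mulr1 mulrN1.
Qed.

(** The classical function e^(-1/t), extended by 0 to t <= 0. *)
Definition eflat : R -> R := flat 0 (fun=> 1 : R).

Lemma eflat_le0 t : t <= 0 -> eflat t = 0.
Proof. by move=> t0; rewrite /eflat /flat ltNge t0. Qed.

Lemma eflat_gt0 t : 0 < t -> 0 < eflat t.
Proof. by move=> t0; rewrite /eflat /flat t0 expr0 mul1r [_ *: _]mulr1 expR_gt0. Qed.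

Lemma eflat_ge0 t : 0 <= eflat t.
Proof.
by have [/eflat_le0->//|/eflat_gt0/ltW] := leP t 0.
Qed.

Lemma smooth_eflat : smooth_curve eflat.
Proof.
apply: (@smooth_flat R (fun k _ => if k is 0 then 1 else 0)).
  by move=> [|k] t; exact: curve_deriv_cst.
move=> k; apply: (@tvs_bounded_normed _ R _ 1) => _ [t _ <-].
by case: k => [|k]; rewrite ?normr0 ?normr1.
Qed.

(** The margins of 1/4 at both ends of the unit interval make integer translates vanish near all
    integers, so that they can be strung together smoothly. *)
Lemma bump01 : exists d : nat -> R -> R, [/\
  forall k t, curve_deriv (d k) t (d k.+1 t), 0 < d 0%N 2^-1 &
  forall k t, t < 4^-1 \/ 3 / 4 < t -> d k t = 0].
Proof.
pose h (t : R) := eflat (t - 4^-1) * eflat (3 / 4 - t).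
have hS : smooth_curve h.
  apply: smooth_curveZ; apply: (smooth_curve_comp smooth_eflat).
    by apply: smooth_curveD; [exact: smooth_curve_id|exact: smooth_curve_cst].
  apply: smooth_curveD; first exact: smooth_curve_cst.
  have := smooth_curveZ (@smooth_curve_cst _ R^o (-1)) smooth_curve_id.
  by under eq_fun do rewrite [_ *: _]mulN1r.
have [d [d0 dS]] := hS; exists d; split.
- by move=> k t; exact: dS.
- by rewrite d0// /h mulr_gt0// eflat_gt0//; lra.
(* On the open sets where the bump is 0, the zero tower is another tower of derivatives of it, so
   uniqueness kills every derivative. *)
- have hR : hausdorff_space R by exact: norm_hausdorff.
  pose J : set R := [set t | t < 4^-1]; pose J' : set R := [set t | 3 / 4 < t].
  have oJ : open J by exact: open_lt.
  have oJ' : open J' by exact: open_gt.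
  move=> k t [tJ|tJ].
    apply: (@smooth_curve_on_deriv_unique _ _ setT J d (fun _ _ => 0)) => //;
      [exact: openT|move=> u _ Ju|by move=> *; exact: curve_deriv_cst].
    by rewrite d0// /h eflat_le0 ?mul0r//; rewrite /J /= in Ju; lra.
  apply: (@smooth_curve_on_deriv_unique _ _ setT J' d (fun _ _ => 0)) => //;
    [exact: openT|move=> u _ Ju|by move=> *; exact: curve_deriv_cst].
  by rewrite d0// /h [eflat (_ - u)]eflat_le0 ?mulr0//; rewrite /J' /= in Ju; lra.
Qed.

Lemma curve_deriv_shift E (c : R -> E) a t v : curve_deriv c (t + a) v ->
  curve_deriv (fun s => c (s + a)) t v.
Proof. by rewrite /curve_deriv; under [in X in _ -> X]eq_fun do rewrite addrAC. Qed.

Section Train.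
Variables (E : tvsType R) (b : nat -> E).
Variable d : nat -> R -> R.
Hypotheses (bb : tvs_bounded (range b))
  (dS : forall k t, curve_deriv (d k) t (d k.+1 t))
  (dz : forall k t, t < 4^-1 \/ 3 / 4 < t -> d k t = 0).

(* [d 0] is a bump on [0, 1]; its n-th translate carries the point [b n]. Substituting
   s = 1 / t in this bounded train of bumps and damping it by e^(-1 / t) gives a curve
   through small multiples of the points [b n]. *)
Let train k (s : R) : E := d k (s - (Num.floor s)%:~R) *: b `|Num.floor s|%N.

Let train_deriv k s : curve_deriv (train k) s (train k.+1 s).
Proof.
(* Off the integers the floor is locally constant and one translate is differentiated; near an
   integer the train is 0, thanks to the margins of the bump. *)
have [sN|sN] := eqVneq ((Num.floor s)%:~R : R) s; last first.
  pose N := Num.floor s.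
  have NsN : N%:~R < s < (N + 1)%:~R.
    by rewrite lt_neqAle sN floor_le floorD1_gt.
  apply: (@curve_deriv_near _ _ (fun s' => d k (s' - N%:~R) *: b `|N|%N)).
    have : \forall s' \near s, N%:~R < s' < (N + 1)%:~R.
      near=> s'; apply/andP; split; near: s'; [apply: lt_nbhsr|apply: lt_nbhsl];
      by case/andP: NsN.
    apply: filterS => s' /andP[Ns' s'N]; rewrite /train (@floor_def _ s' N)//.
    by rewrite (ltW Ns').
  have := curve_derivZ (curve_deriv_shift (@dS k (s - N%:~R)))
    (curve_deriv_cst (b `|N|%N) s).
  by rewrite scaler0 add0r.
have dn0 k' : \forall s' \near s, train k' s' = 0.
  pose N := Num.floor s; rewrite -/N in sN.
  have : \forall s' \near s, s - 4^-1 < s' < s + 4^-1.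
    near=> s'; apply/andP; split; near: s'; [apply: lt_nbhsr|apply: lt_nbhsl]; lra.
  apply: filterS => s' /andP[s's ss']; rewrite /train dz ?scale0r//.
  have [Ns'|s'N] := leP s s'.
    have -> : Num.floor s' = N by apply: floor_def; rewrite intrD sN; lra.
    by left; lra.
  have -> : Num.floor s' = N - 1.
    by apply: floor_def; rewrite subrK intrD sN; lra.
  by right; rewrite intrD sN; lra.
rewrite (nbhs_singleton (dn0 k.+1)).
apply: (@curve_deriv_near _ _ (fun=> 0)); last exact: curve_deriv_cst.
by apply: filterS (dn0 k) => s' ->.
Unshelve. all: by end_near. Qed.

Let train_bounded k : tvs_bounded (range (train k)).
Proof.
have dc : continuous (d k) by move=> t; exact: curve_deriv_continuous (@dS k t).
have [|m _ mP] := @EVT_max R (fun t => `|d k t|) 0 1 ler01.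
  apply: continuous_subspaceT => t.
  by apply: continuous_comp; [exact: dc|exact: norm_continuous].
apply/tvs_boundedP => U /((tvs_boundedP _).1 bb)[e e0 eU].
have m0 : 0 < `|d k m| + 1 by rewrite ltr_wpDl.
exists (e / (`|d k m| + 1)); first by rewrite divr_gt0.
move=> l _ le [s _ <-]; rewrite scalerA; apply: eU; last by exists `|Num.floor s|%N.
rewrite normrM -[leRHS](divfK (lt0r_neq0 m0)); apply: ler_pM => //.
rewrite (@le_trans _ _ `|d k m|) ?lerDl//; apply: mP.
rewrite in_itv /= subr_ge0 floor_le /= lerBlDl.
by have := floorD1_gt s; rewrite intrD => /ltW.
Qed.

(** The time 1/(n + 1/2) corresponds under s = 1/t to the centre of the n-th bump, where the bump is
    d 0 at 1/2; the exponential is the damping factor there. *)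
Lemma train_curve : exists2 c : R -> E, smooth_curve c /\ c 0 = 0 &
  forall n : nat, c (n%:R + 2^-1)^-1 = (expR (- (n%:R + 2^-1)) * d 0%N 2^-1) *: b n.
Proof.
exists (flat 0 (train 0)); first split.
- by apply: smooth_flat.
- by rewrite /flat ltxx.
- move=> n; have n0 : 0 < n%:R + 2^-1 :> R by rewrite ltr_wpDl.
  rewrite /flat invr_gt0 n0 invrK expr0 mul1r /train -scalerA.
  have -> : Num.floor (n%:R + 2^-1 : R) = n.
    by apply: floor_def; rewrite intrD /intmul; lra.
  by rewrite addrAC subrr add0r.
Qed.

End Train.

(** The times and weights are fixed before the space and the sequence, because the applications
    choose the n-th point according to the weight [w n]. *)
Lemma special_curve : exists t w : nat -> R,
  [/\ t @ \oo --> (0 : R), forall n, 0 < w n &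
    forall E (b : nat -> E), tvs_bounded (range b) ->
      exists2 c : R -> E, smooth_curve c /\ c 0 = 0 &
        forall n, c (t n) = w n *: b n].
Proof.
have [d [dS d0 dz]] := bump01.
exists (fun n => (n%:R + 2^-1)^-1), (fun n => expR (- (n%:R + 2^-1)) * d 0%N 2^-1).
split; last by move=> E b bb; exact: train_curve.
  apply/cvgr0Pnorm_lt => e e0; near=> n.
  have n0 : 0 < n%:R + 2^-1 :> R by rewrite ltr_wpDl.
  rewrite gtr0_norm ?invr_gt0// -[ltRHS]invrK ltf_pV2 ?posrE ?invr_gt0//.
  rewrite (@lt_le_trans _ _ n%:R) ?lerDl//.
  by near: n; exact: nbhs_infty_gtr.
by move=> n; rewrite mulr_gt0// expR_gt0.
Unshelve. all: by end_near. Qed.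

(** If W fails to absorb the image of B, there are points b_n of B with psi(b_n) outside r W for
    some r >= 1/w_n. The special curve passes through w_n b_n and tends to 0, so w_n psi(b_n) tends
    to 0, and scaling by 1/(w_n r) <= 1 puts psi(b_n)/r in W. *)
Lemma linear_smooth_bounded E F (psi : E -> F) :
  (forall r a, psi (r *: a) = r *: psi a) ->
  (forall c, smooth_curve c -> continuous (psi \o c)) -> bounded_map psi.
Proof.
move=> psiZ psiC B Bb W W0; apply: contrapT => nW.
have [t [w [t0 w0 tw]]] := special_curve.
have [V V0 VW] := nbhs0_balanced W0.
have /choice[b bP] n : exists b, B b /\ exists2 r, (w n)^-1 <= r &
    forall v, W v -> psi b <> r *: v.
  apply: contrapT => nb; apply: nW.
  have : \forall r \near +oo, (w n)^-1 < r by exact: nbhs_pinfty_gt (num_real _).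
  apply: filterS => r wr _ [b bB <-]; apply: contrapT => nv; apply: nb.
  exists b; split=> //; exists r; first exact: ltW.
  by move=> v Wv pb; apply: nv; exists v.
have bb : tvs_bounded (range b).
  apply/tvs_boundedP => U /((tvs_boundedP _).1 Bb)[e e0 eU].
  by exists e => // l _ le [n _ <-]; apply: eU => //; have [] := bP n.
have [c [cS c0] ct] := tw _ _ bb.
have psi0 : psi 0 = 0 by rewrite -(scale0r 0) psiZ scale0r.
have : (psi \o c) @ (0 : R) --> (0 : F).
  by have := psiC c cS 0; rewrite /continuous_at /= c0 psi0.
move=> /(_ _ V0) Vc; have : \forall n \near \oo, V (psi (c (t n))) by exact: (t0 _ Vc).
move=> /filter_ex[n]; rewrite ct psiZ.
have [_ [r wr rW]] := bP n.
have r0 : 0 < r by rewrite (lt_le_trans _ wr)// invr_gt0.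
move=> /(VW (w n * r)^-1) WV; apply: (rW (r^-1 *: psi (b n))).
  have := WV _; rewrite scalerA invfM mulrAC mulVf ?gt_eqF// mul1r; apply.
  have wr0 : 0 < w n * r by rewrite mulr_gt0.
  have -> : `|(w n)^-1 * r^-1| = (w n * r)^-1 by rewrite -invfM gtr0_norm ?invr_gt0.
  by rewrite invf_le1// -ler_pdivrMl// mulr1.
by rewrite scalerA divff ?scale1r// gt_eqF.
Qed.

(** Were U no neighbourhood of x, points y_k outside U could be chosen within w_k of x; the
    quotients (y_k - x)/w_k are then bounded, and a special curve translated by x runs through the
    y_k towards x. *)
Lemma cinf_open_rV n (U : set 'rV[R]_n) : cinf_open U -> open U.
Proof.
move=> oU; have [t [w [t0 w0 tw]]] := special_curve.
rewrite openE => x Ux; apply: contrapT => nU.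
have /choice[y yP] k : exists y, ~ U y /\ ball x (w k) y.
  apply: contrapT => ny; apply: nU; apply/nbhs_ballP; exists (w k) => //= y xy.
  by apply: contrapT => Uy; apply: ny; exists y.
have [|c [cS c0] ct] := tw 'rV[R]_n (fun k => (w k)^-1 *: (y k - x)).
  apply: (@tvs_bounded_normed _ _ _ 1) => _ [k _ <-].
  rewrite normrZ gtr0_norm ?invr_gt0// ler_pdivrMl// mulr1.
  by have [_] := yP k; rewrite -ball_normE /ball_ /= distrC => /ltW.
have xcS : smooth_curve (fun s => x + c s).
  by apply: smooth_curveD => //; exact: smooth_curve_cst.
have := oU _ xcS; rewrite openE => /(_ 0); rewrite /= c0 addr0 => /(_ Ux) U0.
have : \forall k \near \oo, U (x + c (t k)) by exact: (t0 _ U0).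
move=> /filter_ex[k]; rewrite ct scalerA divff ?gt_eqF// scale1r subrKC.
by have [] := yP k.
Qed.

End SpecialCurve.

(** * Bounded linear maps are smooth *)

Section MeanValue.
Context {R : realType}.
Implicit Types E F : tvsType R.

Definition cvx E (V : set E) : Prop := forall (l : R) x y, 0 <= l <= 1 ->
  V x -> V y -> V (l *: x + (1 - l) *: y).

Lemma nbhs0_convex E (U : set E) : nbhs 0 U -> exists2 V : set E,
  [/\ open V, V 0 & V `<=` U] & cvx V /\ forall v, V v -> V (- v).
Proof.
move=> U0; have [Be Bc [Bo Bb]] := @locally_convex R E.
have [C [BC C0] CU] := Bb 0 U U0.
have Ccvx : cvx C.
  move=> l x y /andP[l0 l1] Cx Cy.
  by have := Bc C (mem_set BC) x y (Itv01 l0 l1) (mem_set Cx) (mem_set Cy); rewrite inE.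
have oC : open C by exact: Bo.
exists (C `&` [set v | C (- v)]).
  split; [|by split=> //=; rewrite oppr0|by move=> v [/CU]].
  apply: openI => //; apply: open_comp => // v _; exact: opp_continuous.
split=> [l x y l01 [Cx CNx] [Cy CNy]|v [Cv CNv]]; last by split=> //=; rewrite opprK.
by split; [exact: Ccvx|rewrite /= opprD -!scalerN; exact: Ccvx].
Qed.

Section Interval.
Variables (E : tvsType R) (V : set E) (c c' : R -> E).
Hypotheses (oV : open V) (cV : cvx V).

Let slope u v : Prop := V ((v - u)^-1 *: (c v - c u)).

Let slope_cat u s v : u < s -> s < v -> slope u s -> slope s v -> slope u v.
Proof.
move=> us sv us_V sv_V; have uv : u < v by exact: lt_trans sv.
rewrite /slope.
have -> : (v - u)^-1 *: (c v - c u) = ((s - u) / (v - u)) *: ((s - u)^-1 *: (c s - c u)) +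
    (1 - (s - u) / (v - u)) *: ((v - s)^-1 *: (c v - c s)).
  rewrite !scalerA.
  have -> : (s - u) / (v - u) / (s - u) = (v - u)^-1.
    by rewrite mulrAC mulfV ?mul1r// subr_eq0 gt_eqF.
  have -> : (1 - (s - u) / (v - u)) / (v - s) = (v - u)^-1.
    by field; rewrite !subr_eq0 !gt_eqF.
  by rewrite -scalerDr; congr (_ *: _); rewrite [RHS]addrC subrKA.
apply: cV => //; rewrite divr_ge0 ?subr_ge0 ?(ltW us) ?(ltW uv)//=.
by rewrite ler_pdivrMr ?subr_gt0// mul1r lerB// ltW.
Qed.

(* Without seminorms: [slope] is additive over adjacent intervals since [V] is convex and
   holds near every point since [V] is open. *)
Lemma curve_mvt a b : a < b ->
  (forall s, a <= s <= b -> curve_deriv c s (c' s) /\ V (c' s)) ->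
  V ((b - a)^-1 *: (c b - c a)).
Proof.
move=> ab cc'; rewrite -/(slope a b).
(* Only intervals containing s are controlled: convergence of the quotients at s gives the slopes on
   either side, and concatenation the others. *)
have straddle s : a <= s <= b -> exists2 d, 0 < d & forall u v,
    s - d < u -> u <= s -> s <= v -> v < s + d -> u < v -> slope u v.
  move=> /cc'[cs Vs].
  have : \forall h \near (0 : R)^', V (h^-1 *: (c (s + h) - c s)).
    by apply: cs; exact: open_nbhs_nbhs.
  move=> /nbhs_ballP[d /= d0 dV]; exists d => // u v su us sv vs uv.
  have R_ x : s < x -> x < s + d -> slope s x.
    move=> sx xs; have := dV (x - s); rewrite subrKC; apply.
      by rewrite /ball /= sub0r normrN gtr0_norm ?subr_gt0// ltrBlDl.
    by rewrite subr_eq0 gt_eqF.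
  have L_ x : s - d < x -> x < s -> slope x s.
    move=> xs sx; have := dV (x - s); rewrite subrKC /slope.
    rewrite -[s - x]opprB invrN scaleNr -scalerN opprB; apply.
      by rewrite /ball /= sub0r normrN ltr0_norm ?subr_lt0// opprB; lra.
    by rewrite subr_eq0 lt_eqF.
  move: us sv; rewrite !le_eqVlt => /orP[/eqP us|us] /orP[/eqP sv|sv].
  - by move: uv; rewrite us sv ltxx.
  - by rewrite us; exact: R_.
  - by rewrite -sv; exact: L_.
  - by apply: (slope_cat us sv); [exact: L_|exact: R_].
(* A supremum argument: the right ends reachable from a include a point slightly past their
   supremum, unless that supremum is b. *)
pose S := [set x | x = a \/ [/\ a < x, x <= b & slope a x]].
have Sa : S a by left.
have Sb x : S x -> a <= x <= b.
  by move=> [->|[/ltW -> ->//]]; rewrite lexx ltW.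
have hS : has_sup S.
  by split; [exists a|exists b => x /Sb/andP[]].
set s := sup S.
have as_ : a <= s by exact: sup_upper_bound hS _ Sa.
have sb : s <= b by apply: ge_sup; [exists a|move=> x /Sb/andP[]].
have [|d d0 dP] := straddle s; first by rewrite as_ sb.
have [x Sx sx] := sup_adherent d0 hS; rewrite -/s in sx.
have xs : x <= s by exact: sup_upper_bound hS _ Sx.
pose y := Num.min (s + d / 2) b.
have d2 : 0 < d / 2 by rewrite divr_gt0.
have sy : s <= y by rewrite le_min sb lerDl ltW.
have yb : y <= b by rewrite ge_min lexx orbT.
have yd : y < s + d.
  by rewrite gt_min ltrD2l ltr_pdivrMr// ltr_pMr// ltr1n.
have Sy : S y.
  have [xy|yx] := ltP x y; last by rewrite (_ : y = x)//; lra.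
  have xyV : slope x y by exact: dP.
  right; case: Sx => [<-//|[ax _ axV]]; split=> //; first exact: lt_trans xy.
  exact: slope_cat axV xyV.
have ys : y <= s by exact: sup_upper_bound hS _ Sy.
have yE : y = b.
  move: ys; rewrite /y ge_min => /orP[|bs]; first by lra.
  by apply/min_idPr; lra.
by move: Sy; rewrite yE => -[/eqP|[]//]; rewrite gt_eqF.
Qed.

Lemma curve_mvt0 h : h != 0 ->
  (forall s, `|s| <= `|h| -> curve_deriv c s (c' s) /\ V (c' s)) ->
  V (h^-1 *: (c h - c 0)).
Proof.
rewrite neq_lt => /orP[h0|h0] cc'.
  have := @curve_mvt h 0 h0; rewrite sub0r invrN scaleNr -scalerN opprB; apply.
  move=> s /andP[hs s0]; apply: cc'; rewrite ler0_norm// ltr0_norm//.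
  by rewrite lerN2.
have := @curve_mvt 0 h h0; rewrite subr0; apply.
by move=> s /andP[s0 sh]; apply: cc'; rewrite ger0_norm// gtr0_norm.
Qed.

End Interval.

(** The mean value estimate is used twice, for [c1] and then for [c] minus its linear part, with
    scalars arranged so that everything reduces to e times second derivatives lying in a convex
    symmetric V. *)
Lemma taylor_bounded E (c c1 c2 : R -> E) (t : R) :
  (forall s, curve_deriv c s (c1 s)) -> (forall s, curve_deriv c1 s (c2 s)) ->
  continuous c2 ->
  tvs_bounded [set h^-1 *: (h^-1 *: (c (t + h) - c t) - c1 t) |
    h in [set h : R | h != 0 /\ `|h| <= 1]].
Proof.
move=> cc1 cc2 c2c; apply/tvs_boundedP => U /nbhs0_convex[V [oV V0 VU] [Vc VN]].
have VZ (l : R) v : `|l| <= 1 -> V v -> V (l *: v).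
  have H (m : R) : 0 <= m <= 1 -> V v -> V (m *: v).
    by move=> m01 Vv; rewrite -[_ *: _]addr0 -(@scaler0 R E (1 - m)); exact: Vc.
  move=> l1 Vv; have [l0|l0] := ler0P l.
    by rewrite -[l]opprK scaleNr; apply/VN/H => //; rewrite oppr_ge0 l0 -ler0_norm.
  by apply: H => //; rewrite ltW//= -(gtr0_norm l0).
(* Compactness of the interval provides one scalar e that moves all the values of the continuous
   [c2] on it into V. *)
have : \forall e \near (0 : R), `[t - 1, t + 1] `<=` [set s | V (e *: c2 s)].
  have /compact_near_coveringP := @segment_compact R (t - 1) (t + 1).
  move=> /(_ R (nbhs (0 : R)) (fun e s => V (e *: c2 s)) _); apply.
  move=> s _; have : (fun x : R * R => x.2 *: c2 x.1) @ filter_prod (nbhs s) (nbhs (0 : R))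
      --> (0 : R) *: c2 s.
    apply: tvs_cvgZ; first exact: cvg_snd.
    apply: (@cvg_comp _ _ _ fst c2 _ (nbhs s)); first exact: cvg_fst.
    exact: c2c.
  by rewrite scale0r => /(_ V); apply; exact: open_nbhs_nbhs.
move=> /nbhs_ballP[e' /= e'0 eV].
pose e := e' / 2; have e0 : 0 < e by rewrite divr_gt0.
have {eV} eV s : `|s| <= 1 -> V (e *: c2 (t + s)).
  move=> s1; apply: (eV e).
    by rewrite /ball /= sub0r normrN gtr0_norm// ltr_pdivrMr// ltr_pMr// ltr1n.
  by rewrite /= in_itv /=; move: s1; rewrite ler_norml => /andP[]; lra.
have c1V (h s : R) : h != 0 -> `|h| <= 1 -> `|s| <= `|h| ->
    V ((e / `|h|) *: (c1 (t + s) - c1 t)).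
  move=> h0 h1 sh; have nh0 : `|h| != 0 by rewrite normr_eq0.
  have [->|s0] := eqVneq s 0; first by rewrite addr0 subrr scaler0.
  have -> : (e / `|h|) *: (c1 (t + s) - c1 t) =
      (s / `|h|) *: (s^-1 *: (e *: c1 (t + s) - e *: c1 (t + 0))).
    rewrite addr0 -scalerBr !scalerA; congr (_ *: _).
    by field; rewrite s0 nh0.
  apply: VZ; first by rewrite normrM normfV normr_id ler_pdivrMr ?normr_gt0// mul1r.
  apply: (@curve_mvt0 _ _ (fun x => e *: c1 (t + x)) (fun x => e *: c2 (t + x))) => //.
  move=> x xs; split; last by apply: eV; rewrite (le_trans xs)// (le_trans sh).
  have := curve_derivZ (curve_deriv_cst e x) (@curve_deriv_shift _ _ c1 t x _ (cc2 (x + t))).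
  rewrite scale0r addr0 [x + t]addrC; congr (curve_deriv _ _ _).
  by apply/funext => y; rewrite addrC.
exists e => // l _ le [h [h0 h1] <-]; apply: VU.
have nh0 : 0 < `|h| by rewrite normr_gt0.
have nhn0 : `|h| != 0 by rewrite gt_eqF.
(* The increment of g over [0, h] is the scaled first order remainder, and its derivative is the
   quantity controlled by [c1V]. *)
pose g (s : R) := (e / `|h|) *: (c (t + s) + (- s) *: c1 t).
have -> : l *: (h^-1 *: (h^-1 *: (c (t + h) - c t) - c1 t)) =
    (l * `|h| / (e * h)) *: (h^-1 *: (g h - g 0)).
  rewrite /g oppr0 scale0r !addr0 -scalerBr addrAC -[c1 t in LHS](scale1r) -(mulVf h0).
  rewrite -[(h^-1 * h) *: _]scalerA -scalerBr -scaleNr !scalerA; congr (_ *: _).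
  by field; rewrite ?h0 ?nhn0 ?gt_eqF.
apply: VZ.
  have -> : `|l * `|h| / (e * h)| = `|l| / e.
    rewrite !normrM normfV normrM normr_id (gtr0_norm e0); field.
    by rewrite nhn0 gt_eqF.
  by rewrite ler_pdivrMr// mul1r.
apply: (@curve_mvt0 _ _ g (fun s => (e / `|h|) *: (c1 (t + s) - c1 t))) => //.
move=> s sh; split; last exact: c1V.
rewrite /g.
have dc : curve_deriv (fun s : R => c (t + s)) s (c1 (t + s)).
  have := @curve_deriv_shift _ _ c t s _ (cc1 (s + t)).
  rewrite [s + t]addrC; congr (curve_deriv _ _ _).
  by apply/funext => y; rewrite addrC.
have dN : curve_deriv (fun s : R => - s) s (- 1 : R).
  by apply: is_derive_curve; exact: is_deriveN.
have := curve_derivZ (curve_deriv_cst (e / `|h|) s)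
  (curve_derivD dc (curve_derivZ dN (curve_deriv_cst (c1 t) s))).
by rewrite scale0r addr0 scaler0 add0r scaleN1r.
Qed.

(** A bounded map need not be continuous, but the difference quotient of c differs from c' by h
    times an element of a bounded set; psi maps this error to h times a bounded set, which tends to
    0. Hence the curves psi o c are closed under derivation. *)
Lemma linear_bounded_smooth E F (psi : E -> F) :
  {morph psi : x y / x + y} -> (forall r a, psi (r *: a) = r *: psi a) ->
  bounded_map psi -> smooth psi.
Proof.
move=> psiD psiZ psiB c cS _.
have psiBr x y : psi (x - y) = psi x - psi y.
  by rewrite psiD -scaleN1r psiZ scaleN1r.
apply: (@smooth_curve_coind _ _ (fun f => exists2 c, smooth_curve c & f = psi \o c));
  last by exists c.
move=> _ [{cS}c cS ->].
have [c1 c1S cc1] := smooth_curve_deriv cS.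
have [c2 /smooth_curve_continuous c2c cc2] := smooth_curve_deriv c1S.
exists (psi \o c1); first by exists c1.
move=> t; have := taylor_bounded t cc1 cc2 c2c.
set S := [set _ | _ in _] => /psiB/tvs_boundedP Sb.
rewrite /curve_deriv /=.
have : (fun h => (h^-1 *: (psi (c (t + h)) - psi (c t)) - psi (c1 t))) @ 0^' --> (0 : F).
  move=> W /Sb[d d0 dW].
  change (\forall h \near 0^', W (h^-1 *: (psi (c (t + h)) - psi (c t)) - psi (c1 t))).
  near=> h; have h0 : h != 0 by near: h; exact: nbhs_dnbhs_neq.
  have -> : h^-1 *: (psi (c (t + h)) - psi (c t)) - psi (c1 t) =
      h *: psi (h^-1 *: (h^-1 *: (c (t + h) - c t) - c1 t)).
    by rewrite -psiZ scalerA divff// scale1r psiBr psiZ psiBr.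
  apply: dW; first by apply: ltW; near: h; exact: dnbhs0_lt.
  exists (h^-1 *: (h^-1 *: (c (t + h) - c t) - c1 t)) => //.
  exists h => //; split=> //; apply: ltW; near: h; exact: dnbhs0_lt.
move=> /tvs_cvgD /(_ (cvg_cst (psi (c1 t)))); rewrite add0r.
by under [in X in X -> _]eq_fun do rewrite subrK.
Unshelve. all: by end_near. Qed.

End MeanValue.

(** * Smooth maps, bump functions and germs *)

Section SmoothMaps.
Context {R : realType}.
Implicit Types E F G : tvsType R.

Lemma smooth_comp E F G (f : E -> F) (g : F -> G) :
  smooth f -> smooth g -> smooth (g \o f).
Proof. by move=> fS gS c cS _; exact: gS (fS c cS _) _. Qed.

Lemma smoothD E F (f g : E -> F) : smooth f -> smooth g ->
  smooth (fun x => f x + g x).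
Proof. by move=> fS gS c cS _; exact: smooth_curveD (fS c cS _) (gS c cS _). Qed.

Lemma smoothZ E F (p : E -> R) (f : E -> F) : smooth p -> smooth f ->
  smooth (fun x => p x *: f x).
Proof. by move=> pS fS c cS _; exact: smooth_curveZ (pS c cS _) (fS c cS _). Qed.

Lemma smooth_curve_smooth E (c : R -> E) : smooth_curve c -> smooth c.
Proof. by move=> cS s sS _; exact: smooth_curve_comp. Qed.

Lemma smoothM E (f g : E -> R) : smooth f -> smooth g ->
  smooth (fun x => f x * g x).
Proof. by move=> fS gS; exact: smoothZ. Qed.

Lemma smooth_coord n (i : 'I_n) : smooth (fun v : 'rV[R]_n => v ord0 i).
Proof. by move=> c cS _; exact: smooth_curve_coord. Qed.

Lemma cvg_row n T (F : set_system T) (FF : Filter F) (c : T -> 'rV[R]_n) (a : 'rV[R]_n) :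
  (forall i, (fun t => c t ord0 i) @ F --> a ord0 i) -> c @ F --> a.
Proof.
move=> ca W [P PI PW]; apply: (@filterS _ F _ [set t | forall i, P ord0 i (c t ord0 i)]).
  by move=> t Pt; apply: PW => i j; rewrite (ord1 i).
by apply: (@filter_forall _ _ (fun i t => P ord0 i (c t ord0 i)) F) => i; exact: ca.
Qed.

Lemma smooth_curve_row n (c : R -> 'rV[R]_n) :
  (forall i, smooth_curve (fun t => c t ord0 i)) -> smooth_curve c.
Proof.
move=> /choice[d dP]; exists (fun k t => \row_i d i k t); split=> [t _|k t _].
  by apply/rowP => i; rewrite mxE; have [d0 _] := dP i; rewrite d0.
apply: cvg_row => i; rewrite mxE; under eq_fun do rewrite !mxE.
by have [_ dS] := dP i; exact: dS.
Qed.

Lemma smooth_row n E (f : E -> 'rV[R]_n) :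
  (forall i, smooth (fun x => f x ord0 i)) -> smooth f.
Proof. by move=> fS c cS _; apply: smooth_curve_row => i; exact: fS. Qed.

(** Preimages of open sets are open along every smooth curve, and in finite dimension this makes
    them open. *)
Lemma smooth_rV_continuous n m (f : 'rV[R]_n -> 'rV[R]_m) :
  smooth f -> continuous f.
Proof.
move=> fS; apply/continuousP => U oU; apply: cinf_open_rV => c cS.
by have /smooth_curve_continuous/continuousP := fS c cS (fun _ => I); exact.
Qed.

Lemma cutoff : exists chi : R -> R, [/\ smooth chi,
  forall x, `|x| <= 2^-1 -> chi x = 1, forall x, 1 <= `|x| -> chi x = 0 &
  forall x, 0 <= chi x <= 1].
Proof.
(* The cutoff is e(q)/(e(q) + e(1 - q)) with e = [eflat]. The polynomial q is at most 0 for |x| >= 1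
   and at least 3/2 for |x| <= 1/2; q and 1 - q are never both nonpositive, so the denominator is
   positive. *)
pose q (x : R) : R := 2 + (-2) * (x * x).
pose den (x : R) : R := eflat (q x) + eflat (1 + -1 * q x).
have eS : smooth (@eflat R) by exact: smooth_curve_smooth (@smooth_eflat R).
have idS : smooth (@id R) by exact: smooth_curve_smooth (@smooth_curve_id R).
have qS : smooth q.
  apply: smoothD; first exact: smooth_cst.
  by apply: smoothM; [exact: smooth_cst|exact: smoothM].
have denS : smooth den.
  apply: smoothD; first exact: smooth_comp qS eS.
  apply: smooth_comp eS; apply: smoothD; first exact: smooth_cst.
  by apply: smoothM => //; exact: smooth_cst.
have den0 x : 0 < den x.
  have [q0|q0] := ltP 0 (q x).
    by rewrite ltr_pwDl ?eflat_gt0 ?eflat_ge0.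
  by rewrite ltr_wpDl ?eflat_ge0// eflat_gt0//; lra.
exists (fun x => eflat (q x) * (den x)^-1); split.
- apply: smoothM; first exact: smooth_comp qS eS.
  apply: smooth_curve_smooth; apply: smooth_curve_inv => //.
  by apply: denS => //; exact: smooth_curve_id.
- move=> x x1.
  have xx : x * x <= 4^-1.
    rewrite -expr2 -real_normK ?num_real// expr2 (_ : 4^-1 = 2^-1 * 2^-1 :> R); last by field.
    exact: ler_pM.
  have -> : den x = eflat (q x).
    by rewrite /den [eflat (1 + _)]eflat_le0 ?addr0// /q; lra.
  by rewrite mulfV// gt_eqF// eflat_gt0// /q; lra.
- move=> x x1; have xx : 1 <= x * x.
    by rewrite -expr2 -real_normK ?num_real// exprn_ege1.
  by rewrite [eflat (q x)]eflat_le0 ?mul0r// /q; lra.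
- move=> x; rewrite divr_ge0 ?eflat_ge0 ?(ltW (den0 x))//=.
  by rewrite ler_pdivrMr// mul1r lerDl eflat_ge0.
Qed.

(** The displacement from t0 is multiplied by a cutoff: it is unchanged below e/2, never increased,
    and zero once it would reach e. *)
Lemma reparam (J : set R) (t0 : R) : open J -> J t0 -> exists s : R -> R,
  [/\ smooth_curve s, forall t, J (s t) & \forall t \near t0, s t = t].
Proof.
move=> oJ Jt0; have [e /= e0 eJ] := (nbhs_ballP _ _).1 (open_nbhs_nbhs (conj oJ Jt0)).
have [chi [chiS chi1 chi0 chi01]] := cutoff.
exists (fun t => t0 + (t - t0) * chi ((t - t0) / e)); split.
- have tS : smooth_curve (fun t => t - t0).
    by apply: smooth_curveD; [exact: smooth_curve_id|exact: smooth_curve_cst].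
  apply: smooth_curveD; first exact: smooth_curve_cst.
  apply: smooth_curveZ => //; apply: (chiS (fun t => (t - t0) / e)) => //.
  by apply: smooth_curveZ => //; exact: smooth_curve_cst.
- move=> t; apply: eJ; rewrite /ball /= opprD addNKr normrN normrM.
  have /andP[c0 c1] := chi01 ((t - t0) / e).
  rewrite (ger0_norm c0); have [te|te] := ltP `|t - t0| e.
    by rewrite (le_lt_trans _ te)// ler_piMr.
  by rewrite chi0 ?mulr0// normrM normfV (gtr0_norm e0) ler_pdivlMr// mul1r.
- apply/nbhs_ballP; exists (e / 2); first by rewrite /= divr_gt0.
  move=> t; rewrite /ball /= distrC => te; rewrite chi1 ?mulr1 ?subrKC//.
  by rewrite normrM normfV (gtr0_norm e0) ler_pdivrMr// mulrC ltW.
Qed.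

(** Using a curve defined on the whole line as local model lets maps known to be smooth only on
    global curves be applied to it. *)
Definition smooth_at E (c : R -> E) (t0 : R) : Prop :=
  exists2 d : R -> E, smooth_curve d & \forall t \near t0, d t = c t.

Lemma smooth_curve_smooth_at E (c : R -> E) t0 : smooth_curve c -> smooth_at c t0.
Proof. by move=> cS; exists c => //; exact: filterE. Qed.

Lemma smooth_at_near E (c d : R -> E) t0 : (\forall t \near t0, c t = d t) ->
  smooth_at c t0 -> smooth_at d t0.
Proof.
move=> cd [c' c'S c'c]; exists c' => //.
by near=> t; rewrite (near c'c t)// (near cd t).
Unshelve. all: by end_near. Qed.

Lemma smooth_curve_on_at E (J : set R) (c : R -> E) t0 :
  smooth_curve_on J c -> open J -> J t0 -> smooth_at c t0.
Proof.
move=> cS oJ Jt0; have [s [sS sJ st]] := reparam oJ Jt0.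
exists (c \o s); first exact: smooth_curve_comp_on cS sS sJ.
by apply: filterS st => t /= ->.
Qed.

Lemma smooth_at_curve_on E (c : R -> E) t0 (P : set R) : smooth_at c t0 ->
  (\forall t \near t0, P t) -> exists J : set R,
    [/\ open J, J t0, J `<=` P & smooth_curve_on J c].
Proof.
move=> [d dS dc] Pt0; have [e /= e0 eJ] := (nbhs_ballP _ _).1 (filterI dc Pt0).
exists (ball t0 e); split; [exact: ball_open|exact: ballxx|by move=> t /eJ[]|].
apply: (@smooth_curve_on_ext _ _ _ d); first by move=> t /eJ[].
exact: smooth_curve_onS dS.
Qed.

Lemma smooth_curve_atP E (c : R -> E) : hausdorff_space E ->
  (forall t0, smooth_at c t0) -> smooth_curve c.
Proof.
move=> hE cS; apply: smooth_curve_local => // t0.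
by have [J [oJ Jt0 _ JS]] := smooth_at_curve_on (cS t0) (@filterT _ _ _); exists J.
Qed.

Lemma smooth_at_open E (U : set E) (c : R -> E) t0 : smooth_at c t0 ->
  cinf_open U -> U (c t0) -> \forall t \near t0, U (c t).
Proof.
move=> [d dS dc] oU; rewrite -(nbhs_singleton dc) => Ud.
have : \forall t \near t0, U (d t).
  exact: (open_nbhs_nbhs (conj (oU d dS) Ud : open_nbhs t0 _)).
by move=> Udt; near=> t; rewrite -(near dc t)//; near: t.
Unshelve. all: by end_near. Qed.

Lemma smooth_on_at E F (U : set E) (f : E -> F) (c : R -> E) t0 :
  smooth_on U f -> cinf_open U -> smooth_at c t0 -> U (c t0) ->
  smooth_at (f \o c) t0.
Proof.
move=> fS oU [d dS dc]; rewrite -(nbhs_singleton dc) => Ud.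
have [s [sS sU st]] := reparam (oU d dS) Ud.
exists (f \o (d \o s)); first exact: fS (smooth_curve_comp dS sS) sU.
by near=> t; rewrite /= (near st t)// (near dc t).
Unshelve. all: by end_near. Qed.

(** A product of one-variable cutoffs, supported in a closed cube. The compact K is recorded because
    it is closed, so X vanishes near every point outside it. *)
Lemma bump_function n (x : 'rV[R]_n) (U : set 'rV[R]_n) : nbhs x U ->
  exists (X : 'rV[R]_n -> R) (K : set 'rV[R]_n),
    [/\ smooth X, \forall y \near x, X y = 1, forall y, ~ K y -> X y = 0,
        compact K & K `<=` U].
Proof.
move=> /nbhs_ballP[e /= e0 eU]; have [chi [chiS chi1 chi0 _]] := cutoff.
(* Halving e keeps the closed cube of half side r inside the open ball of radius e. *)
pose r := e / 2; have r0 : 0 < r by rewrite divr_gt0.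
exists (fun y => \prod_i chi ((y ord0 i - x ord0 i) / r)).
exists [set y | forall i, `[x ord0 i - r, x ord0 i + r]%classic (y ord0 i)]; split.
- elim: (index_enum _) => [|i s IHs].
    by under eq_fun do rewrite big_nil; exact: smooth_cst.
  under eq_fun do rewrite big_cons; apply: smoothM => //.
  apply: (@smooth_comp _ _ _ (fun y : 'rV[R]_n => (y ord0 i - x ord0 i) / r)) => //.
  apply: smoothM; last exact: smooth_cst.
  by apply: smoothD; [exact: smooth_coord|exact: smooth_cst].
- apply/nbhs_ballP; exists (r / 2); first by rewrite /= divr_gt0.
  move=> y /= [_ xy]; apply: big1 => i _; apply: chi1.
  have := xy ord0 i; rewrite /ball /= distrC => yi.
  by rewrite normrM normfV (gtr0_norm r0) ler_pdivrMr//; lra.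
- move=> y /existsNP[i yi]; rewrite (bigD1 i)//= chi0 ?mul0r//.
  rewrite normrM normfV (gtr0_norm r0) ler_pdivlMr// mul1r leNgt.
  apply/negP => /ltW; rewrite ler_norml => /andP[y1 y2]; apply: yi.
  by rewrite /= in_itv /=; lra.
- apply: (@rV_compact R n (fun i => `[x ord0 i - r, x ord0 i + r]%classic)) => i.
  exact: segment_compact.
- move=> y yK; apply: eU; split=> // i j; rewrite (ord1 i); have := yK j.
  rewrite /= in_itv /= /ball /= => /andP[y1 y2].
  by rewrite ltr_norml; rewrite /r in y1 y2; lra.
Qed.

(** The values of f off U are arbitrary, so f is multiplied by a bump and cut to 0 there. A curve at
    a point outside U avoids the closed set K for nearby times, where the product is 0. *)
Lemma smooth_germ n m (U : set 'rV[R]_n) (f : 'rV[R]_n -> 'rV[R]_m) x :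
  smooth_on U f -> open U -> U x ->
  exists2 g : 'rV[R]_n -> 'rV[R]_m, smooth g & \forall y \near x, g y = f y.
Proof.
move=> fS oU Ux; have [X [K [XS X1 X0 cK KU]]] := bump_function (open_nbhs_nbhs (conj oU Ux)).
exists (fun y => if `[< U y >] then X y *: f y else 0); last first.
  near=> y; have -> : X y = 1 by near: y.
  rewrite scale1r ifT//; apply/asboolP; near: y; exact: open_nbhs_nbhs.
move=> c cS _; apply: smooth_curve_atP; first exact: norm_hausdorff.
move=> t0; have [Ut0|Ut0] := pselect (U (c t0)).
  have [s [sS sU st]] := reparam (open_cinf_open oU cS) Ut0.
  exists (fun t => X (c (s t)) *: f (c (s t))).
    have csS := smooth_curve_comp cS sS.
    by apply: smooth_curveZ; [exact: XS|exact: fS].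
  near=> t; rewrite /= ifT; first by rewrite (near st t).
  by apply/asboolP; rewrite -(near st t)//; exact: sU.
exists (fun=> 0); first exact: smooth_curve_cst.
have oK : open (~` K).
  by apply: closed_openC; apply: compact_closed => //; exact: norm_hausdorff.
have : \forall t \near t0, (~` K) (c t).
  apply: (smooth_at_open (smooth_curve_smooth_at t0 cS) (open_cinf_open oK)).
  by move=> /KU.
by apply: filterS => t nK /=; case: ifP => // _; rewrite X0// scale0r.
Unshelve. all: by end_near. Qed.

End SmoothMaps.

(** * Finite powers of a convenient vector space *)

Section Powers.
Context {R : realType}.
Variables (E : tvsType R) (n : nat).

Lemma smooth_curve_tpower (c : R -> tpower E n) :
  (forall i, smooth_curve (fun t => c t i)) -> smooth_curve c.
Proof.
move=> /choice[d dP]; exists (fun k t => (fun i => d i k t) : tpower E n).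
split=> [t _|k t _].
  by apply/funext => i; have [d0 _] := dP i; rewrite d0.
by apply: tpower_cvg => i; have [_ dS] := dP i; exact: dS.
Qed.

Lemma smooth_tpower_coord (i : 'I_n) : smooth (fun a : tpower E n => a i).
Proof.
move=> c [d [d0 dS]] _; exists (fun k t => d k t i); split=> [t _|k t _].
  by rewrite d0.
apply: (@cvg_comp _ _ _ (fun h : R => h^-1 *: (d k (t + h) - d k t))
  (fun a : tpower E n => a i) _ (nbhs (d k.+1 t))); first exact: dS.
exact: tpower_proj_continuous.
Qed.

Lemma hausdorff_tpower : hausdorff_space E -> hausdorff_space (tpower E n).
Proof. by move=> hE; exact: (@hausdorff_product 'I_n (fun=> E)). Qed.

Lemma convenient_tpower : convenient E -> convenient (tpower E n).
Proof.
move=> [hE Ec]; split; first exact: hausdorff_tpower.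
move=> c cS a b ab.
have /choice[I IP] i : exists I, riemann_integral (fun t => c t i) a b I.
  by apply: Ec => //; exact: (smooth_tpower_coord i cS).
exists (I : tpower E n) => W /tpower_nbhsP[V VI VW].
pose Q i del := forall (k : nat) (x xi : nat -> R), x 0%N = a -> x k = b ->
  (forall j, (j < k)%N -> x j <= xi j <= x j.+1 /\ x j.+1 - x j < del) ->
  V i (\sum_(j < k) (x j.+1 - x j) *: c (xi j) i).
(* The condition on the mesh persists when the mesh shrinks, so the finitely many coordinates can be
   satisfied together. *)
have QP i : \forall del \near 0^'+, Q i del.
  have [del del0 dP] : exists2 del, 0 < del & Q i del by exact: (IP i _ (VI i)).
  near=> e => k x xi x0 xk xP; apply: dP => // j jk.
  have [xx xd] := xP j jk; split => //; apply: lt_le_trans xd _.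
  by near: e; exact: nbhs_right_le.
have : \forall del \near (0 : R)^'+, (forall i, Q i del) /\ 0 < del.
  near=> del; split.
    by near: del; exact: (@filter_forall _ _ Q).
  by near: del; exact: nbhs_right_gt.
move=> /filter_ex[del [dQ del0]]; exists del => // k x xi x0 xk xP.
apply: VW => i; rewrite [X in V i X](_ : _ = \sum_(j < k) (x j.+1 - x j) *: c (xi j) i).
  exact: dQ.
exact: (big_morph (fun a : tpower E n => a i)).
Unshelve. all: by end_near. Qed.

End Powers.

(** * Local algebras *)

Section AlgebraOperations.
Context {R : realType} (A : local_convenient_algebra R).

Definition interp1 n (f : 'rV[R]_n -> R) (a : 'I_n -> A) : A :=
  lca_interp (fun v => \row_(_ < 1) f v) a ord0.

Let one : A := cinf_one (@lca_interp R A).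
Let mul (a b : A) : A := cinf_mul (@lca_interp R A) a b.

Lemma smooth_row1 n (f : 'rV[R]_n -> R) : smooth f ->
  smooth (fun v => \row_(_ < 1) f v).
Proof. by move=> fS; apply: smooth_row => i; under eq_fun do rewrite mxE. Qed.

Lemma interp_coord n m (f : 'rV[R]_n -> 'rV[R]_m) (a : 'I_n -> A) j : smooth f ->
  lca_interp f a j = interp1 (fun v => f v ord0 j) a.
Proof.
move=> fS; have pS : smooth (fun v : 'rV[R]_m => \row_(_ < 1) v ord0 j).
  by apply: smooth_row1; exact: smooth_coord.
have := cinf_comp (lca_cinf A) fS pS a; rewrite cinf_proj; last exact: lca_cinf.
by move/(congr1 (@^~ ord0)).
Qed.

Lemma interp1_coord n (i : 'I_n) (a : 'I_n -> A) :
  interp1 (fun v => v ord0 i) a = a i.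
Proof. by rewrite /interp1 (cinf_proj (lca_cinf A)). Qed.

Lemma interp1_comp n m (h : 'rV[R]_m -> R) (f : 'I_m -> 'rV[R]_n -> R) a :
  smooth h -> (forall j, smooth (f j)) ->
  interp1 (fun v => h (\row_j f j v)) a = interp1 h (fun j => interp1 (f j) a).
Proof.
move=> hS fS; have FS : smooth (fun v => \row_j f j v).
  by apply: smooth_row => j; under eq_fun do rewrite mxE; exact: fS.
rewrite /interp1 (cinf_comp (lca_cinf A) FS (smooth_row1 hS)).
congr (lca_interp _ _ _); apply/funext => j; rewrite interp_coord// /interp1.
by congr (lca_interp _ a ord0); apply/funext => v; apply/rowP => k; rewrite !mxE.
Qed.

Let pair2 (T : Type) (x y : T) (i : 'I_2) := if i == 0 then x else y.

Let interp1_comp2 n (h : 'rV[R]_2 -> R) (f g : 'rV[R]_n -> R) a :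
  smooth h -> smooth f -> smooth g ->
  interp1 h (pair2 (interp1 f a) (interp1 g a)) =
  interp1 (fun v => h (\row_j pair2 (f v) (g v) j)) a.
Proof.
move=> hS fS gS; have := @interp1_comp n 2 h (pair2 f g) a hS.
have -> : (fun v => h (\row_j pair2 f g j v)) = fun v => h (\row_j pair2 (f v) (g v) j).
  apply/funext => v; congr h; apply/rowP => j; rewrite !mxE /pair2.
  by case: ifP.
move=> ->; last by move=> j; rewrite /pair2; case: ifP.
by congr (interp1 h); apply/funext => j; rewrite /pair2; case: ifP.
Qed.

Lemma interp1D n (f g : 'rV[R]_n -> R) a : smooth f -> smooth g ->
  interp1 (fun v => f v + g v) a = interp1 f a + interp1 g a.
Proof.
move=> fS gS; rewrite -lca_add.
rewrite [RHS](@interp1_comp2 n (fun v => v ord0 0 + v ord0 1) f g a)//.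
  by congr (interp1 _ a); apply/funext => v; rewrite !mxE.
by apply: smoothD; exact: smooth_coord.
Qed.

Lemma interp1M n (f g : 'rV[R]_n -> R) a : smooth f -> smooth g ->
  interp1 (fun v => f v * g v) a = mul (interp1 f a) (interp1 g a).
Proof.
move=> fS gS.
rewrite [RHS](@interp1_comp2 n (fun v => v ord0 0 * v ord0 1) f g a)//.
  by congr (interp1 _ a); apply/funext => v; rewrite !mxE.
by apply: smoothM; exact: smooth_coord.
Qed.

Lemma interp1Z n r (f : 'rV[R]_n -> R) a : smooth f ->
  interp1 (fun v => r * f v) a = r *: interp1 f a.
Proof.
move=> fS; rewrite -lca_scale /cinf_scale.
have hS : smooth (fun v : 'rV[R]_1 => r * v ord0 ord0).
  by apply: smoothM; [exact: smooth_cst|exact: smooth_coord].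
have := @interp1_comp n 1 _ (fun=> f) a hS (fun=> fS).
under eq_fun do rewrite mxE; move=> ->; rewrite /interp1.
congr (lca_interp _ _ _); apply/funext => v; apply/rowP => j.
by rewrite !mxE (ord1 j).
Qed.

Lemma interp1_cst n r (a : 'I_n -> A) : interp1 (fun=> r) a = r *: one.
Proof.
have -> : (fun _ : 'rV[R]_n => r) = fun _ => r * 1 by apply/funext => v; rewrite mulr1.
rewrite interp1Z; last exact: smooth_cst.
congr (_ *: _).
(* The unit of A is defined through R^0, so the constant is factored through R^0. *)
have := @interp1_comp n 0 (fun=> 1) (fun _ _ => 0) a (@smooth_cst _ _ _ _) (fun _ => @smooth_cst _ _ _ _).
move=> ->; rewrite /one /cinf_one /interp1.
congr (lca_interp _ _ _); last by apply/funext => -[].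
by apply/funext => v; apply/rowP => j; rewrite !mxE.
Qed.

(** The pattern for all the ring laws: the elements are seen as coordinates interpreted at one
    tuple, and the identity becomes one between real functions under [interp1]. *)
Lemma cinf_mulC a b : mul a b = mul b a.
Proof.
suff H (p : 'I_2 -> A) : mul (p 0) (p 1) = mul (p 1) (p 0) by exact: H (pair2 a b).
rewrite -(interp1_coord 0 p) -(interp1_coord 1 p) -!interp1M; do ?exact: smooth_coord.
by congr (interp1 _ _); apply/funext => v; rewrite mulrC.
Qed.

Let triple (a b c : A) (i : 'I_3) : A := nth 0 [:: a; b; c] i.

Let tripleE a b c (P : A -> A -> A -> Prop) :
  (forall (p : 'I_3 -> A) i j k, P (p i) (p j) (p k)) -> P a b c.
Proof.
move=> /(_ (triple a b c) (inord 0) (inord 1) (inord 2)).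
by rewrite /triple !inordK.
Qed.

Let mulA a b c : mul a (mul b c) = mul (mul a b) c.
Proof.
apply: (@tripleE a b c (fun a b c => mul a (mul b c) = mul (mul a b) c)) => p i j k.
rewrite -(interp1_coord i p) -(interp1_coord j p) -(interp1_coord k p).
rewrite -!interp1M; do ?[exact: smooth_coord|apply: smoothM].
by congr (interp1 _ _); apply/funext => v; rewrite mulrA.
Qed.

Let mulDr a b c : mul a (b + c) = mul a b + mul a c.
Proof.
apply: (@tripleE a b c (fun a b c => mul a (b + c) = mul a b + mul a c)) => p i j k.
rewrite -(interp1_coord i p) -(interp1_coord j p) -(interp1_coord k p).
rewrite -interp1D; do ?exact: smooth_coord.
rewrite -!interp1M; do ?[exact: smooth_coord|apply: smoothD].
rewrite -interp1D; do ?[exact: smooth_coord|apply: smoothM].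
by congr (interp1 _ _); apply/funext => v; rewrite mulrDr.
Qed.

Let mul1 a : mul one a = a.
Proof.
suff H (p : 'I_1 -> A) : mul one (p ord0) = p ord0 by exact: H (fun=> a).
rewrite -[one]scale1r -(interp1_cst 1 p) -[X in mul _ X](interp1_coord ord0 p).
rewrite -interp1M; [|exact: smooth_cst|exact: smooth_coord].
by rewrite -[RHS]interp1_coord; congr (interp1 _ _); apply/funext => v; rewrite mul1r.
Qed.

Let mul0 a : mul a 0 = 0.
Proof. by apply: (addrI (mul a 0)); rewrite -mulDr !addr0. Qed.

Lemma aug_interp1 n (f : 'rV[R]_n -> R) a : smooth f ->
  lca_aug (interp1 f a) = f (aug_pow a).
Proof.
move=> /smooth_row1 fS; have /(congr1 (@^~ ord0)) := @lca_aug_hom R A _ _ _ fS a.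
by rewrite /= => ->; rewrite /real_interpretation mxE.
Qed.

Lemma aug_pow_interp n m (f : 'rV[R]_n -> 'rV[R]_m) a : smooth f ->
  aug_pow (lca_interp f a : tpower A m) = f (aug_pow a).
Proof.
move=> fS; apply/rowP => j; rewrite mxE interp_coord// aug_interp1//.
exact: smooth_comp fS (smooth_coord j).
Qed.

Lemma aug_one : lca_aug one = 1.
Proof. by rewrite -[one]scale1r lca_aug_scale_one. Qed.

Lemma aug0 : lca_aug (0 : A) = 0.
Proof. by rewrite -(scale0r one) lca_aug_scale_one. Qed.

Lemma one_neq0 : one <> 0.
Proof. by move=> one0; have := aug_one; rewrite one0 aug0 => /esym/eqP; rewrite oner_eq0. Qed.

Let ideal (I : set A) := is_ideal (@lca_interp R A) I.

Let ideal_one I : ideal I -> I one -> I = setT.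
Proof.
move=> [_ _ IM] I1; rewrite eqEsubset; split=> // a _.
by rewrite -[a]mul1 cinf_mulC; exact: IM.
Qed.

(* Otherwise Zorn's lemma provides a maximal ideal containing [b]; by locality
   it is the kernel of the augmentation. *)
Lemma lca_invertible b : lca_aug b != 0 -> exists c, mul c b = one.
Proof.
move=> b0; apply: contrapT => binv.
pose J : set A := [set mul c b | c in setT].
have JI : ideal J.
  split; first by exists 0 => //; rewrite cinf_mulC mul0.
    move=> _ _ [c _ <-] [d _ <-]; exists (c + d) => //.
    by rewrite ![mul _ b]cinf_mulC mulDr.
  by move=> a _ [c _ <-]; exists (mul a c) => //; rewrite -mulA.
(* The ideal J is adjoined to X inside the predicate because the empty chain has union the empty
   set, which is not an ideal by itself. *)
pose P X := ideal (X `|` J) /\ ~ (X `|` J) one.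
have [F FP Ftot|M [[MI M1] Mmax]] := @Zorn_bigcup A P.
  split; last first.
    move=> [[X FX X1]|[c _ c1]]; last by apply: binv; exists c.
    by have [_] := FP X FX; apply; left.
  have [J0 JD JM] := JI.
  have up X a : F X -> (X `|` J) a -> (\bigcup_(X in F) X `|` J) a.
    by move=> FX [Xa|Ja]; [left; exists X|right].
  split; first by right.
    have J_or a c X : F X -> (X `|` J) a -> (X `|` J) c ->
        (\bigcup_(X in F) X `|` J) (a + c).
      by move=> FX Xa Xc; have [[_ XD _] _] := FP X FX; apply: up (XD _ _ Xa Xc).
    move=> a c [[X FX Xa]|Ja] [[Y FY Yc]|Jc].
    - have [XY|YX] := Ftot X Y FX FY.
        by apply: (J_or _ _ Y) => //; left => //; exact: XY.
      by apply: (J_or _ _ X) => //; left => //; exact: YX.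
    - by apply: (J_or _ _ X) => //; [left|right].
    - by apply: (J_or _ _ Y) => //; [right|left].
    - by right; exact: JD.
  move=> a c [[X FX Xc]|Jc]; last by right; exact: JM.
  by have [[_ _ XM] _] := FP X FX; apply: (up X) => //; apply: XM; left.
have : maximal_ideal (@lca_interp R A) (M `|` J).
  split=> //; first by apply/eqP => MT; apply: M1; rewrite MT.
  move=> K KI MK; have [K1|K1] := pselect (K one); [right; exact: ideal_one|left].
  have KJ : K `|` J = K by apply/setUidPl => x Jx; apply: MK; right.
  have KM : K `<=` M.
    apply: contrapT => nKM; apply: (Mmax K); last by rewrite /P KJ.
    by split=> // x Mx; apply: MK; left.
  by rewrite eqEsubset; split=> // x /KM; left.
move=> /lca_local MN; move/eqP: b0; apply.
have : (M `|` J) b by right; exists one => //; exact: mul1.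
by rewrite MN.
Qed.

(* A bump function [X] supported where [f = g] satisfies [A(X)(a) (A(f)(a) - A(g)(a)) = 0],
   and [A(X)(a)] is invertible. *)
Lemma interp1_germ n (f g : 'rV[R]_n -> R) (a : 'I_n -> A) :
  smooth f -> smooth g -> (\forall y \near aug_pow (a : tpower A n), f y = g y) ->
  interp1 f a = interp1 g a.
Proof.
move=> fS gS fg.
have [X [K [XS X1 X0 _ KU]]] := bump_function fg.
have NgS : smooth (fun v => -1 * g v) by apply: smoothM => //; exact: smooth_cst.
have [c cX] : exists c, mul c (interp1 X a) = one.
  apply: lca_invertible; rewrite aug_interp1// (nbhs_singleton X1).
  exact: oner_neq0.
have : mul (interp1 X a) (interp1 f a - interp1 g a) = 0.
  rewrite -[- interp1 g a]scaleN1r -interp1Z// -interp1D// -interp1M//; last exact: smoothD.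
  rewrite -(scale0r one) -(interp1_cst 0 a); congr (interp1 _ a).
  apply/funext => v; have [/KU fgv|/X0 ->] := pselect (K v); last by rewrite mul0r.
  by rewrite fgv mulN1r subrr mulr0.
move=> /(congr1 (mul c)); rewrite mulA cX mul1 mul0.
by move/eqP; rewrite subr_eq0 => /eqP.
Qed.

Lemma interp_germ n m (f g : 'rV[R]_n -> 'rV[R]_m) (a : 'I_n -> A) :
  smooth f -> smooth g -> (\forall y \near aug_pow (a : tpower A n), f y = g y) ->
  lca_interp f a = lca_interp g a.
Proof.
move=> fS gS fg; apply/funext => j; rewrite !interp_coord//.
apply: interp1_germ.
- exact: smooth_comp fS (smooth_coord j).
- exact: smooth_comp gS (smooth_coord j).
- by apply: filterS fg => y ->.
Qed.

Lemma smooth_interp1 n (f : 'rV[R]_n -> R) : smooth f ->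
  smooth (interp1 f : tpower A n -> A).
Proof.
move=> /smooth_row1 fS.
exact: smooth_comp (lca_wd fS) (smooth_tpower_coord (ord0 : 'I_1)).
Qed.

(* [A(X)] takes the value 1 at points over which the bump function [X] is 1 near,
   and the value 0 at points lying over the complement of its support. *)
Lemma aug_pow_open n (W : set 'rV[R]_n) : open W ->
  cinf_open [set a : tpower A n | W (aug_pow a)].
Proof.
move=> oW c cS; rewrite openE => t0 Wt0.
have [X [K [XS X1 X0 cK KW]]] := bump_function (open_nbhs_nbhs (conj oW Wt0)).
have [hA _] := lca_convenient A.
have Xc : {for t0, continuous (interp1 X \o c)}.
  by apply: smooth_curve_continuous; exact: smooth_interp1.
have Xt0 : interp1 X (c t0) = one.
  rewrite -[one]scale1r -(interp1_cst 1 (c t0)).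
  by apply: interp1_germ => //; exact: smooth_cst.
have oK : open (~` K).
  by apply: closed_openC; apply: compact_closed => //; exact: norm_hausdorff.
have : \forall t \near t0, interp1 X (c t) <> 0.
  move: Xc; rewrite /prop_for /continuous_at /= Xt0 => /(_ [set x | x <> 0]); apply.
  apply: open_nbhs_nbhs; split; last exact: one_neq0.
  have /accessible_closed_set1 := hausdorff_accessible hA.
  by move=> /(_ 0)/closed_openC.
rewrite /interior; apply: filterS => t /= Xt; apply: KW; apply: contrapT => nK.
apply: Xt; rewrite -(scale0r one) -(interp1_cst 0 (c t)).
apply: interp1_germ => //; first exact: smooth_cst.
have : \forall y \near aug_pow (c t), (~` K) y by exact: open_nbhs_nbhs.
by apply: filterS => y /X0.
Qed.

End AlgebraOperations.

(** * Manifolds *)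

Section Manifolds.
Context {R : realType}.

Lemma smooth_mcurveP (M : premanifold R) (g : R -> M) : smooth_mcurve g <->
  forall t0, exists c : chart R M, [/\ atlas M c,
    \forall t \near t0, ch_dom c (g t) & smooth_at (ch_map c \o g) t0].
Proof.
split=> gS t0; have [c] := gS t0.
  move=> [J [cA oJ Jt0 Jc JS]]; exists c; split=> //; last exact: smooth_curve_on_at JS oJ Jt0.
  by apply: filterS Jc _; exact: open_nbhs_nbhs.
move=> [cA cg cS]; have [J [oJ Jt0 Jc JS]] := smooth_at_curve_on cS cg.
by exists c, J.
Qed.

(** Smoothness is given in some chart around g(t0) and carried to d by the transition map; the
    overlap being c^infty-open keeps the curve in the domain of d for nearby times. *)
Lemma mcurve_chart (M : premanifold R) (g : R -> M) (d : chart R M) t0 :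
  is_manifold M -> smooth_mcurve g -> atlas M d -> ch_dom d (g t0) ->
  (\forall t \near t0, ch_dom d (g t)) /\ smooth_at (ch_map d \o g) t0.
Proof.
move=> [Mchart _ Mcompat _] /smooth_mcurveP/(_ t0)[c [cA cg cS]] dA dg.
have [_ cI _] := Mchart c cA; have [oW WS] := Mcompat c d cA dA.
have W0 : (ch_map c @` (ch_dom c `&` ch_dom d)) ((ch_map c \o g) t0).
  by exists (g t0) => //; split=> //; exact: nbhs_singleton cg.
have WSt0 := smooth_on_at WS oW cS W0.
have dgt : \forall t \near t0, ch_dom d (g t).
  near=> t; have ct : ch_dom c (g t) by near: t.
  have [x [cx dx] xg] : (ch_map c @` (ch_dom c `&` ch_dom d)) ((ch_map c \o g) t).
    by near: t; exact: smooth_at_open.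
  by rewrite -(cI x (g t) (mem_set cx) (mem_set ct) xg).
split=> //; apply: smooth_at_near WSt0; near=> t.
by rewrite /= local_repE//; near: t.
Unshelve. all: by end_near. Qed.

Section Transition.
Variables (X : Type) (S : chart R X -> Prop).
Hypotheses (Scover : forall x, exists2 c, S c & ch_dom c x)
  (Schart : forall c, S c -> is_chart c).

(** Two charts compatible with S are compared near one point by going through a member of S around
    it. *)
Let transition_at (c d : chart R X) (g : R -> ch_model c) t0 :
  max_atlas S c -> max_atlas S d -> smooth_at g t0 ->
  (ch_map c @` (ch_dom c `&` ch_dom d)) (g t0) ->
  (\forall t \near t0, (ch_map c @` (ch_dom c `&` ch_dom d)) (g t)) /\
  smooth_at (local_rep c d id \o g) t0.
Proof.
move=> [[_ cI _] cS] [[_ dI _] dS] gS [x [cx dx] xg].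
have [s Ss sx] := Scover x.
have [_ sI _] := Schart Ss.
have [[csO csS] _] := cS s Ss; have [_ [sdO sdS]] := dS s Ss.
have cs0 : (ch_map c @` (ch_dom c `&` ch_dom s)) (g t0) by exists x.
have csgS := smooth_on_at csS csO gS cs0.
have sd0 : (ch_map s @` (ch_dom s `&` ch_dom d)) ((local_rep c s id \o g) t0).
  by exists x => //=; rewrite -xg local_repE.
have gt : \forall t \near t0, exists y, [/\ ch_dom c y, ch_dom s y, ch_dom d y &
    ch_map c y = g t].
  have H1 := smooth_at_open gS csO cs0.
  have H2 := smooth_at_open csgS sdO sd0.
  apply: filterS2 H1 H2 => t [y [cy sy] yg] /= [z [sz dz]].
  rewrite -yg local_repE// => zy; exists y; split=> //.
  by rewrite -(sI z y (mem_set sz) (mem_set sy) zy).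
split.
  by apply: filterS gt => t [y [cy sy dy yg]]; exists y.
apply: smooth_at_near (smooth_on_at sdS sdO csgS sd0).
apply: filterS gt => t [y [cy sy dy yg]] /=.
by rewrite -yg !local_repE.
Qed.

Lemma max_atlas_is_manifold :
  (forall c d, S c -> S d -> compatible c d) ->
  is_manifold (Premanifold (max_atlas S)).
Proof.
move=> Scompat; split=> /=.
- by move=> c [].
- move=> x; have [c Sc cx] := Scover x; exists c => //.
  by split=> [|d Sd]; [exact: Schart|split; exact: Scompat].
- move=> c d cA dA; split.
    move=> g gS; rewrite openE => t0 gt0.
    by have [] := transition_at cA dA (smooth_curve_smooth_at t0 gS) gt0.
  move=> g gS gW; apply: smooth_curve_atP; first by have [[[]]] := dA.
  move=> t0.
  by have [] := transition_at cA dA (smooth_curve_smooth_at t0 gS) (gW t0).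
- move=> c cC cA; split=> // d Sd; apply: cA.
  by split=> [|e Se]; [exact: Schart|split; exact: Scompat].
Qed.

End Transition.

Section LocalRepresentative.
Variables (M N : premanifold R) (f : M -> N) (c : chart R M) (d : chart R N).
Hypotheses (MM : is_manifold M) (NM : is_manifold N) (fS : msmooth f)
  (cA : atlas M c) (dA : atlas N d).

(** The set on which [local_rep] expresses f rather than an irrelevant value. *)
Definition rep_dom : set (ch_model c) := [set e | exists x,
  [/\ ch_dom c x, ch_map c x = e & ch_dom d (f x)]].

(** Smoothness of f concerns global curves in M, so the curve g is first reparametrized to stay in
    the image of the chart c, then lifted to M and mapped by f. *)
Let rep_at (g : R -> ch_model c) t0 : smooth_curve g -> rep_dom (g t0) ->
  (\forall t \near t0, rep_dom (g t)) /\ smooth_at (local_rep c d f \o g) t0.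
Proof.
move=> gS [x [cx xg dfx]].
have [Mchart _ _ _] := MM; have [_ cI cO] := Mchart c cA.
have [s [sS sc st]] := reparam (cO g gS) (ex_intro2 _ _ x cx xg).
have /choice[h hP] t : exists y, ch_dom c y /\ ch_map c y = g (s t).
  by have [y cy yg] := sc t; exists y.
have hS : smooth_mcurve h.
  apply/smooth_mcurveP => t1; exists c; split=> //.
    by near=> t; have [] := hP t.
  apply: smooth_curve_smooth_at.
  have -> : ch_map c \o h = g \o s by apply/funext => t; have [_] := hP t.
  exact: smooth_curve_comp.
have hx : h t0 = x.
  have [ch hg] := hP t0; apply: cI; rewrite ?inE//.
  by rewrite hg (nbhs_singleton st) xg.
have [|dfh dfhS] := mcurve_chart (t0 := t0) NM (fS hS) dA; first by rewrite /= hx.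
split.
  near=> t; exists (h t); have [ch hg] := hP t; split=> //; last by near: t.
  by rewrite hg (near st t).
apply: smooth_at_near dfhS; near=> t; have [ch hg] := hP t.
by rewrite /= -[in g t](near st t)// -hg local_repE.
Unshelve. all: by end_near. Qed.

Lemma rep_dom_open : cinf_open rep_dom.
Proof. by move=> g gS; rewrite openE => t0 gt0; have [] := rep_at gS gt0. Qed.

Lemma local_rep_smooth : smooth_on rep_dom (local_rep c d f).
Proof.
move=> g gS gW; apply: smooth_curve_atP.
  by have [Nchart _ _ _] := NM; have [[]] := Nchart d dA.
by move=> t0; have [] := rep_at gS (gW t0).
Qed.

End LocalRepresentative.

Lemma mcurve_open (M : premanifold R) (g : R -> M) (W : set M) t0 :
  is_manifold M -> smooth_mcurve g -> mopen W -> W (g t0) ->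
  \forall t \near t0, W (g t).
Proof.
move=> [Mchart _ _ _] /smooth_mcurveP/(_ t0)[c [cA cg cS]] oW Wg.
have [_ cI _] := Mchart c cA.
have cgt0 : (ch_map c @` (W `&` ch_dom c)) ((ch_map c \o g) t0).
  by exists (g t0) => //; split=> //; exact: nbhs_singleton cg.
have H := smooth_at_open cS (oW c cA) cgt0.
apply: filterS2 cg H => t cgt [x [Wx cx] xg].
by rewrite -(cI x (g t) (mem_set cx) (mem_set cgt) xg).
Qed.

Lemma msmooth_id (M : premanifold R) : msmooth (@id M).
Proof. by []. Qed.

Lemma msmooth_comp (M N P : premanifold R) (f : M -> N) (g : N -> P) :
  msmooth f -> msmooth g -> msmooth (g \o f).
Proof. by move=> fS gS c cS; exact: gS (fS c cS). Qed.

Lemma vmanifold_mcurve (E : tvsType R) (c : R -> E) : convenient E ->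
  smooth_mcurve (c : R -> vmanifold E) <-> smooth_curve c.
Proof.
move=> Ec; split=> cS.
  apply: smooth_curve_atP; first by have [] := Ec.
  by move=> t0; have [] := mcurve_chart (t0 := t0) (vmanifold_is_manifold Ec) cS
    (vmanifold_vchart Ec).
apply/smooth_mcurveP => t0; exists (vchart E); split.
- exact: vmanifold_vchart.
- by near=> t.
- exact: smooth_curve_smooth_at.
Unshelve. all: by end_near. Qed.

Lemma msmooth_Rn n m (f : 'rV[R]_n -> 'rV[R]_m) : smooth f ->
  msmooth (f : Rn R n -> Rn R m).
Proof.
move=> fS c /(vmanifold_mcurve _ (convenient_rV n)) cS.
by apply/(vmanifold_mcurve _ (convenient_rV m)); exact: fS.
Qed.

End Manifolds.

(** * Representatives of the points of T_A M *)

Section LocalValues.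
Context {R : realType} (A : local_convenient_algebra R).

Definition smooth_germ_at n m (f : 'rV[R]_n -> 'rV[R]_m) (x : 'rV[R]_n) : Prop :=
  exists2 g : 'rV[R]_n -> 'rV[R]_m, smooth g & \forall y \near x, g y = f y.

(** Two global maps with the germ of f have the same interpretation at a by [interp_germ], so the
    choice inside [TA_loc] is immaterial. *)
Lemma TA_locE n m (f g : 'rV[R]_n -> 'rV[R]_m) (a : tpower A n) :
  smooth g -> (\forall y \near aug_pow a, g y = f y) ->
  TA_loc f a = lca_interp g a.
Proof.
move=> gS gf; rewrite /TA_loc; set P := [set _ | _].
have : P (xget 0 P) by apply: (@xgetPex _ 0 P); exists (lca_interp g a), g.
move=> [h [hS hf ->]]; apply: interp_germ => //.
by apply: filterS2 hf gf => y -> ->.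
Qed.

Lemma TA_loc_near n m (f h : 'rV[R]_n -> 'rV[R]_m) (a : tpower A n) :
  smooth_germ_at f (aug_pow a) -> (\forall y \near aug_pow a, f y = h y) ->
  TA_loc f a = TA_loc h a.
Proof.
move=> [g gS gf] fh; rewrite (TA_locE gS gf) (TA_locE gS)//.
by apply: filterS2 gf fh => y -> ->.
Qed.

Lemma TA_loc_id n (f : 'rV[R]_n -> 'rV[R]_n) (a : tpower A n) :
  (\forall y \near aug_pow a, y = f y) -> TA_loc f a = a.
Proof.
move=> f_id; by rewrite (@TA_locE _ _ _ id)//; exact: cinf_id (lca_cinf A) _ _.
Qed.

Lemma aug_TA_loc n m (f : 'rV[R]_n -> 'rV[R]_m) (a : tpower A n) :
  smooth_germ_at f (aug_pow a) -> aug_pow (TA_loc f a) = f (aug_pow a).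
Proof.
move=> [g gS gf]; rewrite (TA_locE gS gf) aug_pow_interp//.
exact: nbhs_singleton gf.
Qed.

Lemma TA_loc_comp n m p (f : 'rV[R]_n -> 'rV[R]_m) (h : 'rV[R]_m -> 'rV[R]_p)
    (a : tpower A n) :
  smooth_germ_at f (aug_pow a) -> smooth_germ_at h (f (aug_pow a)) ->
  TA_loc h (TA_loc f a) = TA_loc (h \o f) a.
Proof.
move=> fG [k kS kh]; have fa := aug_TA_loc fG; have [g gS gf] := fG.
rewrite (TA_locE kS) ?fa// (TA_locE gS gf) (@TA_locE _ _ _ (k \o g)).
- by rewrite (cinf_comp (lca_cinf A)).
- exact: smooth_comp.
have gfa := nbhs_singleton gf; rewrite -gfa in kh.
have : \forall y \near aug_pow a, k (g y) = h (g y).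
  exact: (smooth_rV_continuous gS kh).
by apply: filterS2 gf => y /= ->.
Qed.

Lemma TA_loc_smooth_at n m (f : 'rV[R]_n -> 'rV[R]_m) (c : R -> tpower A n) t0 :
  smooth_germ_at f (aug_pow (c t0)) -> smooth_at c t0 ->
  smooth_at (TA_loc f \o c : R -> tpower A m) t0.
Proof.
move=> [g gS gf] cS.
have gc : smooth_at ((lca_interp g : tpower A n -> tpower A m) \o c) t0.
  apply: (smooth_on_at (lca_wd gS) _ cS I).
  by move=> d _; rewrite preimage_setT; exact: openT.
(* The base point of c(t) stays in the interior of the set where g = f, so the single map g computes
   [TA_loc f] at all nearby times. *)
have H := smooth_at_open cS (aug_pow_open (@open_interior _ _)) gf.
apply: smooth_at_near gc; apply: filterS H => t /= gft.
by rewrite (TA_locE gS).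
Qed.

End LocalValues.

Section Representatives.
Context {R : realType} (A : local_convenient_algebra R).
Implicit Types M N P : fmanifold R.

(** The point x is the image of the represented point under the projection T_A M -> M. *)
Definition lies_over M (p : TA_rep A M) (x : M) : Prop :=
  [/\ atlas M (tr_chart p), tr_dom p x & tr_map p x = aug_pow (tr_val p)].

Lemma fm_chart_inj M (c : chart R M) : atlas M c ->
  {in ch_dom c &, injective (ch_map c)}.
Proof. by move=> cA; have [Mc _ _ _] := fm_manifold M; have [] := Mc c cA. Qed.

Lemma over_unique M (p : TA_rep A M) x y : lies_over p x -> lies_over p y -> x = y.
Proof.
move=> [pA px xp] [_ py yp].
by apply: (fm_chart_inj pA); rewrite ?inE//= xp yp.
Qed.

Lemma TA_validP M (p : TA_rep A M) : TA_valid p <-> exists x, lies_over p x.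
Proof.
by split=> [[pA [x px xp]]|[x [pA px xp]]]; [exists x|split=> //; exists x].
Qed.

(* The representative, in the chart [(V, v)], of the image under [T_A f] of the
   point represented by [p] *)
Definition push M N (f : M -> N) (p : TA_rep A M) (V : set N)
    (v : N -> 'rV[R]_(fm_dim N)) : TA_rep A N :=
  TARep V v (TA_loc (local_rep (tr_chart p) (Chart V v) f) (tr_val p)).

Section Germs.
Variables (M N : fmanifold R) (f : M -> N).
Variables (U : set M) (u : M -> 'rV[R]_(fm_dim M)).
Variables (V : set N) (v : N -> 'rV[R]_(fm_dim N)) (x : M).
Hypotheses (fS : msmooth f) (uA : atlas M (Chart U u)) (vA : atlas N (Chart V v))
  (Ux : U x) (Vfx : V (f x)).

Let W : set 'rV[R]_(fm_dim M) := @rep_dom R M N f (Chart U u) (Chart V v).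

Let oW : open W.
Proof.
by apply: cinf_open_rV; exact: (rep_dom_open (fm_manifold M) (fm_manifold N) fS uA vA).
Qed.

Let Wx : W (u x). Proof. by exists x. Qed.

Lemma rep_near : \forall e \near u x, exists y, [/\ U y, u y = e & V (f y)].
Proof. exact: open_nbhs_nbhs (conj oW Wx). Qed.

Lemma rep_germ : smooth_germ_at (local_rep (Chart U u) (Chart V v) f) (u x).
Proof.
have := local_rep_smooth (fm_manifold M) (fm_manifold N) fS uA vA.
by move=> /smooth_germ; apply; [exact: oW|exact: Wx].
Qed.

End Germs.

Lemma push_over M N (f : M -> N) (p : TA_rep A M) V v x : msmooth f -> lies_over p x ->
  atlas N (Chart V v) -> V (f x) -> lies_over (push f p V v) (f x).
Proof.
move=> fS [pA px xp] vA Vfx; split=> //=.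
rewrite aug_TA_loc -xp; last exact: rep_germ.
by rewrite (@local_repE _ _ _ (tr_chart p) (Chart V v))//; exact: fm_chart_inj pA.
Qed.

(** Functoriality on representatives. With f or g the identity it also yields transitivity of the
    gluing and independence of the intermediate chart. *)
Lemma push_push M N P (f : M -> N) (g : N -> P) (p : TA_rep A M) V v Z z x :
  msmooth f -> msmooth g -> lies_over p x -> atlas N (Chart V v) -> V (f x) ->
  atlas P (Chart Z z) -> Z (g (f x)) ->
  push g (push f p V v) Z z = push (g \o f) p Z z.
Proof.
move=> fS gS [pA px xp] vA Vfx zA Zgfx.
have pI := fm_chart_inj pA; have vI := fm_chart_inj vA.
have fG := rep_germ fS pA vA px Vfx; have gG := rep_germ gS vA zA Vfx Zgfx.
have gfG := rep_germ (msmooth_comp fS gS) pA zA px Zgfx.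
rewrite /push /=; congr TARep; rewrite TA_loc_comp -?xp//.
  apply/esym/TA_loc_near; rewrite -?xp//.
  apply: filterS2 (rep_near fS pA vA px Vfx) (rep_near (msmooth_comp fS gS) pA zA px Zgfx).
  move=> e [y [py <- Vfy]] _.
  rewrite (@local_repE _ _ _ (tr_chart p) (Chart Z z))//=.
  rewrite (@local_repE _ _ _ (tr_chart p) (Chart V v))//=.
  by rewrite (@local_repE _ _ _ (Chart V v) (Chart Z z)).
by rewrite (@local_repE _ _ _ (tr_chart p) (Chart V v)).
Qed.

Lemma push_id M (p : TA_rep A M) x : lies_over p x ->
  push id p (tr_dom p) (tr_map p) = p.
Proof.
case: p => U u a [/= pA px xp]; rewrite /push; congr TARep; apply: TA_loc_id => /=.
rewrite -xp; apply: filterS (rep_near (@msmooth_id _ M) pA pA px px).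
move=> _ [y [Uy <- _]].
by rewrite (@local_repE _ _ _ (Chart U u) (Chart U u))//; exact: fm_chart_inj pA.
Qed.

(** Gluing is pushing along the identity, so its being an equivalence relation follows from
    [push_push] and [push_id]. *)
Lemma TA_glueP M (p q : TA_rep A M) x : lies_over p x -> TA_glue p q <->
  lies_over q x /\ q = push id p (tr_dom q) (tr_map q).
Proof.
move=> px_; have [pA px xp] := px_.
split=> [[_ [qA [z qz zq]] [y [py qy] yp] vq]|[qx_ qE]].
  have qE : q = push id p (tr_dom q) (tr_map q) by case: q vq {qA qz zq qy} => V v b /= <-.
  split=> //; rewrite qE; have -> : x = y by apply: over_unique px_ _.
  exact: (@push_over _ _ id).
have [qA qx xq] := qx_; split=> //; do ?[by apply/TA_validP; exists x].
  by exists x.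
by rewrite [in RHS]qE.
Qed.

Lemma TA_glue_over M (p q : TA_rep A M) : TA_glue p q -> exists x, lies_over p x /\ lies_over q x.
Proof.
move=> pq; have [/TA_validP[x px] _ _ _] := pq; exists x; split=> //.
by have [] := (TA_glueP q px).1 pq.
Qed.

Lemma TA_glue_refl M (p : TA_rep A M) : TA_valid p -> TA_glue p p.
Proof.
by move=> /TA_validP[x px]; apply/(TA_glueP _ px); split=> //; rewrite (push_id px).
Qed.

Lemma TA_glue_trans M (p q r : TA_rep A M) : TA_glue p q -> TA_glue q r -> TA_glue p r.
Proof.
move=> pq qr; have [x [px qx]] := TA_glue_over pq.
have [_ qE] := (TA_glueP _ px).1 pq; have [rx rE] := (TA_glueP _ qx).1 qr.
apply/(TA_glueP _ px); split=> //; rewrite {1}rE qE.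
have [qA qdx _] := qx; have [rA rdx _] := rx.
exact: (push_push (@msmooth_id _ M) (@msmooth_id _ M) px).
Qed.

Lemma TA_glue_sym M (p q : TA_rep A M) : TA_glue p q -> TA_glue q p.
Proof.
move=> pq; have [x [px qx]] := TA_glue_over pq.
have [_ qE] := (TA_glueP _ px).1 pq.
apply/(TA_glueP _ qx); split=> //; rewrite qE.
have [qA qdx _] := qx; have [pA pdx _] := px.
rewrite (push_push (@msmooth_id _ M) (@msmooth_id _ M) px)//.
by rewrite (push_id px).
Qed.

Definition has_rep M (t : TA_point A M) (p : TA_rep A M) : Prop := sval t p.

Lemma has_repE M (t : TA_point A M) p : has_rep t p -> sval t = TA_glue p.
Proof.
case: t => C [q qv CE]; rewrite /has_rep /= {1}CE => qp; rewrite CE.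
apply/funext => r; apply/propext; split=> [qr|pr].
  exact: TA_glue_trans (TA_glue_sym qp) qr.
exact: TA_glue_trans qp pr.
Qed.

Lemma has_rep_glue M (t : TA_point A M) p q : has_rep t p -> has_rep t q <-> TA_glue p q.
Proof. by move=> /has_repE tp; rewrite /has_rep tp. Qed.

Lemma has_rep_class M (p : TA_rep A M) (pv : TA_valid p) : has_rep (TA_class pv) p.
Proof. exact: TA_glue_refl. Qed.

Lemma TA_point_eq M (t s : TA_point A M) p : has_rep t p -> has_rep s p -> t = s.
Proof.
move=> /has_repE tp /has_repE sp; case: t s tp sp => C Cp [D Dp] /= CE DE.
by subst C D; congr exist; exact: Prop_irrelevance.
Qed.

Lemma repr_ex M (t : TA_point A M) : exists p x, has_rep t p /\ lies_over p x.
Proof.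
case: t => C [p pv CE]; have [x px] := (TA_validP p).1 pv.
by exists p, x; split=> //; rewrite /has_rep /= CE; exact: TA_glue_refl.
Qed.

Lemma repr_over M (t : TA_point A M) p : has_rep t p -> exists x, lies_over p x.
Proof.
move=> tp; have [q [_ [tq _]]] := repr_ex t.
have /(has_rep_glue _ tq) /TA_glue_over[x [_ px]] := tp.
by exists x.
Qed.

Lemma repr_push M (t : TA_point A M) p x V v : has_rep t p -> lies_over p x ->
  atlas M (Chart V v) -> V x -> has_rep t (push id p V v).
Proof.
move=> tp px vA Vx; apply/(has_rep_glue _ tp)/(TA_glueP _ px); split=> //.
exact: (@push_over _ _ id).
Qed.

Lemma repr_eq M (t : TA_point A M) p q x : has_rep t p -> has_rep t q -> lies_over p x ->
  lies_over q x /\ q = push id p (tr_dom q) (tr_map q).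
Proof. by move=> tp /(has_rep_glue _ tp) pq px; exact/(TA_glueP _ px). Qed.

Lemma repr_val M (t : TA_point A M) U u a b : has_rep t (TARep U u a) ->
  has_rep t (TARep U u b) -> a = b.
Proof.
move=> ta tb; have [x xa] := repr_over ta.
have [_ /=] := repr_eq ta tb xa; have /= -> := push_id xa.
by move=> [].
Qed.

Lemma pick_orP (T : Type) (x0 : T) (P : set T) : (exists x, P x) -> P (pick_or x0 P).
Proof. by move=> Px; rewrite /pick_or; case: pselect => // h; case: cid. Qed.

(** Whatever pair of representatives the choice in [TA_map] picks, changing charts on both sides by
    [push_push] turns it into the push of p. *)
Lemma TA_map_repr M N (f : M -> N) (t : TA A M) p x V v : msmooth f ->
  has_rep t p -> lies_over p x -> atlas N (Chart V v) -> V (f x) ->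
  has_rep (TA_map A f t) (push f p V v).
Proof.
move=> fS tp px vA Vfx; rewrite /TA_map; set S := [set _ | _].
have qx := push_over fS px vA Vfx.
have : S (pick_or (TA_zero A (f (TA_base t))) S).
  apply: pick_orP; exists (TA_class ((TA_validP _).2 (ex_intro _ _ qx))), p, (push f p V v).
  split=> //; first by apply: TA_glue_refl; apply/TA_validP; exists (f x).
  by have [pA pdx xp] := px; exists x; split.
set s := pick_or _ _ => -[p' [q' [tp' sq' [x' [p'x' x'p' q'fx']] q'E]]].
have [p'x p'E] := repr_eq tp tp' px.
have [p'A _ _] := p'x.
have xx' : x' = x by apply: over_unique p'x.
rewrite {}xx' {p'x' x'p'} in q'fx'.
have q'fE : q' = push f p' (tr_dom q') (tr_map q') by case: q' q'E {sq' q'fx'} => ? ? ? /= ->.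
have [y [q'A _ _]] := repr_over sq'.
have [_ p'dx _] := p'x.
have q'x := push_over fS p'x q'A q'fx'; rewrite -q'fE in q'x.
have := repr_push sq' q'x vA Vfx.
rewrite [X in push id X]q'fE (push_push fS (@msmooth_id _ N) p'x)//.
by rewrite p'E (push_push (@msmooth_id _ M) fS px).
Qed.

End Representatives.

(** * The functor T_A *)

Section TAManifold.
Context {R : realType} (A : local_convenient_algebra R).
Implicit Types M N : fmanifold R.

Section Charts.
Variables (M : fmanifold R).
Implicit Types (U V : set M) (u v : M -> 'rV[R]_(fm_dim M)).

Lemma TA_chart_mapE (t : TA_point A M) U u a : has_rep t (TARep U u a) ->
  ch_map (TA_chart A U u) t = a.
Proof.
move=> ta /=; set P := [set _ | _].
have Pb : P (xget 0 P) by apply: (@xgetPex _ 0 P); exists a.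
exact: repr_val Pb ta.
Qed.

Lemma TA_chart_domE (t : TA_point A M) U u : ch_dom (TA_chart A U u) t ->
  has_rep t (TARep U u (ch_map (TA_chart A U u) t)).
Proof. by move=> [a ta]; rewrite (TA_chart_mapE ta). Qed.

Lemma TA_chart_image U u U' : atlas M (Chart U u) -> U' `<=` U ->
  forall a, (u @` U') (aug_pow (a : tpower A (fm_dim M))) ->
  exists t : TA_point A M, has_rep t (TARep U u a).
Proof.
move=> uA U'U a [x U'x xa].
have pv : TA_valid (TARep U u a) by split=> //; exists x => //; exact: U'U.
by exists (TA_class pv); exact: has_rep_class.
Qed.

Lemma fm_chart_open (c : chart R M) U u : atlas M c -> atlas M (Chart U u) ->
  open (u @` (U `&` ch_dom c)).
Proof.
move=> cA uA; apply: cinf_open_rV; have [_ _ Mc _] := fm_manifold M.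
by have [] := Mc _ _ uA cA.
Qed.

(** The abstract overlaps and transition maps of T_A M become preimages of open sets under the
    augmentation and instances of [TA_loc], whose openness and smoothness are already settled. *)
Lemma TA_chart_transition U u V v : atlas M (Chart U u) -> atlas M (Chart V v) ->
  let c := TA_chart A U u in let d := TA_chart A V v in
  ch_map c @` (ch_dom c `&` ch_dom d) =
    [set a | (u @` (U `&` V)) (aug_pow (a : tpower A (fm_dim M)))] /\
  forall a, (u @` (U `&` V)) (aug_pow (a : tpower A (fm_dim M))) ->
    local_rep c d id a = TA_loc (local_rep (Chart U u) (Chart V v) id) a.
Proof.
move=> uA vA c d.
have cI : {in ch_dom c &, injective (ch_map c)}.
  move=> t s /set_mem/TA_chart_domE tc /set_mem/TA_chart_domE sc ts.
  by rewrite -/c ts in tc; exact: TA_point_eq tc sc.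
have UV_repr t x a : has_rep t (TARep U u a) -> lies_over (TARep U u a) x -> V x ->
    has_rep t (TARep V v (TA_loc (local_rep (Chart U u) (Chart V v) id) a)).
  by move=> ta xa Vx; exact: (repr_push ta xa).
have H a : (u @` (U `&` V)) (aug_pow (a : tpower A (fm_dim M))) -> exists t x,
    [/\ has_rep t (TARep U u a), lies_over (TARep U u a) x & V x].
  move=> Wa; have [t ta] := TA_chart_image uA (@subIsetl _ U V) Wa.
  by have [x [Ux Vx] xa] := Wa; exists t, x.
split.
  rewrite eqEsubset; split=> [_ [t [[a ta] [b tb]] <-]|a Wa] /=.
    have -> : xget 0 _ = a := TA_chart_mapE ta.
    have [x xa] := repr_over ta; have [[_ Vx _] _] := repr_eq ta tb xa.
    by have [_ Ux <-] := xa; exists x.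
  have [t [x [ta xa Vx]]] := H a Wa; exists t; last exact: TA_chart_mapE.
  by split; [exists a|exists (TA_loc (local_rep (Chart U u) (Chart V v) id) a); exact: UV_repr xa _].
move=> a Wa; have [t [x [ta xa Vx]]] := H a Wa.
rewrite -[in LHS](TA_chart_mapE ta) -/c local_repE//; last by exists a.
by apply: TA_chart_mapE; exact: UV_repr xa _.
Qed.

Lemma TA_chart_is_chart U u : atlas M (Chart U u) -> is_chart (TA_chart A U u).
Proof.
move=> uA; split.
- exact: convenient_tpower (lca_convenient A).
- move=> t s /set_mem/TA_chart_domE tc /set_mem/TA_chart_domE sc ts.
  by rewrite ts in tc; exact: TA_point_eq tc sc.
- have [+ _] := TA_chart_transition uA uA; rewrite !setIid => ->.
  have := fm_chart_open uA uA; rewrite setIid; exact: aug_pow_open.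
Qed.

Lemma TA_chart_compatible U u V v : atlas M (Chart U u) -> atlas M (Chart V v) ->
  compatible (TA_chart A U u) (TA_chart A V v).
Proof.
move=> uA vA; have [domE mapE] := TA_chart_transition uA vA.
rewrite /compatible domE; split; first exact: aug_pow_open (fm_chart_open vA uA).
move=> c cS cW; apply: smooth_curve_atP.
  by have [] := convenient_tpower (fm_dim M) (lca_convenient A).
move=> t0; have [x [Ux Vx] xc] := cW t0.
have := TA_loc_smooth_at _ (smooth_curve_smooth_at t0 cS); rewrite -xc.
move=> /(_ _ _ (rep_germ (@msmooth_id _ M) uA vA Ux Vx)).
by apply: smooth_at_near; near=> t; exact/esym/mapE/cW.
Unshelve. all: by end_near. Qed.

End Charts.

Lemma TA_is_manifold M : is_manifold (TA A M).
Proof.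
apply: max_atlas_is_manifold.
- move=> t; have [[U u a] [x [ta [uA Ux xa]]]] := repr_ex t.
  by exists (TA_chart A U u); [exists U, u|exists a].
- by move=> _ [U [u [uA ->]]]; exact: TA_chart_is_chart.
- by move=> _ _ [U [u [uA ->]]] [V [v [vA ->]]]; exact: TA_chart_compatible.
Qed.

Lemma TA_chart_atlas M U u : atlas M (Chart U u) -> atlas (TA A M) (TA_chart A U u).
Proof.
move=> uA; split; first exact: TA_chart_is_chart.
by move=> _ [V [v [vA ->]]]; split; exact: TA_chart_compatible.
Qed.

Lemma TA_mcurve M (g : R -> TA A M) t0 (U : set M) (u : M -> 'rV[R]_(fm_dim M)) a :
  smooth_mcurve g -> has_rep (g t0) (TARep U u a) ->
  exists c : R -> tpower A (fm_dim M), [/\ smooth_at c t0, c t0 = a &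
    \forall t \near t0, has_rep (g t) (TARep U u (c t))].
Proof.
move=> gS ga; have [x [uA _ _]] := repr_over ga.
have [|gU cS] := mcurve_chart (t0 := t0) (@TA_is_manifold M) gS (TA_chart_atlas uA).
  by exists a.
exists (ch_map (TA_chart A U u) \o g); split=> //; first exact: TA_chart_mapE.
by apply: filterS gU => t /TA_chart_domE.
Qed.

Lemma TA_mcurveP M (g : R -> TA A M) :
  (forall t0, exists U u (c : R -> tpower A (fm_dim M)),
    smooth_at c t0 /\ \forall t \near t0, has_rep (g t) (TARep U u (c t))) ->
  smooth_mcurve g.
Proof.
move=> gS; apply/smooth_mcurveP => t0; have [U [u [c [cS gc]]]] := gS t0.
have [x [uA _ _]] := repr_over (nbhs_singleton gc).
exists (TA_chart A U u); split; first exact: TA_chart_atlas.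
  by apply: filterS gc => t gt; exists (c t).
by apply: smooth_at_near cS; apply: filterS gc => t gt; rewrite /= -[LHS](TA_chart_mapE gt).
Qed.

Lemma TA_map_smooth M N (f : M -> N) : msmooth f -> msmooth (TA_map A f).
Proof.
move=> fS g gS; apply: TA_mcurveP => t0.
have [[U u a] [x [ga xa]]] := repr_ex (g t0).
have [c [cS c0 gc]] := TA_mcurve gS ga.
have [V [v [vA Vfx]]] := fm_chart (f x).
exists V, v, (TA_loc (local_rep (Chart U u) (Chart V v) f) \o c).
have [uA Ux xu] := xa.
have fG := rep_germ fS uA vA Ux Vfx; have fR := rep_near fS uA vA Ux Vfx.
rewrite /= in uA xu fG fR; rewrite xu -c0 in fG fR.
split; first exact: TA_loc_smooth_at.
(* The base point stays where f is represented from (U, u) to (V, v), so one target chart serves all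
   nearby times. *)
have cW := smooth_at_open cS (aug_pow_open (@open_interior _ _)) fR.
apply: filterS2 gc cW => t gt /= /nbhs_singleton[y [Uy yc Vfy]].
exact: (TA_map_repr fS gt _ vA Vfy).
Qed.

Lemma TA_map_id M : TA_map A (@id M) = id.
Proof.
apply/funext => t; have [[U u a] [x [ta xa]]] := repr_ex t.
have [uA Ux _] := xa.
have := TA_map_repr (@msmooth_id _ M) ta xa uA Ux.
by rewrite (push_id xa) => tt; exact: TA_point_eq tt ta.
Qed.

Lemma TA_map_comp (M N P : fmanifold R) (f : M -> N) (g : N -> P) :
  msmooth f -> msmooth g -> TA_map A (g \o f) = TA_map A g \o TA_map A f.
Proof.
move=> fS gS; apply/funext => t; have [p [x [tp px]]] := repr_ex t.
have [V [v [vA Vfx]]] := fm_chart (f x).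
have [Z [z [zA Zgfx]]] := fm_chart (g (f x)).
have fr := TA_map_repr fS tp px vA Vfx.
have gr := TA_map_repr gS fr (push_over fS px vA Vfx) zA Zgfx.
rewrite (push_push fS gS px) // in gr.
exact: TA_point_eq (TA_map_repr (msmooth_comp fS gS) tp px zA Zgfx) gr.
Qed.

Lemma TA_is_functor : is_functor (@TA_map R A).
Proof.
split; [exact: TA_is_manifold|exact: TA_map_smooth|exact: TA_map_id|].
exact: TA_map_comp.
Qed.

Section Euclidean.
Variable n : nat.

Lemma Rn_atlas : atlas (Rn R n) (Chart setT (@id 'rV[R]_n) : chart R (Rn R n)).
Proof. exact/vmanifold_vchart/convenient_rV. Qed.

Lemma Rn_TA_repr (a : tpower A n) :
  has_rep (Rn_TA A n a) (@TARep R A (Rn R n) setT id a).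
Proof. exact: has_rep_class. Qed.

Lemma TA_Rn_repr (t : TA A (Rn R n)) :
  has_rep t (@TARep R A (Rn R n) setT id (TA_Rn A n t)).
Proof.
apply: (@TA_chart_domE (Rn R n)); have [p [x [tp px]]] := repr_ex t.
exists (tr_val (push id p setT (@id 'rV[R]_n : Rn R n -> _))).
exact: (repr_push tp px Rn_atlas).
Qed.

Lemma Rn_TAK : cancel (Rn_TA A n) (TA_Rn A n).
Proof. by move=> a; exact: repr_val (TA_Rn_repr _) (Rn_TA_repr a). Qed.

Lemma TA_RnK : cancel (TA_Rn A n) (Rn_TA A n).
Proof. by move=> t; exact: TA_point_eq (Rn_TA_repr _) (TA_Rn_repr t). Qed.

Lemma TA_Rn_smooth : msmooth (TA_Rn A n : TA A (Rn R n) -> vmanifold (tpower A n)).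
Proof.
have Ec := convenient_tpower n (lca_convenient A).
move=> g gS; apply/(vmanifold_mcurve _ Ec).
apply: smooth_curve_atP; first by have [] := Ec.
move=> t0; have [c [cS _ gc]] := TA_mcurve gS (TA_Rn_repr (g t0)).
apply: smooth_at_near cS; apply: filterS gc => t gt.
exact: repr_val gt (TA_Rn_repr _).
Qed.

Lemma Rn_TA_smooth : msmooth (Rn_TA A n : vmanifold (tpower A n) -> TA A (Rn R n)).
Proof.
have Ec := convenient_tpower n (lca_convenient A).
move=> c /(vmanifold_mcurve _ Ec) cS; apply: TA_mcurveP => t0.
exists setT, id, c; split; first exact: smooth_curve_smooth_at.
by near=> t; exact: Rn_TA_repr.
Unshelve. all: by end_near. Qed.

Lemma Rn_local_rep m (f : 'rV[R]_n -> 'rV[R]_m) :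
  @local_rep R (Rn R n) (Rn R m) (Chart setT id) (Chart setT id) f = f.
Proof. by apply/funext => x; exact: (@local_repE _ (Rn R n) (Rn R m)). Qed.

End Euclidean.

Lemma TA_map_Rn n m (f : 'rV[R]_n -> 'rV[R]_m) (a : tpower A n) : smooth f ->
  TA_map A (f : Rn R n -> Rn R m) (Rn_TA A n a) = Rn_TA A m (lca_interp f a).
Proof.
move=> fS; have ax : lies_over (@TARep R A (Rn R n) setT id a) (aug_pow a).
  by split=> //; exact: Rn_atlas.
have := TA_map_repr (msmooth_Rn fS) (Rn_TA_repr a) ax (Rn_atlas m) I.
rewrite /push [local_rep _ _ _]Rn_local_rep /= (@TA_locE _ _ _ _ _ f)//; last exact: filterE.
by move=> /TA_point_eq; apply; exact: Rn_TA_repr.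
Qed.

End TAManifold.

(** * Natural transformations *)

Section Homomorphisms.
Context {R : realType} (A B : local_convenient_algebra R) (psi : A -> B).
Hypothesis psiH : cinf_hom (@lca_interp R A) (@lca_interp R B) psi.

Lemma hom_interp1 n (f : 'rV[R]_n -> R) (a : 'I_n -> A) : smooth f ->
  psi (interp1 f a) = interp1 f (psi \o a).
Proof. by move=> /smooth_row1/psiH/(_ a)/(congr1 (@^~ ord0)). Qed.

Let pair2 (T : Type) (x y : T) (i : 'I_2) := if i == 0 then x else y.

Lemma homD : {morph psi : a b / a + b}.
Proof.
move=> a b; rewrite -!lca_add /cinf_add.
have addS : smooth (fun v : 'rV[R]_2 => v ord0 0 + v ord0 1).
  by apply: smoothD; exact: smooth_coord.
rewrite [LHS](hom_interp1 (pair2 a b) addS); congr (lca_interp _ _ _).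
by apply/funext => i /=; rewrite /pair2; case: ifP.
Qed.

Lemma homZ r a : psi (r *: a) = r *: psi a.
Proof.
have fS : smooth (fun v : 'rV[R]_1 => v ord0 ord0) by exact: smooth_coord.
have rS : smooth (fun v : 'rV[R]_1 => r * v ord0 ord0).
  by apply: smoothM => //; exact: smooth_cst.
have Ea : interp1 (fun v : 'rV[R]_1 => v ord0 ord0) (fun=> a) = a by exact: interp1_coord.
by rewrite -[in LHS]Ea -interp1Z// hom_interp1// interp1Z// interp1_coord.
Qed.

(** If the augmentations differed, some X would be 1 near that of psi(a) and 0 near that of a. Then
    A(X)(a) = 0 while B(X)(psi(a)) = 1, and compatibility with psi would give 0 = 1 in B. *)
Lemma aug_hom a : lca_aug (psi a) = lca_aug a.
Proof.
pose a1 : tpower A 1 := fun=> a; pose b1 : tpower B 1 := psi \o a1.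
have [ab|ab] := pselect (aug_pow b1 = aug_pow a1).
  by have := congr1 (fun v : 'rV[R]_1 => v ord0 ord0) ab; rewrite !mxE.
have cl1 (x : 'rV[R]_1) : closed [set x].
  by apply: accessible_closed_set1; exact: hausdorff_accessible (@norm_hausdorff _ _).
have [X [K [XS X1 X0 cK KU]]] : exists (X : 'rV[R]_1 -> R) (K : set 'rV[R]_1),
    [/\ smooth X, \forall y \near aug_pow b1, X y = 1, forall y, ~ K y -> X y = 0,
      compact K & K `<=` ~` [set aug_pow a1]].
  by apply: bump_function; apply: open_nbhs_nbhs; split=> //; exact: closed_openC.
have cst_S r : smooth (fun _ : 'rV[R]_1 => r) by exact: smooth_cst.
have Xa : interp1 X a1 = interp1 (fun=> 0) a1.
  apply: interp1_germ => //.
  have : \forall y \near aug_pow a1, (~` K) y.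
    apply: open_nbhs_nbhs; split; last by move=> /KU; apply.
    by apply: closed_openC; apply: compact_closed => //; exact: norm_hausdorff.
  by apply: filterS => y /X0.
have Xb : interp1 X b1 = interp1 (fun=> 1) b1 by exact: interp1_germ.
have := hom_interp1 a1 XS; rewrite -/b1 Xa Xb hom_interp1//.
rewrite -/b1 !interp1_cst scale0r scale1r => /esym one0.
by case: (one_neq0 one0).
Qed.

Lemma aug_pow_hom n (a : tpower A n) : aug_pow (psi \o a : tpower B n) = aug_pow a.
Proof. by apply/rowP => i; rewrite !mxE aug_hom. Qed.

(** As psi preserves base points, one global representative of the germ serves at both a and its
    image. *)
Lemma hom_TA_loc n m (f : 'rV[R]_n -> 'rV[R]_m) (a : tpower A n) :
  smooth_germ_at f (aug_pow a) ->
  psi \o TA_loc f a = TA_loc f (psi \o a : tpower B n).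
Proof.
move=> [g gS gf]; rewrite (TA_locE gS gf) (TA_locE gS) ?aug_pow_hom//.
exact: psiH.
Qed.

Lemma hom_lies_over (M : fmanifold R) U u a x :
  lies_over (@TARep R A M U u a) x -> lies_over (@TARep R B M U u (psi \o a)) x.
Proof. by move=> [pA px xp]; split=> //=; rewrite aug_pow_hom. Qed.

Lemma hom_push (M N : fmanifold R) (f : M -> N) U u a x V v : msmooth f ->
  lies_over (@TARep R A M U u a) x -> atlas N (Chart V v) -> V (f x) ->
  psi \o tr_val (push f (@TARep R A M U u a) V v) =
  tr_val (push f (@TARep R B M U u (psi \o a)) V v).
Proof.
move=> fS [/= uA Ux xa] vA Vfx; rewrite /push /= hom_TA_loc// -xa.
exact: rep_germ.
Qed.

(** The choice in [T_hom] may use another chart; the two answers agree because psi commutes with the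
    transition maps. *)
Lemma T_hom_repr (M : fmanifold R) (t : TA A M) U u a :
  has_rep t (TARep U u a) -> has_rep (T_hom psi t) (TARep U u (psi \o a)).
Proof.
move=> ta; have [x xa] := repr_over ta; rewrite /T_hom; set S := [set _ | _].
have : S (pick_or (TA_zero B (TA_base t)) S).
  have xb := hom_lies_over xa.
  apply: pick_orP; exists (TA_class ((TA_validP _).2 (ex_intro _ _ xb))), U, u, a.
  by split=> //; apply: TA_glue_refl; apply/TA_validP; exists x.
move=> [V [v [b [tb sb]]]].
have [[vA Vx xv] _] := repr_eq ta tb xa.
have xb : lies_over (TARep V v b) x by [].
have [_ /(congr1 (@tr_val R A M)) /= aE] := repr_eq tb ta xb; have [uA Ux _] := xa.
rewrite [in X in has_rep _ X]aE.
have := repr_push sb (hom_lies_over xb) uA Ux.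
by have := hom_push (@msmooth_id _ M) xb uA Ux; rewrite /push /= => <-.
Qed.

Lemma T_hom_natural : bounded_map psi -> natural (T_hom psi).
Proof.
move=> psiB; have psiS := linear_bounded_smooth homD homZ psiB.
split=> [M g gS|M N f fS].
  apply: TA_mcurveP => t0; have [[U u a] [x [ga xa]]] := repr_ex (g t0).
  have [c [cS c0 gc]] := TA_mcurve gS ga.
  exists U, u, (fun t => psi \o c t); split; last first.
    by apply: filterS gc => t /T_hom_repr.
  apply: (smooth_on_at (U := setT) (f := fun b : tpower A _ => psi \o b : tpower B _) _ _ cS I).
    move=> d dS _; apply: smooth_curve_tpower => i.
    by apply: psiS => //; exact: smooth_tpower_coord.
  exact/open_cinf_open/openT.
apply/funext => t /=; have [[U u a] [x [ta xa]]] := repr_ex t.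
have [V [v [vA Vfx]]] := fm_chart (f x).
have lhs := T_hom_repr (TA_map_repr fS ta xa vA Vfx).
have rhs := TA_map_repr fS (T_hom_repr ta) (hom_lies_over xa) vA Vfx.
apply: TA_point_eq rhs; move: lhs.
by have := hom_push fS xa vA Vfx; rewrite /push /= => ->.
Qed.

Lemma at_R_T_hom : at_R (T_hom psi) = psi.
Proof.
apply/funext => a; rewrite /at_R.
have := T_hom_repr (Rn_TA_repr (fun _ : 'I_1 => a : A)).
by move=> /(repr_val (TA_Rn_repr _)) ->.
Qed.

End Homomorphisms.

(** * Recovering a natural transformation from its value on the line *)

Section NaturalTransformations.
Context {R : realType} (A B : local_convenient_algebra R).

(* Separation is what makes the extension by zero smooth: the support of the bump
   function is compact in the chart, hence closed in the manifold. *)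
Lemma chart_extension (M : fmanifold R) U (u : M -> 'rV[R]_(fm_dim M)) x m
    (k : 'rV[R]_(fm_dim M) -> 'rV[R]_m) (O : set 'rV[R]_(fm_dim M)) :
  atlas M (Chart U u) -> U x -> smooth k -> nbhs (u x) O ->
  exists F : M -> 'rV[R]_m, [/\ msmooth (F : M -> Rn R m),
    \forall e \near u x, forall y, U y -> u y = e -> F y = k e &
    forall y, F y <> 0 -> U y /\ O (u y)].
Proof.
move=> uA Ux kS Ox; have uI := fm_chart_inj uA.
have uUo : open (u @` U) by have := fm_chart_open uA uA; rewrite setIid.
have uUx : nbhs (u x) (u @` U) by apply: open_nbhs_nbhs; split=> //; exists x.
have [X [K [XS X1 X0 cK KO]]] := bump_function (filterI Ox uUx).
exists (fun y => if `[< U y >] then X (u y) *: k (u y) else 0); split.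
- move=> g gS; apply/(vmanifold_mcurve _ (convenient_rV m)).
  apply: smooth_curve_atP; first exact: norm_hausdorff.
  move=> t0; have [Ug|nUg] := pselect (U (g t0)).
    have [gU ugS] := mcurve_chart (t0 := t0) (fm_manifold M) gS uA Ug.
    have XkS := smoothZ XS kS.
    have : smooth_at ((fun e => X e *: k e) \o (u \o g)) t0.
      apply: (smooth_on_at XkS _ ugS I).
      by move=> d _; rewrite preimage_setT; exact: openT.
    apply: smooth_at_near; apply: filterS gU => t gt /=.
    by rewrite ifT//; exact/asboolP.
  exists (fun=> 0); first exact: smooth_curve_cst.
  (* For t near t0 the point g(t) is not in the part of U lying over K. Each point of that part is
     separated from g(t0) by open sets, and compactness of K makes the times uniform. *)
  have : \forall t \near t0, K `<=` [set z | ~ (U (g t) /\ u (g t) = z)].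
    have /compact_near_coveringP := cK.
    move=> /(_ R (nbhs t0) (fun t z => ~ (U (g t) /\ u (g t) = z)) _); apply.
    move=> _ /KO[_ [y Uy <-]].
    have gy : g t0 <> y by move=> gy; apply: nUg; rewrite gy.
    have [U1 [U2 [oU1 oU2 U1g U2y U12]]] := fm_hausdorff gy.
    have g1 := mcurve_open (fm_manifold M) gS oU1 U1g.
    have u2 : nbhs (u y) (u @` (U2 `&` U)).
      apply: open_nbhs_nbhs; split; last by exists y.
      by apply: cinf_open_rV; exact: oU2 uA.
    exists (u @` (U2 `&` U), [set t | U1 (g t)]); first by split.
    move=> [_ t] /= [[y' [U2y' Uy'] <-] U1t] [Ut uty].
    have ty : g t = y' by apply: uI; rewrite ?inE.
    suff : (U1 `&` U2) (g t) by rewrite U12.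
    by split=> //; rewrite ty.
  apply: filterS => t Kt /=; case: asboolP => // Ut.
  by rewrite X0 ?scale0r// => /Kt; apply.
- apply: filterS X1 => e Xe y Uy ye.
  by rewrite ifT; [rewrite ye Xe scale1r|exact/asboolP].
- move=> y; case: asboolP => // Uy Xk; split=> //.
  have /KO[] // : K (u y).
  by apply: contrapT => /X0 Xy; apply: Xk; rewrite Xy scale0r.
Qed.

Lemma TA_map_base (C : local_convenient_algebra R) (M : fmanifold R) m
    (f : M -> Rn R m) (s : TA C M) q y b : msmooth f -> has_rep s q ->
  lies_over q y -> TA_map C f s = Rn_TA C m b -> aug_pow b = f y.
Proof.
move=> fS sq qy fs.
have fr := TA_map_repr fS sq qy (Rn_atlas m) I; rewrite fs in fr.
have fo := push_over fS qy (Rn_atlas m) I.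
by have [[_ _ /= fyb] _] := repr_eq fr (Rn_TA_repr b) fo; rewrite -fyb.
Qed.

(** A global map agreeing with u near the base point reads off the coordinate a, which makes the
    points of T_A M visible from T_A(R^n). *)
Lemma TA_map_chart (C : local_convenient_algebra R) (M : fmanifold R) U u
    (F : M -> Rn R (fm_dim M)) (s : TA C M) a x : msmooth F ->
  has_rep s (TARep U u a) -> lies_over (TARep U u a) x ->
  (\forall e \near u x, forall y, U y -> u y = e -> F y = e) ->
  TA_map C F s = Rn_TA C _ a.
Proof.
move=> FS sa xa Fu; have := TA_map_repr FS sa xa (Rn_atlas _) I.
have [uA Ux xu] := xa; rewrite /= in uA Ux xu.
have -> : push F (TARep U u a) setT id = @TARep R C (Rn R (fm_dim M)) setT id a.
  rewrite /push; congr TARep; apply: TA_loc_id => /=; rewrite -xu.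
  have := rep_near FS uA (Rn_atlas _) Ux I.
  apply: filterS2 Fu => e Fe [y [Uy ye _]].
  rewrite -{2}ye (@local_repE _ _ _ (Chart U u) (Chart setT id : chart R (Rn R _)))//.
    by rewrite /= (Fe y).
  exact: fm_chart_inj uA.
by move=> sF; exact: TA_point_eq sF (Rn_TA_repr a).
Qed.

Variable phi : forall M : fmanifold R, TA A M -> TA B M.
Hypothesis phiN : natural phi.
Let psi := at_R phi.

Let phi_nat (M N : fmanifold R) (f : M -> N) t : msmooth f ->
  phi (TA_map A f t) = TA_map B f (phi t).
Proof. by move=> fS; have [_ /(_ _ _ _ fS)/(congr1 (@^~ t))] := phiN. Qed.

Lemma natural_Rn n (a : tpower A n) : phi (Rn_TA A n a) = Rn_TA B n (psi \o a).
Proof.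
rewrite -[LHS]TA_RnK; congr (Rn_TA B n _); set b := TA_Rn B n _.
apply/funext => i /=.
pose pr (v : 'rV[R]_n) : 'rV[R]_1 := \row_(_ < 1) v ord0 i.
have prS : smooth pr by apply: smooth_row1; exact: smooth_coord.
have := phi_nat (Rn_TA A n a) (msmooth_Rn prS).
rewrite -[phi (Rn_TA A n a)]TA_RnK -/b !TA_map_Rn//.
rewrite (cinf_proj (lca_cinf A)) (cinf_proj (lca_cinf B)).
by rewrite /psi /at_R => ->; rewrite Rn_TAK.
Qed.

Lemma at_R_hom : cinf_hom (@lca_interp R A) (@lca_interp R B) psi.
Proof.
move=> n m f fS a; apply: (can_inj (@Rn_TAK _ B m)).
transitivity (phi (Rn_TA A m (lca_interp f a))); first exact/esym/natural_Rn.
rewrite -TA_map_Rn// phi_nat; last exact: msmooth_Rn.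
by rewrite natural_Rn TA_map_Rn.
Qed.

Lemma at_R_bounded : bounded_map psi.
Proof.
apply: linear_smooth_bounded => [|c cS]; first exact: homZ at_R_hom.
apply: smooth_curve_continuous.
have c1S : smooth_curve (fun t => (fun=> c t) : tpower A 1).
  by apply: smooth_curve_tpower => _.
have c1M : smooth_mcurve ((fun t => (fun=> c t)) : R -> vmanifold (tpower A 1)).
  exact/(vmanifold_mcurve _ (convenient_tpower 1 (lca_convenient A))).
have := TA_Rn_smooth (phiN.1 _ _ (Rn_TA_smooth c1M)).
move=> /(vmanifold_mcurve _ (convenient_tpower 1 (lca_convenient B))).
by move=> /(smooth_tpower_coord (ord0 : 'I_1)); apply.
Qed.

(** Take F equal to 1 near x and 0 at y. Naturality for F makes psi send an element over F(x) to one
    over F(y), and psi preserves augmentations. *)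
Lemma natural_base (M : fmanifold R) (t : TA A M) p q x y : has_rep t p ->
  lies_over p x -> has_rep (phi t) q -> lies_over q y -> x = y.
Proof.
move=> tp px tq qy; apply: contrapT => xy.
have [U [u [uA Ux]]] := fm_chart x; have uI := fm_chart_inj uA.
(* The condition is empty when y is outside U, since F is then 0 at y anyway. *)
pose O := [set e | U y -> e <> u y].
have Ox : nbhs (u x) O.
  have [Uy|nUy] := pselect (U y); last by apply: filterE => e /nUy.
  have : open (~` [set u y]).
    apply: closed_openC; apply: accessible_closed_set1.
    exact: hausdorff_accessible (@norm_hausdorff _ _).
  move=> oy; have : nbhs (u x) (~` [set u y]).
    apply: open_nbhs_nbhs; split=> // /(uI x y (mem_set Ux) (mem_set Uy)).
    exact: xy.
  by apply: filterS => e ey _.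
have [F [FS Fx FO]] := chart_extension (k := fun=> const_mx 1 : 'rV[R]_1) uA Ux
  (@smooth_cst _ _ _ _) Ox.
have hx := TA_map_base FS tp px (esym (TA_RnK _)).
have hy : aug_pow (psi \o TA_Rn A 1 (TA_map A (F : M -> Rn R 1) t) : tpower B 1) = F y.
  by apply: (TA_map_base FS tq qy); rewrite -phi_nat// -natural_Rn TA_RnK.
have FxFy : F x = F y by rewrite -hx -hy aug_pow_hom//; exact: at_R_hom.
have Fx1 : F x = const_mx 1 by apply: (nbhs_singleton Fx).
have [Uy Oy] : U y /\ O (u y).
  apply: FO; rewrite -FxFy Fx1 => /(congr1 (fun v : 'rV[R]_1 => v ord0 ord0)).
  by rewrite !mxE => /eqP; rewrite oner_eq0.
exact: Oy.
Qed.

Lemma T_hom_at_R : T_hom psi = phi.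
Proof.
apply: functional_extensionality_dep => M; apply/funext => t.
have [[U u a] [x [ta xa]]] := repr_ex t; have [uA Ux xu] := xa.
have [q [y [tq qy]]] := repr_ex (phi t).
(* Equal base points allow phi(t) to be represented in the chart already used for t. *)
have xy := natural_base ta xa tq qy; rewrite -xy in qy.
have tb := repr_push tq qy uA Ux; rewrite /push /= in tb.
set b := TA_loc _ _ in tb.
have idS : smooth (@id 'rV[R]_(fm_dim M)) by move=> c cS _.
(* Here F extends u itself from a neighbourhood of x; reading t and phi(t) through F compares a with
   b by naturality on R^n. *)
have [F [FS Fx _]] := chart_extension uA Ux idS (@filterT _ (nbhs (u x)) _).
have xb : lies_over (TARep U u b) x by exact: (@push_over _ _ _ _ id q U u x).
have Ea := TA_map_chart FS ta xa Fx; have Eb := TA_map_chart FS tb xb Fx.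
have ab : b = psi \o a.
  by apply: (can_inj (@Rn_TAK _ B _)); rewrite -Eb -natural_Rn -Ea phi_nat.
rewrite ab in tb.
exact: TA_point_eq (T_hom_repr at_R_hom ta) tb.
Qed.

End NaturalTransformations.

Theorem theorem4p7 (R : realType) (A B : local_convenient_algebra R) :
  is_functor (@TA_map R A) /\
  ((forall n,
      [/\ cancel (TA_Rn A n) (Rn_TA A n), cancel (Rn_TA A n) (TA_Rn A n),
          msmooth (TA_Rn A n : TA A (Rn R n) -> vmanifold (tpower A n)) &
          msmooth (Rn_TA A n : vmanifold (tpower A n) -> TA A (Rn R n))]) /\
   (forall n m (f : 'rV[R]_n -> 'rV[R]_m), smooth f ->
      TA_Rn A m \o TA_map A (f : Rn R n -> Rn R m) =
      lca_interp f \o TA_Rn A n)) /\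
  ([/\ forall phi : (forall M, TA A M -> TA B M),
         natural phi -> bounded_hom (at_R phi),
       forall psi : A -> B, bounded_hom psi -> natural (T_hom psi),
       forall phi : (forall M, TA A M -> TA B M),
         natural phi -> T_hom (at_R phi) = phi &
       forall psi : A -> B, bounded_hom psi -> at_R (T_hom psi) = psi]).
Proof.
split; first exact: TA_is_functor.
split; first split.
- by move=> n; split; [exact: TA_RnK|exact: Rn_TAK|exact: TA_Rn_smooth|
    exact: Rn_TA_smooth].
- move=> n m f fS; apply/funext => t /=.
  by rewrite -[in LHS](TA_RnK t) TA_map_Rn// Rn_TAK.
- split.
  + by move=> phi phiN; split; [exact: at_R_hom|exact: at_R_bounded].
  + by move=> psi [psiH psiB]; exact: T_hom_natural.
  + exact: T_hom_at_R.
  + by move=> psi [psiH _]; exact: at_R_T_hom.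
Qed.
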